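(* Let $\Gamma$ be a Feynman graph of genus $g>1$. Then $N_{\underline a,\Gamma}^{\operatorname{trop}}=0$ for every $\underline a\in\mathbb{N}^{3g-3}$ (with $0\in\mathbb N$), or equivalently $I_\Gamma(q_1,\dots,q_{3g-3})=0$, if and only if $\Gamma$ contains a bridge.
   Context: A bridge of a connected graph is an edge whose removal produces two connected components. **Feynman graphs.** A Feynman graph $\Gamma$ of genus $g$ is a trivalent connected graph of genus (first Betti number) $g$, equipped with a fixed reference labeling $x_1,\dots,x_{2g-2}$ of its vertices and $q_1,\dots,q_{3g-3}$ of its edges. **Tropical covers.** A tropical curve $C$ is a connected, finite, trivalent metric graph. A tropical elliptic curve $E$ is a circle of fixed length. A map $\pi:C\to E$ is a tropical cover if it is continuous, non-constant, integer affine on each edge, and balanced at every vertex $P$ of $C$: writing $w_e$ (weight of $e$) for the absolute value of the slope of $\pi_{|e}$, and letting $r_1,r_2$ be the two rays of a small neighbourhood $U$ of $\pi(P)$, among the three rays $R$ adjacent to $P$ in the component of $\pi^{-1}(U)$ containing $P$ one has $\sum_{R\mapsto r_1}w_R=\sum_{R\mapsto r_2}w_R$ (rays inherit the weights of their edges). The degree is the number of preimages of a point $p\in E$ not having a vertex as preimage, counted with the weights of the edges containing them. The branch points are the images of the vertices. A labeled tropical cover $\hat\pi:C\to E$ of type $\Gamma$ is a tropical cover together with a labeling of the vertices and edges of $C$ such that the labeled underlying graph of $C$ is $\Gamma$ with its reference labeling; isomorphisms (isometries of source curves commuting with the maps to $E$) must respect labels, and labeled covers are considered up to isomorphism. **Counts.**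 Fix pairwise distinct points $p_0,p_1,\dots,p_{2g-2}\in E$. For $\underline a=(a_1,\dots,a_{3g-3})$, $N_{\underline a,\Gamma}^{\operatorname{trop}}$ is the weighted number of labeled tropical covers $\hat\pi:C\to E$ of type $\Gamma$ and degree $\sum_i a_i$, having their branch points at the prescribed positions $p_1,\dots,p_{2g-2}$ and satisfying $\#(\hat\pi^{-1}(p_0)\cap q_i)\cdot w_i=a_i$ for all $i$, each counted with multiplicity $\prod_{i=1}^{3g-3}w_i$, where $w_i$ is the weight of the edge $q_i$. **Refined Feynman integrals.** The propagator is $P(z,q):=\frac{1}{4\pi^2}\wp(z,q)+\frac1{12}E_2(q^2)$, where $q=e^{i\pi\tau}$ with $\tau$ in the upper half plane, $\wp(z,q)$ is the Weierstrass $\wp$-function of the lattice $\mathbb{Z}+\mathbb{Z}\tau$, and $E_2(q)=1-24\sum_{d\ge1}\sigma(d)q^d$, $\sigma(d)=\sum_{m\mid d}m$. For an edge $q_k$ of $\Gamma$ connecting $x_i$ and $x_j$ put $P_k:=P(z_i-z_j,q_k)$ (the sign of $z_i-z_j$ is irrelevant), with independent variables $q_k=e^{i\pi\tau_k}$. For a total ordering $\Omega$ of the vertices choose pairwise different small real numbers $y_1,\dots,y_{2g-2}$ whose order equals $\Omega$, and paths $\gamma_j:[0,1]\to\mathbb{C}$, $t\mapsto iy_j+t$ (small means $|y_i-y_j|<\operatorname{Im}\tau_k$ for all $i,j,k$). Set $$I_{\Gamma,\Omega}(q_1,\dots,q_{3g-3}):=\int_{z_j\in\gamma_j}\prod_{k=1}^{3g-3}(-P_k),\qquad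 I_\Gamma(q_1,\dots,q_{3g-3}):=\sum_\Omega I_{\Gamma,\Omega}(q_1,\dots,q_{3g-3}),$$ where the integral is over all variables $z_1,\dots,z_{2g-2}$ and the sum is over all $(2g-2)!$ orders $\Omega$ of the vertices. *)

(* Defs.v *)
From HB Require Import structures.
From mathcomp Require Import all_boot all_order all_fingroup all_algebra.
From mathcomp Require Import generic_quotient.
From mathcomp Require Import all_classical all_reals all_analysis.
From mathcomp Require Import complex.

Set Implicit Arguments.
Unset Strict Implicit.
Unset Printing Implicit Defensive.

Import Order.TTheory GRing.Theory Num.Theory.
Import numFieldNormedType.Exports.

Local Open Scope classical_set_scope.
Local Open Scope ring_scope.
Local Open Scope complex_scope.
Local Open Scope quotient_scope.

(** * Feynman graphs *)

(* A multigraph (loops and multiple edges allowed) with vertices x_0, ...,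
   x_(n-1) and edges q_0, ..., q_(m-1).  The orientation of the edges is
   auxiliary: it only serves to write down coordinates. *)
Record graph (n m : nat) := Graph {
  etail : 'I_m -> 'I_n;
  ehead : 'I_m -> 'I_n }.

Definition edge_adjacent n m (G : graph n m) (S : {set 'I_m}) : rel 'I_n :=
  fun u v => [exists k in S, ((etail G k == u) && (ehead G k == v))
                          || ((etail G k == v) && (ehead G k == u))].

(* Number of connected components of the graph with all the vertices of G and
   the edges in S. *)
Definition ncomponents n m (G : graph n m) (S : {set 'I_m}) : nat :=
  n_comp (edge_adjacent G S) predT.

Definition is_connected n m (G : graph n m) : Prop :=
  ncomponents G [set: 'I_m]%SET = 1%N.

Definition genus n m (G : graph n m) : nat :=
  (m + ncomponents G [set: 'I_m]%SET - n)%N.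

(* A ray (half-edge) is a pair (k, b): the germ of the edge k at its tail for
   b = false, at its head for b = true. *)
Definition ray_vertex n m (G : graph n m) (r : 'I_m * bool) : 'I_n :=
  if r.2 then ehead G r.1 else etail G r.1.

Definition trivalent n m (G : graph n m) : Prop :=
  forall v : 'I_n, #|[set r : 'I_m * bool | ray_vertex G r == v]%SET| = 3%N.

Definition feynman (g : nat) (G : graph (2 * g - 2) (3 * g - 3)) : Prop :=
  [/\ is_connected G, trivalent G & genus G = g].

Definition bridge n m (G : graph n m) (k : 'I_m) : Prop :=
  ncomponents G [set~ k]%SET = 2%N.

(** * The tropical elliptic curve: the circle R / L Z *)

Definition circle_rel (R : realType) (L : R) : rel R :=
  fun x y => `[< exists z : int, x - y = z%:~R * L >].

Lemma circle_rel_class (R : realType) (L : R) :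
  equiv_class_of (circle_rel L).
Proof.
split.
- by move=> x; apply/asboolP; exists 0; rewrite subrr mul0r.
- move=> x y; apply/asboolP/asboolP => -[z xy]; exists (- z);
  by rewrite -opprB xy mulrNz mulNr.
- move=> y x z /asboolP[i xy] /asboolP[j yz]; apply/asboolP; exists (i + j).
  by rewrite intrD mulrDl -xy -yz addrA subrK.
Qed.

Canonical circle_equiv (R : realType) (L : R) :=
  EquivRelPack (circle_rel_class L).

Definition circle (R : realType) (L : R) : Type :=
  quotient_topology {eq_quot (circle_equiv L)}.

HB.instance Definition _ (R : realType) (L : R) :=
  Topological.copy (circle L) (quotient_topology {eq_quot (circle_equiv L)}).

Definition circle_pt (R : realType) (L x : R) : circle L :=
  (\pi_{eq_quot (circle_equiv L)} x)%qT.

(** * Tropical curves with labeled underlying graph G *)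

Record tropical_curve (R : realType) n m (G : graph n m) := TropicalCurve {
  len : 'I_m -> R;
  len_gt0 : forall k, 0 < len k }.

(* The points of the metric graph: the edge k is a segment [0, len k] whose end
   0 (resp. len k) is glued to the vertex etail G k (resp. ehead G k). *)
Inductive curve_point (R : realType) n m (G : graph n m)
    (C : tropical_curve R G) : Type :=
| Vertex (v : 'I_n)
| Inner (k : 'I_m) (t : R) of 0 < t < len C k.

Arguments Vertex {R n m G} C v.
Arguments Inner {R n m G} C k t _.

(* The parametrisation of the closed edge k by [0, len k]; the values outside
   this segment are never used. *)
Definition chart (R : realType) n m (G : graph n m) (C : tropical_curve R G)
    (k : 'I_m) (t : R) : curve_point C :=
  match @idP (0 < t < len C k) with
  | ReflectT h => Inner C k t h
  | ReflectF _ => Vertex C (if t <= 0 then etail G k else ehead G k)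
  end.

(** * Tropical covers *)

(* The slope of a map on the edge k, seen along a ray pointing away from its
   vertex; the ray is mapped to the ray of the circle in the positive
   (resp. negative) direction when it is > 0 (resp. < 0). *)
Definition ray_slope m (s : 'I_m -> int) (r : 'I_m * bool) : int :=
  if r.2 then - s r.1 else s r.1.

Definition balanced n m (G : graph n m) (s : 'I_m -> int) (v : 'I_n) : Prop :=
  (\sum_(r | (ray_vertex G r == v) && (0 < ray_slope s r)) `|s r.1|
   = \sum_(r | (ray_vertex G r == v) && (ray_slope s r < 0)) `|s r.1| :> int).

(* The labeled tropical covers C -> R / L Z of type G.  As C carries the
   topology glued from the segments [0, len k], a map on C is continuous iff
   its restriction to every closed edge is.  The slopes are determined by the
   map, for L > 0. *)
Record tropical_cover (R : realType) n m (G : graph n m) (L : R) :=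
  TropicalCover {
    source :> tropical_curve R G;
    cover_map : curve_point source -> circle L;
    slope : 'I_m -> int;
    cover_continuous : forall k,
      {within `[0, len source k], continuous (cover_map \o chart source k)};
    cover_nonconstant : exists x y, cover_map x <> cover_map y;
    cover_affine : forall k, exists x0 : R, forall t, 0 <= t <= len source k ->
      cover_map (chart source k t) = circle_pt L (x0 + (slope k)%:~R * t);
    cover_balanced : forall v, balanced G slope v }.

HB.instance Definition _ (R : realType) n m (G : graph n m) (L : R) :=
  gen_eqMixin (tropical_cover G L).
HB.instance Definition _ (R : realType) n m (G : graph n m) (L : R) :=
  gen_choiceMixin (tropical_cover G L).

(* Label-preserving isometries of the metric graphs: bijections that fix the
   vertex labels and map the edge k isometrically onto the edge k. *)
Definition labeled_isometry (R : realType) n m (G : graph n m)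
    (C C' : tropical_curve R G) (phi : curve_point C -> curve_point C') : Prop :=
  [/\ bijective phi,
      forall v, phi (Vertex C v) = Vertex C' v &
      forall k, exists sigma : R -> R,
        [/\ set_bij `[0, len C k] `[0, len C' k] sigma,
            {in `[0, len C k] &, forall s t, `|sigma s - sigma t| = `|s - t|} &
            {in `[0, len C k], forall t,
               phi (chart C k t) = chart C' k (sigma t)}]].

Definition labeled_iso (R : realType) n m (G : graph n m) (L : R) :
    rel (tropical_cover G L) :=
  fun c c' => `[< exists phi : curve_point c -> curve_point c',
    labeled_isometry phi /\ (forall x, cover_map (phi x) = cover_map x) >].

Lemma labeled_iso_class (R : realType) n m (G : graph n m) (L : R) :
  equiv_class_of (@labeled_iso R n m G L).
Proof.
have sym (c c' : tropical_cover G L) : labeled_iso c c' -> labeled_iso c' c.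
  move=> /asboolP[phi [[[psi phiK psiK] phiv phie] phim]].
  apply/asboolP; exists psi; split; last by move=> x; rewrite -phim psiK.
  split; first by exists phi.
    by move=> v; rewrite -phiv phiK.
  move=> k; have [sigma [bsigma isigma esigma]] := phie k.
  have [fs /= inj surj] := bsigma.
  pose tau y := xget 0 [set x | x \in `[0, len c k] /\ sigma x = y].
  have tauP y : y \in `[0, len c' k] ->
      tau y \in `[0, len c k] /\ sigma (tau y) = y.
    move=> yl; have [x xl xy] := surj y yl.
    by rewrite /tau; case: xgetP => [z _ //|/(_ x)]; case; split.
  have sigmaI x : x \in `[0, len c k] -> sigma x \in `[0, len c' k].
    by move=> xl; exact: (fs x).
  have tauK x : x \in `[0, len c k] -> tau (sigma x) = x.
    move=> xl; have [tl ts] := tauP _ (sigmaI _ xl).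
    by apply: inj => //; rewrite inE.
  exists tau; split.
  - split => [y yl|y z|x xl].
    + exact: (tauP y yl).1.
    + rewrite !inE /= => yl zl yz.
      by rewrite -(tauP y yl).2 yz (tauP z zl).2.
    + by exists (sigma x); [exact: sigmaI|exact: tauK].
  - move=> y z yl zl; have [ty sy] := tauP y yl; have [tz sz] := tauP z zl.
    by rewrite -{2}sy -{2}sz isigma.
  - move=> y yl; have [ty sy] := tauP y yl.
    by rewrite -[in LHS]sy -esigma// phiK.
split.
- move=> c; apply/asboolP; exists id; split => //; split => //.
    by exists id.
  by move=> k; exists id; split => //; split => // x xl; exists x.
- by move=> c c'; apply/idP/idP; exact: sym.
- move=> c2 c1 c3 /asboolP[phi [[bphi phiv phie] phim]].
  move=> /asboolP[psi [[bpsi psiv psie] psim]].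
  apply/asboolP; exists (psi \o phi); split; last first.
    by move=> x /=; rewrite psim phim.
  split; first exact: bij_comp.
    by move=> v /=; rewrite phiv psiv.
  move=> k; have [s [bs is_ es]] := phie k; have [t [bt it et]] := psie k.
  have sI x : x \in `[0, len c1 k] -> s x \in `[0, len c2 k].
    by move=> xl; have [fs _ _] := bs; exact: (fs x).
  exists (t \o s); split.
  - exact: set_bij_comp bs bt.
  - by move=> x y xl yl /=; rewrite it ?sI// is_.
  - by move=> x xl /=; rewrite es// et ?sI.
Qed.

Canonical labeled_iso_equiv (R : realType) n m (G : graph n m) (L : R) :=
  EquivRelPack (@labeled_iso_class R n m G L).

Definition cover_class (R : realType) n m (G : graph n m) (L : R) : Type :=
  {eq_quot (@labeled_iso_equiv R n m G L)}.

HB.instance Definition _ (R : realType) n m (G : graph n m) (L : R) :=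
  Choice.copy (cover_class G L) {eq_quot (@labeled_iso_equiv R n m G L)}.

Definition cover_repr (R : realType) n m (G : graph n m) (L : R)
    (K : cover_class G L) : tropical_cover G L :=
  repr (K : {eq_quot (@labeled_iso_equiv R n m G L)}).

(** * Counts of tropical covers *)

Definition weight (R : realType) n m (G : graph n m) (L : R)
  (c : tropical_cover G L) (k : 'I_m) : nat := `|slope c k|%N.

Definition edge_fibre (R : realType) n m (G : graph n m) (L : R)
    (c : tropical_cover G L) (p : circle L) (k : 'I_m) : set (curve_point c) :=
  [set x | (exists2 t, 0 <= t <= len c k & x = chart c k t) /\
           cover_map x = p].

Arguments edge_fibre {R n m G L} c p k _.

(* The fibre over p is finite on the edge k, and its number of points times the
   weight of k is a. *)
Definition fibre_weight (R : realType) n m (G : graph n m) (L : R)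
    (c : tropical_cover G L) (p : circle L) (k : 'I_m) (a : nat) : Prop :=
  exists2 d : nat, (edge_fibre c p k #= `I_d)%card & (d * weight c k)%N = a.

Definition has_degree (R : realType) n m (G : graph n m) (L : R)
    (c : tropical_cover G L) (d : nat) : Prop :=
  forall p : circle L, (forall v, cover_map (Vertex c v) <> p) ->
    exists2 b : 'I_m -> nat,
      (forall k, fibre_weight c p k (b k)) & (\sum_k b k)%N = d.

(* Base points p_0, p_1, ..., p_n: the last n are the branch points. *)
Definition counted (R : realType) n m (G : graph n m) (L : R)
    (p : 'I_n.+1 -> circle L) (a : 'I_m -> nat) (c : tropical_cover G L) : Prop :=
  [/\ range (fun v => cover_map (Vertex c v)) = range (p \o lift ord0),
      has_degree c (\sum_k a k)%N &
      forall k, fibre_weight c (p ord0) k (a k)].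

(* A sum in the extended reals over the isomorphism classes: it does not
   presuppose that they are finitely many, and vanishes only if every counted
   cover has multiplicity 0. *)
Definition Ntrop (R : realType) n m (G : graph n m) (L : R)
    (p : 'I_n.+1 -> circle L) (a : 'I_m -> nat) : \bar R :=
  \esum_(K in [set K : cover_class G L | counted p a (cover_repr K)])
    ((\prod_k weight (cover_repr K) k)%N%:R)%:E.

(** * Refined Feynman integrals *)

Definition clim (R : realType) (u : nat -> R[i]) : R[i] :=
  limn (fun N => complex.Re (u N)) +i* limn (fun N => complex.Im (u N)).

Definition cexp (R : realType) (z : R[i]) : R[i] :=
  (expR (complex.Re z))%:C
  * (cos (complex.Im z) +i* sin (complex.Im z)).

Definition upper_half (R : realType) (z : R[i]) : Prop := 0 < complex.Im z.

Definition lattice_pt (R : realType) (tau : R[i]) (w : int * int) : R[i] :=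
  w.1%:~R + w.2%:~R * tau.

(* The element (i - N, j - N) of [-N, N]^2. *)
Definition square_pt (N : nat) (ij : 'I_(2 * N).+1 * 'I_(2 * N).+1) : int * int :=
  (ij.1%:Z - N%:Z, ij.2%:Z - N%:Z).

(* The lattice sum converges absolutely; it is evaluated by exhausting Z^2 with
   the squares [-N, N]^2. *)
Definition weierstrass_p (R : realType) (z tau : R[i]) : R[i] :=
  z ^- 2 + clim (fun N => \sum_(ij | @square_pt N ij != (0, 0))
    ((z - lattice_pt tau (square_pt ij)) ^- 2
     - lattice_pt tau (square_pt ij) ^- 2)).

Definition divisor_sum (d : nat) : nat := (\sum_(e <- divisors d) e)%N.

Definition E2 (R : realType) (q : R[i]) : R[i] :=
  1 - 24 * clim (fun N => \sum_(1 <= d < N.+1) (divisor_sum d)%:R * q ^+ d).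

(* The propagator P(z, q) at q = exp(i pi tau), as a function of z and tau. *)
Definition propagator (R : realType) (z tau : R[i]) : R[i] :=
  let q := cexp ('i * (pi : R)%:C * tau) in
  weierstrass_p z tau / (4 * (pi : R)%:C ^+ 2) + E2 (q ^+ 2) / 12.

Definition integral01 (R : realType) (f : R -> R[i]) : R[i] :=
  (\int[lebesgue_measure]_(t in `[0, 1]) complex.Re (f t)) +i*
  (\int[lebesgue_measure]_(t in `[0, 1]) complex.Im (f t)).

(* Iterated integral over all the variables t_j in [0, 1], j < n. *)
Definition cube_integral (R : realType) n (f : ('I_n -> R) -> R[i]) : R[i] :=
  foldr (fun j (F : ('I_n -> R) -> R[i]) t =>
           integral01 (fun x => F [eta t with j |-> x]))
        f (enum 'I_n) (fun=> 0).

(* The integral over the paths t |-> i y_j + t, along which dz_j = dt_j. *)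
Definition path_integral (R : realType) n (y : 'I_n -> R)
    (f : ('I_n -> R[i]) -> R[i]) : R[i] :=
  cube_integral (fun t => f (fun j => t j +i* y j)).

(* A total ordering of the vertices is encoded by the permutation Omega that
   sends each vertex to its rank. *)
Definition admissible (R : realType) n m (tau : 'I_m -> R[i]) (Omega : 'S_n)
    (y : 'I_n -> R) : Prop :=
  [/\ injective y,
      forall i j, (y i < y j) = (Omega i < Omega j)%N &
      forall i j k, `|y i - y j| < complex.Im (tau k)].

(* For a loop edge the difference is 0, a pole of the propagator: such a factor
   takes the value given by 0^-1 = 0, a constant in z. *)
Definition feynman_integrand (R : realType) n m (G : graph n m)
    (tau : 'I_m -> R[i]) (z : 'I_n -> R[i]) : R[i] :=
  \prod_k - propagator (z (etail G k) - z (ehead G k)) (tau k).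

(* y Omega are the heights of the paths chosen for the ordering Omega. *)
Definition feynman_integral (R : realType) n m (G : graph n m)
    (tau : 'I_m -> R[i]) (y : 'S_n -> 'I_n -> R) : R[i] :=
  \sum_(Omega : 'S_n) path_integral (y Omega) (feynman_integrand G tau).

(* Main.v *)
Require Import Defs.
From mathcomp Require Import all_boot all_order all_fingroup all_algebra.
From mathcomp Require Import generic_quotient.
From mathcomp Require Import all_classical all_reals all_analysis.
From mathcomp Require Import complex.
From mathcomp Require Import zify ring lra.

(** Both vanishing statements say that the graph has no nowhere-zero integer
flow, and a connected graph has such a flow if and only if it has no bridge.

Flows.  The flow through a bridge is the sum of the divergences on one of its
sides, hence zero ([flow_bridge]).  Conversely, an edge that is not a bridge
lies on a cycle, which carries a unit flow, and a combination of these flows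
with rapidly growing coefficients vanishes on no edge ([nowhere_zero_flow]).

Tropical covers.  The balancing condition says that the slopes of a cover form a
flow, so without a nowhere-zero flow all multiplicities are zero
([Ntrop0_no_flow]).  Given a nowhere-zero flow and the images of the vertices,
lengths of the edges that are compatible with the slopes always exist, which
gives a cover of nonzero multiplicity; its degree is well defined because the
divergence is zero ([cover_of_flow], [fibre_weight_constant], [Ntrop_flow]).

Feynman integrals.  With [w = exp (2 pi i z)] and [Q = exp (2 pi i tau)] the
negative of the propagator has, on the line of height [y], the expansion
[sum_(j != 0) |j| ([j y > 0] + Q ^ |j| / (1 - Q ^ |j|)) w ^ j] without constant
term.  The integral over the positions of the vertices keeps the terms of the
product over the edges that do not depend on these positions, and these are the
terms whose exponents form a flow ([path_integral_limit]).  At a bridge the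
exponent would have to be zero, so nothing is left ([path_integral_bridge]).  If
there is a nowhere-zero flow, all the terms are nonnegative for [tau = i], and
the one of this flow is positive, for each order of the vertices
([path_integral_flow_gt0]).

The expansion of the propagator comes from summing the lattice by rows.  A row
adds up to [(pi / sin (pi z)) ^ 2], which is [- 4 pi ^ 2 w / (1 - w) ^ 2]: by
iterating the duplication formula of the latter and passing to the limit term by
term ([tends_rowsum]).  Summation by squares and by rows differ by an error that
vanishes for growing squares ([row_difference_tail]), and the constant that
remains is cancelled by the Eisenstein series ([E2_kernel],
[propagator_kernel]). *)

Set Implicit Arguments.
Unset Strict Implicit.
Unset Printing Implicit Defensive.

Import Order.TTheory GRing.Theory Num.Theory.
Import numFieldNormedType.Exports.

Local Open Scope ring_scope.


(** * Integer flows on graphs *)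

Section Flows.
Variables (n m : nat) (G : graph n m).
Implicit Types (f : 'I_m -> int) (v : 'I_n) (k : 'I_m) (S : {set 'I_m}).

Definition divergence f v : int :=
  \sum_(k | etail G k == v) f k - \sum_(k | ehead G k == v) f k.

Definition flow f : Prop := forall v, divergence f v = 0.

(** Summation by parts.  It is applied to the indicator function of a set of
vertices, to the number of turns of the vertices around the circle, and to the
real parts of the positions of the vertices. *)
Lemma sum_divergence (V : zmodType) (h : 'I_n -> V) f :
  \sum_k (h (etail G k) - h (ehead G k)) *~ f k = \sum_v h v *~ divergence f v.
Proof.
have sumE (e : 'I_m -> 'I_n) :
    \sum_v h v *~ (\sum_(k | e k == v) f k) = \sum_k h (e k) *~ f k.
  under eq_bigr do rewrite mulrz_sumr.
  rewrite (exchange_big_dep xpredT)//=; apply: eq_bigr => k _.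
  by rewrite (big_pred1 (e k))// => v; rewrite eq_sym.
under [RHS]eq_bigr do rewrite mulrzBr.
under [LHS]eq_bigr do rewrite mulrzBl.
by rewrite !sumrB !sumE.
Qed.

Lemma divergence_rays f v :
  divergence f v = \sum_(r | ray_vertex G r == v) ray_slope f r.
Proof.
rewrite -(pair_big_dep xpredT (fun k b => ray_vertex G (k, b) == v)
  (fun k b => ray_slope f (k, b)))/= /divergence.
rewrite -sumrN big_mkcond [X in _ + X]big_mkcond -big_split/=.
apply: eq_bigr => k _; rewrite big_mkcond big_bool/= /ray_vertex/ray_slope/=.
by rewrite addrC.
Qed.

(** A ray leaves its vertex with the slope of its edge at the tail, and with the
opposite slope at the head, so that the slopes of the rays add up to the
divergence; the balancing condition separates this sum according to sign. *)
Lemma balanced_divergence f v : balanced G f v <-> divergence f v = 0.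
Proof.
have ->: divergence f v =
    \sum_(r | (ray_vertex G r == v) && (0 < ray_slope f r)) `|f r.1|
    - \sum_(r | (ray_vertex G r == v) && (ray_slope f r < 0)) `|f r.1|.
  rewrite divergence_rays (bigID (fun r => 0 < ray_slope f r))/=; congr (_ + _).
    apply: eq_bigr => -[k []]/andP[_]; rewrite /ray_slope/= => h.
      by rewrite -normrN gtr0_norm.
    by rewrite gtr0_norm.
  rewrite -sumrN (bigID (fun r => ray_slope f r < 0))/= [X in _ + X]big1 ?addr0.
    apply: eq_big => [r|]; first by case: ltgtP; rewrite ?andbT ?andbF.
    move=> -[k []]/andP[_]; rewrite /ray_slope/= => h.
      by rewrite gtr0_norm// -oppr_lt0.
    by rewrite ltr0_norm// opprK.
  by move=> r /andP[/andP[_]]; case: ltgtP.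
by rewrite /balanced; split => [->|/eqP]; rewrite ?subrr// subr_eq0 => /eqP.
Qed.

Lemma divergenceD f g v :
  divergence (fun k => f k + g k) v = divergence f v + divergence g v.
Proof. by rewrite /divergence !big_split opprD addrACA. Qed.

Lemma divergenceM (c : int) f v :
  divergence (fun k => c * f k) v = c * divergence f v.
Proof. by rewrite /divergence -!mulr_sumr mulrBr. Qed.

Lemma divergence1 k v :
  divergence (fun j => (j == k)%:Z) v =
  (etail G k == v)%:Z - (ehead G k == v)%:Z.
Proof.
have E (P : pred 'I_m) : \sum_(j | P j) (j == k)%:Z = (P k)%:Z.
  rewrite big_mkcond (bigD1 k)//= eqxx big1 => [|j /negPf->].
    by rewrite addr0; case: (P k).
  by case: ifP.
by rewrite /divergence !E.
Qed.

Lemma edge_adjacentC S : symmetric (edge_adjacent G S).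
Proof.
by move=> u v; apply/existsP/existsP => -[k /andP[kS uv]]; exists k;
  rewrite kS orbC.
Qed.

Lemma connectC S : connect_sym (edge_adjacent G S).
Proof. exact/sym_connect_sym/edge_adjacentC. Qed.

Lemma edge_connect S k : k \in S ->
  connect (edge_adjacent G S) (etail G k) (ehead G k).
Proof. by move=> kS; apply/connect1/existsP; exists k; rewrite kS !eqxx. Qed.

Lemma ncomponents1P S :
  ncomponents G S = 1%N -> forall u v, connect (edge_adjacent G S) u v.
Proof.
move=> n1 u v; rewrite -(root_connect (connectC S)); apply/eqP.
have /eqP := n1; rewrite /ncomponents /n_comp_mem => /card1P[w] r1.
have rw x : fingraph.root (edge_adjacent G S) x = w.
  have := r1 (fingraph.root (edge_adjacent G S) x).
  by rewrite !inE roots_root ?andbT; [move/esym/eqP|exact: connectC].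
by rewrite !rw.
Qed.

Hypothesis connectedG : is_connected G.

(** A step of a path across [k] only leads from one end of [k] to the other, so
the remaining edges suffice if both ends are allowed as starting points. *)
Lemma connect_setC1 k u :
  connect (edge_adjacent G [set~ k]) (etail G k) u
  || connect (edge_adjacent G [set~ k]) (ehead G k) u.
Proof.
set e := edge_adjacent G [set~ k].
pose A := [pred u | connect e (etail G k) u || connect e (ehead G k) u].
suff AP p x : A x -> path (edge_adjacent G [set: 'I_m]) x p -> A (last x p).
  have /connectP[p pp ->] := ncomponents1P connectedG (etail G k) u.
  by apply: AP => //=; rewrite connect0.
elim: p x => // y p IHp x Ax /= /andP[/existsP[j /andP[_ jxy]]]; apply: IHp.
have [jk|jk] := eqVneq j k.
  by rewrite jk in jxy; case/orP: jxy => /andP[/eqP tk /eqP hk];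
    rewrite /A/= -?hk -?tk connect0 ?orbT.
have xy : connect e x y.
  by apply/connect1/existsP; exists j; rewrite !inE jk.
by case/orP: Ax => /= c; rewrite (connect_trans c xy) ?orbT.
Qed.

(** Without [k], every vertex is still joined to one of the ends of [k], so at
most two components remain. *)
Lemma bridgeP k : bridge G k <->
  ~~ connect (edge_adjacent G [set~ k]) (etail G k) (ehead G k).
Proof.
set e := edge_adjacent G _; have eC : connect_sym e := connectC _.
rewrite /bridge /ncomponents -/e; split=> [n2|th].
  apply/negP => th; move: n2; suff -> : n_comp e predT = 1%N by [].
  rewrite -(n_comp_connect eC (etail G k)); apply: eq_n_comp_r => u.
  rewrite !inE; apply/esym; have := connect_setC1 k u.
  by case/orP => // hu; exact: connect_trans hu.
rewrite /n_comp_mem.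
rewrite (eq_card (B := pred2 (fingraph.root e (etail G k))
                             (fingraph.root e (ehead G k)))).
  by rewrite card2 (root_connect eC) th.
move=> u; rewrite !inE andbT; apply/idP/idP => [/eqP <-|].
  by rewrite !(root_connect eC) !(eC u) connect_setC1.
by case/orP => /eqP->; rewrite roots_root.
Qed.

(** Summed over one side of a bridge, the divergence counts the flow through
the bridge and nothing else. *)
Lemma flow_bridge f k : flow f -> bridge G k -> f k = 0.
Proof.
move=> f0 /bridgeP; set e := edge_adjacent G _ => th.
pose h u : int := connect e (etail G k) u.
have := sum_divergence h f; rewrite [RHS]big1 => [|v _]; last first.
  by rewrite f0.
rewrite (bigD1 k)//= big1 => [|j jk].
  by rewrite /h connect0 (negPf th) subr0 addr0 intz.
have tj : connect e (etail G j) (ehead G j) by rewrite edge_connect// !inE.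
suff -> : h (etail G j) = h (ehead G j) by rewrite subrr mul0rz.
congr (nat_of_bool _)%:Z; apply/idP/idP => c; apply: connect_trans c _ => //.
by rewrite connectC.
Qed.

(** A unit of flow sent along the path; an edge that is traversed against its
orientation counts negatively. *)
Lemma path_flow S u p : path (edge_adjacent G S) u p ->
  exists2 f, forall k, k \notin S -> f k = 0
    & forall v, divergence f v = (u == v)%:Z - (last u p == v)%:Z.
Proof.
elim: p u => [|w p IHp] u /=.
  move=> _; exists (fun=> 0) => // v.
  by rewrite /divergence !big1// !subrr.
move=> /andP[/existsP[k /andP[kS kuw]] /IHp[f f0 fv]].
have [c ckv] : exists c : int, forall v,
    c * ((etail G k == v)%:Z - (ehead G k == v)%:Z) = (u == v)%:Z - (w == v)%:Z.
  case/orP: kuw => /andP[/eqP-> /eqP->]; first by exists 1 => v; lia.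
  by exists (-1) => v; lia.
exists (fun j => c * (j == k)%:Z + f j) => [j jS|v].
  by rewrite f0// addr0 (negPf (contraNneq _ jS)) ?mulr0// => ->.
by rewrite divergenceD divergenceM divergence1 ckv fv; lia.
Qed.

(** An edge that is not a bridge closes up to a cycle with a path that avoids
it; this cycle carries a unit flow. *)
Lemma cycle_flow k : ~ bridge G k -> exists2 f, flow f & f k != 0.
Proof.
move=> /bridgeP/negP/negPn; rewrite connectC => /connectP[p /path_flow[f fk fv] lp].
exists (fun j => (j == k)%:Z + f j) => [v|]; last by rewrite eqxx fk ?inE ?eqxx.
by rewrite divergenceD divergence1 fv -lp; lia.
Qed.

(** Flows through the single edges combine to one that vanishes nowhere:
multiplying a flow by an integer larger than all the values of the next one
leaves no room for cancellation. *)
Lemma nowhere_zero_flow : (forall k, ~ bridge G k) ->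
  exists2 f, flow f & forall k, f k != 0.
Proof.
move=> nobridge.
suff [f f0 fs] : exists2 f, flow f & forall k, k \in enum 'I_m -> f k != 0.
  by exists f => // k; rewrite fs ?mem_enum.
elim: (enum 'I_m) => [|k s [f f0 fs]].
  by exists (fun=> 0) => // v; rewrite /divergence !big1// subrr.
have [fk|fk] := eqVneq (f k) 0; last first.
  by exists f => // j; rewrite inE => /predU1P[->//|/fs].
have [g g0 gk] := cycle_flow (nobridge k).
pose c : int := 1 + \sum_j `|g j|.
exists (fun j => c * f j + g j) => [v|j].
  by rewrite divergenceD divergenceM f0 g0 mulr0.
have [->|jk] := eqVneq j k; first by rewrite fk mulr0 add0r.
rewrite inE (negPf jk) => /fs fj.
have cg : `|g j| < c.
  by rewrite /c (bigD1 j)//= ltz1D lerDl sumr_ge0.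
rewrite -normr_gt0 (lt_le_trans _ (lerB_normD _ _))// subr_gt0 normrM.
have : 1 <= `|f j| by rewrite -gtz0_ge1 normr_gt0.
nia.
Qed.

End Flows.

(** At a trivalent vertex carrying a loop, the third ray has to carry the flow
alone. *)
Lemma nowhere_zero_flow_loopless n m (G : graph n m) (f : 'I_m -> int) :
  trivalent G -> flow G f -> (forall k, f k != 0) ->
  forall k, etail G k != ehead G k.
Proof.
move=> G3 f0 fN0 k; apply/negP => /eqP loop; have := G3 (etail G k).
set A := [set r | _]%SET => A3.
have kA b : (k, b) \in A by rewrite inE; case: b; rewrite /ray_vertex/= ?loop.
have /cards1P[r Ar] : #|A :\ (k, true) :\ (k, false)| == 1%N.
  have := cardsD1 (k, true) A; rewrite A3 kA (cardsD1 (k, false)).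
  rewrite in_setD1 kA (_ : (k, false) != (k, true)); last first.
    by apply/eqP => -[].
  by rewrite !add1n => -[<-].
have fslope : \sum_(r in A) ray_slope f r = 0.
  apply: etrans (f0 (etail G k)); rewrite divergence_rays.
  by apply: eq_bigl => r'; rewrite inE.
move: fslope; rewrite (big_setD1 (k, true))//= (big_setD1 (k, false))/=; last first.
  by rewrite in_setD1 kA andbT; apply/eqP => -[].
rewrite Ar big_set1 /ray_slope/= addKr; case: r.2 => /eqP.
  by rewrite oppr_eq0 (negPf (fN0 _)).
by rewrite (negPf (fN0 _)).
Qed.
(** * Tropical covers and flows *)

Section Circle.
Local Open Scope classical_set_scope.
Variables (R : realType) (L : R).

Lemma circle_ptP (x y : R) :
  circle_pt L x = circle_pt L y <-> exists z : int, x - y = z%:~R * L.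
Proof.
split=> [/(eqmodP (circle_equiv L))/asboolP//|h].
exact/(eqmodP (circle_equiv L))/asboolP.
Qed.

Lemma circle_ptK (p : circle L) : exists x, p = circle_pt L x.
Proof. by exists (repr (p : {eq_quot (circle_equiv L)}%qT)); rewrite /circle_pt reprK. Qed.

Lemma circle_pt_continuous : continuous (circle_pt L).
Proof. exact: (@pi_continuous _ {eq_quot (circle_equiv L)}%qT). Qed.

End Circle.

Section Chart.
Variables (R : realType) (n m : nat) (G : graph n m) (C : tropical_curve R G).
Implicit Types (k : 'I_m) (t : R).

(** Case analysis on a chart: its definition matches on a proof that depends on
the tested boolean, which cannot be generalised directly. *)
Lemma chart_spec k t (T := curve_point C) (Q : T -> Prop) :
  (forall h : 0 < t < len C k, Q (Inner C k t h)) ->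
  (~ 0 < t < len C k -> Q (Vertex C (if t <= 0 then etail G k else ehead G k))) ->
  Q (chart C k t).
Proof.
rewrite /chart => QI QV.
by refine (match @idP (0 < t < len C k) as r return Q (match r with
  ReflectT h => Inner C k t h | ReflectF _ => Vertex C _ end)
  with ReflectT h => QI h | ReflectF h => QV h end).
Qed.

Lemma chart_inner k t (h : 0 < t < len C k) : chart C k t = Inner C k t h.
Proof.
apply: (@chart_spec k t (eq^~ (Inner C k t h))) => // h'.
by congr Inner; exact: bool_irrelevance.
Qed.

Lemma chart0 k : chart C k 0 = Vertex C (etail G k).
Proof.
apply: (@chart_spec k 0 (eq^~ (Vertex C (etail G k)))) => [h|_].
  by exfalso; rewrite ltxx in h.
by rewrite lexx.
Qed.

Lemma chart_len k : chart C k (len C k) = Vertex C (ehead G k).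
Proof.
apply: (@chart_spec k (len C k) (eq^~ (Vertex C (ehead G k)))) => [h|_].
  by exfalso; rewrite ltxx andbF in h.
by rewrite leNgt len_gt0.
Qed.

Lemma itv_endsP (l t : R) : 0 <= t <= l -> [\/ t = 0, t = l | 0 < t < l].
Proof.
move=> /andP[]; rewrite le_eqVlt => /predU1P[<-|t0]; first by constructor 1.
rewrite le_eqVlt => /predU1P[<-|tl]; first by constructor 2.
by constructor 3; rewrite t0.
Qed.

Lemma chart_inj k : {in [pred t | 0 < t < len C k] &, injective (chart C k)}.
Proof. by move=> s t hs ht; rewrite (chart_inner hs) (chart_inner ht) => -[]. Qed.

End Chart.

Section FibreCount.
Local Open Scope classical_set_scope.
Variables (R : realType) (L : R).
Hypothesis L_gt0 : 0 < L.
Variables (n m : nat) (G : graph n m).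

(** Unrolling the circle, the fibre over [P + Z * L] of an edge that runs from
[x] to [x + s * l] consists of the translates of [P] passed on the way, which
are counted by the jump of the floor function. *)
Lemma card_edge_fibre (c : tropical_cover G L) k (x P : R)
    (a := (x - P) / L) (b := (x + (slope c k)%:~R * len c k - P) / L) :
  slope c k != 0 ->
  (forall t, 0 <= t <= len c k ->
     cover_map (chart c k t) = circle_pt L (x + (slope c k)%:~R * t)) ->
  (forall v, cover_map (Vertex c v) <> circle_pt L P) ->
  (edge_fibre c (circle_pt L P) k #= `I_(`|Num.floor b - Num.floor a|%N))%card.
Proof.
set s := slope c k; set l := len c k => s0 aff vP.
have l0 : 0 < l by exact: len_gt0.
have sR0 : s%:~R != 0 :> R by rewrite intr_eq0.
have L0 : L != 0 by rewrite gt_eqF.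
have notint y (z : int) : circle_pt L y <> circle_pt L P -> (y - P) / L != z%:~R.
  move=> yP; apply/eqP => yz; apply: yP; apply/circle_ptP; exists z.
  by rewrite -yz divfK.
have aN z : a != z%:~R.
  apply: notint; rewrite -[x]addr0 -[in x + _](mulr0 s%:~R) -aff ?lexx ?ltW//.
  by rewrite chart0; exact: vP.
have bN z : b != z%:~R.
  apply: notint; rewrite -aff ?lexx ?ltW//.
  by rewrite chart_len; exact: vP.
pose T z := (P + z%:~R * L - x) / s%:~R.
have Tab (z : int) : (0 < T z < l) =
   (if (0 < s)%R then (Num.floor a < z <= Num.floor b)%R
    else (Num.floor b < z <= Num.floor a)%R).
  have zP : a < z%:~R = (x - P < z%:~R * L) by rewrite /a ltr_pdivrMr.
  have zQ : z%:~R < b = (z%:~R * L < x + s%:~R * l - P) by rewrite /b ltr_pdivlMr.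
  have zP' : z%:~R < a = (z%:~R * L < x - P) by rewrite /a ltr_pdivlMr.
  have zQ' : b < z%:~R = (x + s%:~R * l - P < z%:~R * L) by rewrite /b ltr_pdivrMr.
  rewrite !floor_lt_int !floor_ge_int !le_eqVlt ![z%:~R == _]eq_sym.
  rewrite (negPf (aN z)) (negPf (bN z)) !orFb zP zQ zP' zQ' /T.
  have [s_gt0|s_le0] := ltP 0 s; last first.
    have sR : s%:~R < 0 :> R by rewrite ltrz0 lt_neqAle s0.
    by rewrite ltr_ndivlMr// ltr_ndivrMr// mul0r; apply/andP/andP => -[h1 h2]; split; lra.
  have sR : 0 < s%:~R :> R by rewrite ltr0z.
  by rewrite ltr_pdivlMr// ltr_pdivrMr// mul0r; apply/andP/andP => -[h1 h2]; split; lra.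
pose lo := if (0 < s)%R then Num.floor a else Num.floor b.
have Tlo (z : int) : (0 < T z < l) =
    (lo < z <= lo + `|Num.floor b - Num.floor a|%N%:Z)%R.
  have ab : if (0 < s)%R then (Num.floor a <= Num.floor b)%R
            else (Num.floor b <= Num.floor a)%R.
    have ba : b - a = s%:~R * l / L by rewrite /a /b -/s -/l; field.
    have [s_gt0|s_le0] := ltP 0 s; apply: le_floor; rewrite -subr_ge0; last first.
      rewrite -opprB ba oppr_ge0 mulr_le0_ge0 ?invr_ge0 ?(ltW L_gt0)//.
      by rewrite mulr_le0_ge0 ?(ltW l0)// lerz0.
    by rewrite ba !mulr_ge0 ?invr_ge0 ?(ltW L_gt0) ?(ltW l0)// ler0z ltW.
  by rewrite Tab /lo; case: ifP ab => _ ab; congr (_ && _); congr (_ <= _); lia.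
pose f (i : nat) := chart c k (T (lo + 1 + i%:Z)).
have fT i : `I_(`|Num.floor b - Num.floor a|%N) i -> 0 < T (lo + 1 + i%:Z) < l.
  by move=> /= il; rewrite Tlo; lia.
have -> : edge_fibre c (circle_pt L P) k = f @` `I_(`|Num.floor b - Num.floor a|%N).
  apply/seteqP; split=> [_ [[t tl ->]]|_ [i /fT il <-]].
    rewrite aff// => /circle_ptP[z xz].
    have tT : t = T z by rewrite /T -xz; field.
    have t0l : 0 < T z < l.
      rewrite -tT; have [t0|tl'|//] := itv_endsP tl.
        exfalso; move: (aN z) => /eqP; apply; rewrite /a.
        by apply: (canLR (mulfK L0)); rewrite -xz t0; ring.
      exfalso; move: (bN z) => /eqP; apply; rewrite /b.
      by apply: (canLR (mulfK L0)); rewrite -xz tl'; ring.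
    move: (t0l); rewrite Tlo => zlo.
    exists (absz (z - lo - 1)%R); first by rewrite /=; lia.
    by rewrite /f [in RHS]tT; congr (chart c k (T _)); lia.
  split; last first.
    rewrite aff; last first.
      by case/andP: il => *; rewrite !ltW.
    by apply/circle_ptP; exists (lo + 1 + i%:Z); rewrite /T; field.
  by exists (T (lo + 1 + i%:Z)) => //; case/andP: il => *; rewrite !ltW.
apply: inj_card_eq => i j /set_mem/fT il /set_mem/fT jl /(chart_inj il jl).
by rewrite /T => /(mulIf (invr_neq0 sR0))/addIr/addrI/(mulIf L0)/intr_inj; lia.
Qed.

(** The total weight of the fibre over [P] is a sum over the edges of the slope
times the jump of [floor ((_ - P) / L)].  Writing the ends of the edges as
lifts of the images of the vertices up to a multiple of [L], the dependence on
[P] is a sum of slopes against differences of a function on the vertices, which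
is zero for a flow. *)
Lemma fibre_weight_constant (c : tropical_cover G L) :
  (forall k, slope c k != 0) -> exists D : int, forall p : circle L,
    (forall v, cover_map (Vertex c v) <> p) ->
    exists2 b : 'I_m -> nat, forall k, fibre_weight c p k (b k)
                           & (\sum_k b k)%N%:Z = D.
Proof.
move=> s0; set s := slope c.
have [X vX] := choice (fun v => circle_ptK (cover_map (Vertex c v))).
have [x xaff] := choice (@cover_affine _ _ _ _ _ c).
have /choice[i iX] k : exists i : int, x k - X (etail G k) = i%:~R * L.
  apply/circle_ptP; rewrite -vX -chart0 xaff ?lexx ?(ltW (len_gt0 _ _))//.
  by rewrite mulr0 addr0.
have /choice[j jX] k : exists j : int,
    x k + (s k)%:~R * len c k - X (ehead G k) = j%:~R * L.
  by apply/circle_ptP; rewrite -vX -chart_len xaff ?lexx ?(ltW (len_gt0 _ _)).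
exists (\sum_k s k * (j k - i k)) => p; have [P ->] := circle_ptK p => vP.
exists (fun k =>
  (`|Num.floor ((x k + (s k)%:~R * len c k - P) / L)
     - Num.floor ((x k - P) / L)| * weight c k)%N) => [k|].
  exists (absz (Num.floor ((x k + (s k)%:~R * len c k - P) / L)
     - Num.floor ((x k - P) / L))%R) => //.
  exact: (card_edge_fibre (s0 k) (xaff k) vP).
rewrite (raddf_sum Posz)/=.
have floorX (u w : R) (z : int) : u - w = z%:~R * L ->
    Num.floor ((u - P) / L) = Num.floor ((w - P) / L) + z.
  have L0 : L != 0 by rewrite gt_eqF.
  move=> uw; rewrite (_ : (u - P) / L = (w - P) / L + z%:~R); last first.
    by rewrite -(subrK w u) uw; field.
  by rewrite floorDrz ?intrKfloor.
pose h v := Num.floor ((X v - P) / L).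
transitivity (\sum_k (s k * (j k - i k) - (h (etail G k) - h (ehead G k)) *~ s k)).
  apply: eq_bigr => k _; rewrite PoszM !abszE -normrM mulrC ger0_norm.
    by rewrite (floorX _ _ _ (iX k)) (floorX _ _ _ (jX k)) /h -mulrzr intz -/(s k); ring.
  rewrite -/(s k).
  have ab : if (0 < s k)%R
      then (Num.floor ((x k - P) / L) <= Num.floor ((x k + (s k)%:~R * len c k - P) / L))%R
      else (Num.floor ((x k + (s k)%:~R * len c k - P) / L) <= Num.floor ((x k - P) / L))%R.
    have l0 := len_gt0 c k.
    have [sk|sk] := ltP 0 (s k); apply: le_floor; rewrite ler_pM2r ?invr_gt0// lerD2r.
      by rewrite lerDl mulr_ge0 ?(ltW l0)// ler0z ltW.
    by rewrite gerDl mulr_le0_ge0 ?(ltW l0)// lerz0.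
  have [sk|sk] := ltP 0 (s k); rewrite ?sk ?ltNge ?sk/= in ab.
    by rewrite mulr_ge0 ?(ltW sk)// subr_ge0.
  by rewrite mulr_le0// subr_le0.
rewrite sumrB sum_divergence [X in _ - X]big1 ?subr0// => v _.
by have /balanced_divergence-> := cover_balanced c v.
Qed.

Lemma cover_slope_flow (c : tropical_cover G L) : flow G (slope c).
Proof. by move=> v; apply/balanced_divergence; exact: cover_balanced. Qed.

Lemma edge_length (u w : R) (s : int) : s != 0 ->
  exists2 l : R, 0 < l & exists z : int, u + s%:~R * l - w = z%:~R * L.
Proof.
move=> s0; have sR0 : s%:~R != 0 :> R by rewrite intr_eq0.
pose N := Num.floor (`|w - u| / L) + 1.
have NL : `|w - u| < N%:~R * L.
  by rewrite -ltr_pdivrMr// floorD1_gt.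
have uwN := le_lt_trans (ler_norm (w - u)) NL.
have uwN' : u - w < N%:~R * L.
  by rewrite (le_lt_trans _ NL)// distrC ler_norm.
pose z := if (0 < s)%R then N else - N.
exists ((w - u + z%:~R * L) / s%:~R); last first.
  by exists z; rewrite mulrCA divff// mulr1; ring.
rewrite /z; have [s_gt0|s_le0] := ltP 0 s.
  by rewrite divr_gt0 ?ltr0z//; lra.
rewrite nmulr_lgt0 ?invr_lt0 ?ltrz0 ?lt_neqAle ?s0//.
by rewrite rmorphN/= mulNr; lra.
Qed.

(** Over prescribed vertex images, a flow without zeros is the slope of a
cover: the ends of every edge leave its length free up to a multiple of [L]
divided by the slope, so that it can be chosen positive. *)
Lemma cover_of_flow (s : 'I_m -> int) (X : 'I_n -> R) :
  flow G s -> (forall k, s k != 0) ->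
  (exists v w, circle_pt L (X v) <> circle_pt L (X w)) ->
  exists2 c : tropical_cover G L, slope c = s
    & forall v, cover_map (Vertex c v) = circle_pt L (X v).
Proof.
move=> s_flow s0 nonconst.
have /choice[l lP] k : exists l, 0 < l /\ exists z : int,
    X (etail G k) + (s k)%:~R * l - X (ehead G k) = z%:~R * L.
  have [l l0 lz] := edge_length (X (etail G k)) (X (ehead G k)) (s0 k).
  by exists l.
pose C := @TropicalCurve R n m G l (fun k => (lP k).1).
pose f (x : curve_point C) := match x with
  | Vertex v => circle_pt L (X v)
  | Inner k t _ => circle_pt L (X (etail G k) + (s k)%:~R * t) end.
have faff k t : 0 <= t <= l k ->
    f (chart C k t) = circle_pt L (X (etail G k) + (s k)%:~R * t).
  move=> tl; have [->|->|t0l] := itv_endsP tl.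
  - by rewrite chart0 mulr0 addr0.
  - by rewrite (chart_len C)/=; apply/esym/circle_ptP; exact: (lP k).2.
  - by rewrite (chart_inner (C := C) t0l).
have fcont k : {within `[0, len C k], continuous (f \o chart C k)}.
  pose g (t : R) := circle_pt L (X (etail G k) + (s k)%:~R * t).
  have cg : {within `[0, len C k], continuous g}.
    apply: continuous_subspaceT => t.
    have ct : {for t, continuous (fun t : R => X (etail G k) + (s k)%:~R * t)}.
      apply: continuousD; first exact: cst_continuous.
      exact: mulrl_continuous.
    exact: (continuous_comp ct (@circle_pt_continuous R L _)).
  apply: (subspace_eq_continuous _ cg) => t.
  by rewrite inE/= in_itv/= => tl; apply/esym/faff.
have fnc : exists x y, f x <> f y.
  by have [v [w vw]] := nonconst; exists (Vertex C v), (Vertex C w).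
have fa k : exists x0 : R, forall t, 0 <= t <= len C k ->
    f (chart C k t) = circle_pt L (x0 + (s k)%:~R * t).
  by exists (X (etail G k)) => t /faff.
have fb v : balanced G s v by apply/balanced_divergence; exact: s_flow.
by exists (TropicalCover fcont fnc fa fb).
Qed.

(** Whether the slope of an edge is zero can be read off the map alone; hence
isomorphic covers agree on it. *)
Lemma slope0_constant (c : tropical_cover G L) k :
  slope c k = 0 <-> exists q, forall t, 0 <= t <= len c k ->
    cover_map (chart c k t) = q.
Proof.
have l0 := len_gt0 c k; have [x aff] := cover_affine c k; split=> [s0|[q cst]].
  by exists (circle_pt L x) => t tl; rewrite aff// s0 mul0r addr0.
apply/eqP; rewrite -[_ == 0](@intr_eq0 R); apply/eqP.
set s := (slope c k)%:~R in aff *; apply: contrapT => /eqP s0.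
(* a time t at which the edge has gone at most half way around the circle *)
pose t := Num.min (len c k) (L / (2 * `|s|)).
have t_gt0 : 0 < t.
  by rewrite lt_min l0 divr_gt0// mulr_gt0// normr_gt0.
have tl : 0 <= t <= len c k by rewrite ltW//= ge_min lexx.
have : circle_pt L (x + s * t) = circle_pt L (x + s * 0).
  by rewrite -!aff ?cst// lexx ltW.
move/circle_ptP => [z]; rewrite mulr0 addr0 addrC addKr => /(congr1 Num.norm).
rewrite !normrM (gtr0_norm t_gt0) (gtr0_norm L_gt0) => stz.
have stL : `|s| * t <= L / 2.
  rewrite (le_trans (ler_wpM2l (normr_ge0 s) (_ : t <= L / (2 * `|s|))))//.
    by rewrite ge_min lexx orbT.
  have sn0 : `|s| != 0 by rewrite normr_eq0.
  rewrite (_ : `|s| * (L / (2 * `|s|)) = L / 2)//.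
  by field.
have st0 : 0 < `|s| * t by rewrite mulr_gt0// normr_gt0.
have z1 : `|z%:~R : R| < 1.
  by rewrite -(ltr_pM2r L_gt0) mul1r -stz; move: L_gt0 stL; lra.
move: z1 st0; rewrite stz; case: (eqVneq z 0) => [->|z0].
  by rewrite normr0 mul0r ltxx.
by rewrite -intr_norm (ltr_int R `|z| 1); move: z0; lia.
Qed.

Lemma labeled_iso_slope0 (c c' : tropical_cover G L) k :
  labeled_iso c c' -> slope c' k = 0 -> slope c k = 0.
Proof.
move=> /asboolP[phi [[_ _ phie] phim]] /slope0_constant[q cst].
apply/slope0_constant; exists q => t tl.
have [sigma [[sI _ _] _ sE]] := phie k.
have tI : t \in `[0, len c k]%R by rewrite in_itv.
rewrite -phim sE// cst//; have := sI t tI.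
by rewrite /= in_itv.
Qed.

Lemma labeled_iso_vertex (c c' : tropical_cover G L) v :
  labeled_iso c c' -> cover_map (Vertex c' v) = cover_map (Vertex c v).
Proof. by move=> /asboolP[phi [[_ phiv _] phim]]; rewrite -phiv phim. Qed.

Lemma cover_repr_pi (c : tropical_cover G L) :
  labeled_iso c (cover_repr (\pi_{eq_quot (@labeled_iso_equiv R n m G L)} c)%qT).
Proof. by apply/(eqmodP (@labeled_iso_equiv R n m G L)); rewrite reprK. Qed.

Lemma Ntrop0_no_flow (p : 'I_n.+1 -> circle L) (a : 'I_m -> nat) :
  (forall f, flow G f -> exists k, f k = 0) -> Ntrop G p a = 0%E.
Proof.
move=> noflow; apply: esum1 => K _.
have [k sk] := noflow _ (cover_slope_flow (cover_repr K)).
by rewrite (bigD1 k)//= /weight sk mul0n.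
Qed.

(** The class of the cover built from a flow without zeros is counted for the
vector of the fibre weights of its own representative over [p ord0], and has
nonzero multiplicity. *)
Lemma Ntrop_flow (p : 'I_n.+1 -> circle L) : (1 < n)%N -> injective p ->
  (forall a, Ntrop G p a = 0%E) -> forall f, flow G f -> exists k, f k = 0.
Proof.
move=> n1 p_inj N0 s s_flow; apply: contrapT => snz.
have s0 k : s k != 0 by apply/eqP => sk; apply: snz; exists k.
have [X pX] := choice (fun v => circle_ptK (p (lift ord0 v))).
have [c cs cX] : exists2 c : tropical_cover G L, slope c = s
    & forall v, cover_map (Vertex c v) = circle_pt L (X v).
  apply: cover_of_flow => //; exists (Ordinal (ltnW n1)), (Ordinal n1).
  by rewrite -!pX => /p_inj/lift_inj/(congr1 val).
pose K : cover_class G L := (\pi_{eq_quot (@labeled_iso_equiv R n m G L)} c)%qT.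
have cK : labeled_iso c (cover_repr K) by exact: cover_repr_pi.
have cv v : cover_map (Vertex (cover_repr K) v) = p (lift ord0 v).
  by rewrite (labeled_iso_vertex v cK) cX pX.
have sK k : slope (cover_repr K) k != 0.
  apply: contraNneq (s0 k) => sk; rewrite -cs; apply/eqP.

  exact: labeled_iso_slope0 cK sk.
have [D DP] := fibre_weight_constant sK.
have [a aw aD] : exists2 b : 'I_m -> nat,
    forall k, fibre_weight (cover_repr K) (p ord0) k (b k) & (\sum_k b k)%N%:Z = D.
  by apply: DP => v; rewrite cv => /p_inj/eqP; rewrite eq_sym (negPf (neq_lift _ _)).
have Kcounted : counted p a (cover_repr K).
  split=> //.
    by apply: eq_imagel => v _; exact: cv.
  move=> q qv; have [b bw bD] := DP q qv; exists b => //.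
  by have := etrans bD (esym aD); case.
have w_gt0 : (0 < \prod_k weight (cover_repr K) k)%N.
  by rewrite prodn_gt0// => k; rewrite absz_gt0.
have : ((\prod_k weight (cover_repr K) k)%N%:R%:E <= Ntrop G p a)%E.
  apply: esum_ge; exists [set K].
    by split=> [|_ ->//]; exact: finite_set1.
  by rewrite fsbig_set1.
by rewrite N0 lee_fin lern0 -leqn0 leqNgt w_gt0.
Qed.

End FibreCount.
(** * Complex sequences *)

Section Modulus.
Variable R : rcfType.
Local Open Scope complex_scope.
Implicit Types (x y z : R[i]) (t : R).

Definition modulus z : R := Normc.normc z.

Lemma modulus_ge0 z : 0 <= modulus z.
Proof. by case: z => a b; exact: sqrtr_ge0. Qed.

Lemma modulusM x y : modulus (x * y) = modulus x * modulus y.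
Proof. exact: Normc.normcM. Qed.

Lemma modulusV x : modulus x^-1 = (modulus x)^-1.
Proof. exact: Normc.normcV. Qed.

Lemma modulusN x : modulus (- x) = modulus x.
Proof. exact: (@normcN R x). Qed.

Lemma modulusD x y : modulus (x + y) <= modulus x + modulus y.
Proof. exact: (@le_normcD R x y). Qed.

Lemma modulusB x y : modulus (x - y) <= modulus x + modulus y.
Proof. by rewrite -[modulus y]modulusN modulusD. Qed.

Lemma modulusBC x y : modulus (x - y) = modulus (y - x).
Proof. by rewrite -opprB modulusN. Qed.

Lemma modulus0 : modulus 0 = 0.
Proof. exact: Normc.normc0. Qed.

Lemma modulus1 : modulus 1 = 1.
Proof. exact: Normc.normc1. Qed.

Lemma modulus_eq0 x : (modulus x == 0) = (x == 0).
Proof.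
by apply/eqP/eqP => [/Normc.eq0_normc//|->]; exact: modulus0.
Qed.

Lemma modulus_gt0 x : (0 < modulus x) = (x != 0).
Proof. by rewrite lt_neqAle eq_sym modulus_eq0 modulus_ge0 andbT. Qed.

Lemma modulusX x n : modulus (x ^+ n) = modulus x ^+ n.
Proof. by elim: n => [|n IHn]; rewrite ?expr0 ?modulus1// !exprS modulusM IHn. Qed.

Lemma modulus_real t : modulus t%:C = `|t|.
Proof. by rewrite /modulus/= expr0n addr0 sqrtr_sqr. Qed.

Lemma modulus_nat n : modulus n%:R = n%:R.
Proof. by rewrite -(rmorph_nat (real_complex R)) modulus_real normr_nat. Qed.

Lemma modulus_sum (I : Type) (r : seq I) (P : pred I) (f : I -> R[i]) :
  modulus (\sum_(i <- r | P i) f i) <= \sum_(i <- r | P i) modulus (f i).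
Proof.
elim/big_ind2: _ => [|x1 x2 y1 y2 h1 h2|//]; first by rewrite modulus0.
by rewrite (le_trans (modulusD _ _))// lerD.
Qed.

Lemma modulus_Re z : `|complex.Re z| <= modulus z.
Proof.
by case: z => a b; rewrite /modulus/= -sqrtr_sqr ler_sqrt ?lerDl ?sqr_ge0//
  addr_ge0 ?sqr_ge0.
Qed.

Lemma modulus_Im z : `|complex.Im z| <= modulus z.
Proof.
by case: z => a b; rewrite /modulus/= -sqrtr_sqr ler_sqrt ?lerDr ?sqr_ge0//
  addr_ge0 ?sqr_ge0.
Qed.

Lemma modulus_le z : modulus z <= `|complex.Re z| + `|complex.Im z|.
Proof.
rewrite {1}[z]complexE (le_trans (modulusD _ _))// modulusM !modulus_real.
by rewrite [X in X * _](_ : _ = 1) ?mul1r// /modulus/= expr0n expr1n add0r sqrtr1.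
Qed.

Lemma modulus_sqr z : modulus z ^+ 2 = complex.Re z ^+ 2 + complex.Im z ^+ 2.
Proof. by case: z => a b; rewrite sqr_sqrtr// addr_ge0 ?sqr_ge0. Qed.

Lemma ler_modulusB x y : modulus x - modulus y <= modulus (x - y).
Proof. by rewrite lerBlDr -{1}(subrK y x) modulusD. Qed.

End Modulus.
Arguments modulus : simpl never.

Section Sequences.
Variable R : realType.
Local Open Scope classical_set_scope.
Local Open Scope ring_scope.
Local Open Scope complex_scope.
Implicit Types (r s : nat -> R) (u v : nat -> R[i]).

(** Upper bounds that become arbitrarily small: the sequences in question bound
moduli from above. *)
Definition vanishing r :=
  forall e, 0 < e -> exists N, forall n, (N <= n)%N -> r n <= e.

Definition tends u (l : R[i]) := vanishing (fun n => modulus (u n - l)).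

Lemma vanishing_le r s N : (forall n, (N <= n)%N -> r n <= s n) ->
  vanishing s -> vanishing r.
Proof.
move=> rs s0 e /s0[M sM]; exists (maxn N M) => n; rewrite geq_max => /andP[Nn Mn].
by rewrite (le_trans (rs n Nn))// sM.
Qed.

Lemma vanishingD r s : vanishing r -> vanishing s -> vanishing (fun n => r n + s n).
Proof.
move=> r0 s0 e e0; have e2 : 0 < e / 2 by rewrite divr_gt0.
have [N rN] := r0 _ e2; have [M sM] := s0 _ e2.
exists (maxn N M) => n; rewrite geq_max => /andP[Nn Mn].
by rewrite (splitr e) lerD ?rN ?sM.
Qed.

Lemma vanishingZ (c : R) r : 0 <= c -> vanishing r -> vanishing (fun n => c * r n).
Proof.
rewrite le_eqVlt => /predU1P[<- _ e e0|c0 r0 e e0].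
  by exists 0 => n _; rewrite mul0r ltW.
have [|N rN] := r0 (e / c); first by rewrite divr_gt0.
by exists N => n Nn; rewrite mulrC -ler_pdivlMr// rN.
Qed.

Lemma vanishing0 : vanishing (fun=> 0).
Proof. by move=> e e0; exists 0%N => n _; exact: ltW. Qed.

Lemma vanishing_sum (J : nat) (r : nat -> nat -> R) :
  (forall j, vanishing (r^~ j)) -> vanishing (fun n => \sum_(j < J) r n j).
Proof.
move=> r0; elim: J => [|J IHJ].
  by apply: (@vanishing_le _ (fun=> 0) 0); [move=> n _; rewrite big_ord0|exact: vanishing0].
apply: (@vanishing_le _ (fun n => \sum_(j < J) r n j + r n J) 0).
  by move=> n _; rewrite big_ord_recr.
exact: vanishingD.
Qed.

Lemma vanishing_cst (c : R) : vanishing (fun=> c) -> c <= 0.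
Proof.
move=> c0; rewrite leNgt; apply/negP => c_gt0.
have [|N /(_ N (leqnn _))] := c0 (c / 2); first by rewrite divr_gt0.
by move: c_gt0; lra.
Qed.

Lemma vanishing_comp r (phi : nat -> nat) : (forall n, (n <= phi n)%N) ->
  vanishing r -> vanishing (r \o phi).
Proof.
move=> phin r0 e /r0[N rN]; exists N => n Nn /=.
by rewrite rN// (leq_trans Nn).
Qed.

Lemma vanishing_inv : vanishing (fun n => n%:R^-1).
Proof.
move=> e e0; exists (Num.truncn e^-1).+1 => n Nn.
have n0 : 0 < n%:R :> R by rewrite ltr0n (leq_trans _ Nn).
rewrite -[leRHS]invrK lef_pV2 ?posrE ?invr_gt0//.
by rewrite (le_trans (ltW (truncnS_gt _)))// ler_nat.
Qed.

Lemma tends_cst l : tends (fun=> l) l.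
Proof.
by apply: (@vanishing_le _ (fun=> 0) 0); [move=> n _; rewrite subrr modulus0|exact: vanishing0].
Qed.

Lemma tends_near u v l : vanishing (fun n => modulus (u n - v n)) ->
  tends u l -> tends v l.
Proof.
move=> uv ul; apply: (@vanishing_le _ _ 0) (vanishingD uv ul) => n _.
by rewrite (modulusBC (u n)) (le_trans _ (modulusD _ _))// addrA subrK.
Qed.

Lemma tends_eq u v l : u =1 v -> tends u l -> tends v l.
Proof.
move=> uv; apply: tends_near; apply: (@vanishing_le _ (fun=> 0) 0).
  by move=> n _; rewrite uv subrr modulus0.
exact: vanishing0.
Qed.

Lemma tendsD u v k l : tends u k -> tends v l -> tends (fun n => u n + v n) (k + l).
Proof.
move=> uk vl; apply: (@vanishing_le _ _ 0) (vanishingD uk vl) => n _.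
by rewrite (le_trans _ (modulusD _ _))// addrACA opprD.
Qed.

Lemma tendsN u l : tends u l -> tends (fun n => - u n) (- l).
Proof.
apply: (@vanishing_le _ _ 0) => n _.
by rewrite -opprD modulusN.
Qed.

Lemma tendsB u v k l : tends u k -> tends v l -> tends (fun n => u n - v n) (k - l).
Proof. by move=> uk /tendsN; exact: tendsD. Qed.

Lemma tends_bounded u l : tends u l ->
  exists2 B, 0 < B & exists N, forall n, (N <= n)%N -> modulus (u n) <= B.
Proof.
move=> /(_ 1 ltr01)[N uN]; exists (1 + modulus l).
  by rewrite ltr_pwDl// modulus_ge0.
exists N => n /uN ul1; rewrite -(subrK l (u n)) (le_trans (modulusD _ _))//.
by rewrite lerD2r.
Qed.

Lemma tendsM u v k l : tends u k -> tends v l -> tends (fun n => u n * v n) (k * l).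
Proof.
move=> uk vl; have [B B0 [N uB]] := tends_bounded uk.
have := vanishingD (vanishingZ (ltW B0) vl) (vanishingZ (modulus_ge0 l) uk).
apply: (@vanishing_le _ _ N) => n /uB un.
rewrite (_ : _ - _ = u n * (v n - l) + l * (u n - k)); last by ring.
by rewrite (le_trans (modulusD _ _))// !modulusM lerD2r ler_wpM2r// modulus_ge0.
Qed.

Lemma tendsZ (c : R[i]) u l : tends u l -> tends (fun n => c * u n) (c * l).
Proof. exact/tendsM/tends_cst. Qed.

Lemma tendsV u l : l != 0 -> tends u l -> tends (fun n => (u n)^-1) l^-1.
Proof.
move=> l0 ul; have ml : 0 < modulus l by rewrite modulus_gt0.
have [|N uN] := ul (modulus l / 2); first by rewrite divr_gt0.
have c0 : 0 <= 2 / modulus l ^+ 2 by rewrite divr_ge0// sqr_ge0.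
apply: (@vanishing_le _ _ N) (vanishingZ c0 ul) => n /uN un.
have lun : modulus l / 2 <= modulus (u n).
  have := ler_modulusB l (u n); rewrite modulusBC => h.
  by move: (le_trans h un); lra.
have un0 : u n != 0.
  by rewrite -modulus_gt0 (lt_le_trans _ lun)// divr_gt0.
rewrite (_ : _ - _ = (u n)^-1 * l^-1 * - (u n - l)); last by field; rewrite un0 l0.
rewrite !modulusM !modulusV modulusN ler_wpM2r ?modulus_ge0//.
rewrite (_ : _ / _ = (modulus l / 2)^-1 * (modulus l)^-1); last first.
  by field; rewrite lt0r_neq0.
by rewrite ler_wpM2r ?invr_ge0 ?modulus_ge0// lef_pV2 ?posrE ?divr_gt0// modulus_gt0.
Qed.

Lemma tends_comp u l (phi : nat -> nat) : (forall n, (n <= phi n)%N) ->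
  tends u l -> tends (u \o phi) l.
Proof. exact: vanishing_comp. Qed.

Lemma tends_modulus_le u l (c : R) N :
  (forall n, (N <= n)%N -> modulus (u n) <= c) -> tends u l -> modulus l <= c.
Proof.
move=> uc ul; rewrite -subr_le0; apply: vanishing_cst.
apply: (@vanishing_le _ _ N) ul => n /uc un.
rewrite lerBlDr (le_trans _ (lerD (lexx _) un))//.
by rewrite modulusBC -{1}(subrK (u n) l) modulusD.
Qed.

Lemma vanishing_cvgr (x : nat -> R) (l : R) :
  vanishing (fun n => `|x n - l|) <-> x @ \oo --> l.
Proof.
split=> [xl|/cvgrPdist_le xl e e0].
  apply/cvgrPdist_le => e /xl[N xN]; near=> n; rewrite distrC xN//.
  by near: n; exists N.
have [N _ xN] := xl e e0; exists N => n Nn; rewrite distrC.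
exact: xN.
Unshelve. all: by end_near. Qed.

Lemma tends_Re u l : tends u l -> (fun n => complex.Re (u n)) @ \oo --> complex.Re l.
Proof.
move=> ul; apply/vanishing_cvgr; apply: (@vanishing_le _ _ 0) ul => n _.
by rewrite (le_trans _ (modulus_Re _))//; case: (u n) => a b; case: l.
Qed.

Lemma tends_Im u l : tends u l -> (fun n => complex.Im (u n)) @ \oo --> complex.Im l.
Proof.
move=> ul; apply/vanishing_cvgr; apply: (@vanishing_le _ _ 0) ul => n _.
by rewrite (le_trans _ (modulus_Im _))//; case: (u n) => a b; case: l.
Qed.

Lemma cvg_tends u (a b : R) : (fun n => complex.Re (u n)) @ \oo --> a ->
  (fun n => complex.Im (u n)) @ \oo --> b -> tends u (a +i* b).
Proof.
move=> /vanishing_cvgr ua /vanishing_cvgr ub.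
apply: (@vanishing_le _ _ 0) (vanishingD ua ub) => n _.
by rewrite (le_trans (modulus_le _))//; case: (u n).
Qed.

Lemma tends_clim u l : tends u l -> clim u = l.
Proof.
move=> ul; rewrite /clim (cvg_lim _ (tends_Re ul))// (cvg_lim _ (tends_Im ul))//.
by case: l {ul}.
Qed.

Lemma cauchy_tends u r : vanishing r ->
  (forall n m, (n <= m)%N -> modulus (u m - u n) <= r n) -> exists l, tends u l.
Proof.
move=> r0 ur.
suff cvgc (p : R[i] -> R) : (forall x y, `|p x - p y| <= modulus (x - y)) ->
    exists a : R, (fun n => p (u n)) @ \oo --> a.
  have [a ua] : exists a : R, (fun n => complex.Re (u n)) @ \oo --> a.
    by apply: cvgc => x y; rewrite (le_trans _ (modulus_Re _))//; case: x; case: y.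
  have [b ub] : exists b : R, (fun n => complex.Im (u n)) @ \oo --> b.
    by apply: cvgc => x y; rewrite (le_trans _ (modulus_Im _))//; case: x; case: y.
  by exists (a +i* b); exact: cvg_tends.
move=> pM; suff : cvgn (fun n => p (u n)) by exists (limn (fun n => p (u n))).
apply/cauchy_cvgP/cauchy_exP => e e0; have [|N rN] := r0 (e / 2).
  by rewrite divr_gt0.
exists (p (u N)); exists N => // n /= Nn.
rewrite /ball/= distrC (le_lt_trans (pM _ _))// (le_lt_trans (ur _ _ Nn))//.
by rewrite (le_lt_trans (rN N (leqnn _)))// ltr_pdivrMr// ltr_pMr// ltr1n.
Qed.

End Sequences.
(** * The exponential and the kernel [w / (1 - w) ^ 2] *)

Section Exponential.
Variable R : realType.
Local Open Scope complex_scope.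
Implicit Types (z w : R[i]) (t : R).

Lemma cexpE z : cexp z = (expR (complex.Re z) * cos (complex.Im z))
  +i* (expR (complex.Re z) * sin (complex.Im z)).
Proof. by rewrite /cexp; simpc. Qed.

Lemma cexpD z w : cexp (z + w) = cexp z * cexp w.
Proof.
case: z w => a b [c d]; rewrite !cexpE/= expRD cosD sinD.
by apply/eqP; rewrite eq_complex/=; apply/andP; split; apply/eqP; ring.
Qed.

Lemma modulus_cexp z : modulus (cexp z) = expR (complex.Re z).
Proof.
rewrite /cexp modulusM modulus_real gtr0_norm ?expR_gt0// /modulus/=.
by rewrite cos2Dsin2 sqrtr1 mulr1.
Qed.

(** The character [e(z) = exp (2 pi i z)]. *)
Definition echar z : R[i] := cexp ('i * (2 * pi)%:C * z).

Lemma echarD z w : echar (z + w) = echar z * echar w.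
Proof. by rewrite /echar mulrDr cexpD. Qed.

Lemma echarE (x y : R) : echar (x +i* y) =
  (expR (- (2 * pi * y)))%:C * (cos (2 * pi * x) +i* sin (2 * pi * x)).
Proof.
by rewrite /echar /cexp/=; congr (_%:C * (cos _ +i* sin _)); first congr expR; ring.
Qed.

Lemma modulus_echar z : modulus (echar z) = expR (- (2 * pi * complex.Im z)).
Proof. by rewrite modulus_cexp; case: z => a b /=; congr expR; ring. Qed.

Lemma echar_neq0 z : echar z != 0.
Proof. by rewrite -modulus_gt0 modulus_echar expR_gt0. Qed.

Lemma echar0 : echar 0 = 1.
Proof.
by rewrite (echarE 0 0) !mulr0 oppr0 expR0 cos0 sin0 mul1r.
Qed.

Lemma echar1 : echar 1 = 1.
Proof.
by rewrite (echarE 1 0) mulr0 oppr0 expR0 mulr1 mulr_natl cos2pi sin2pi mul1r.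
Qed.

Lemma echar_half : echar (2^-1) = -1.
Proof.
rewrite (_ : 2^-1 = (2^-1 : R) +i* 0); last first.
  by rewrite -[RHS]/((2^-1 : R)%:C) rmorphV ?unitfE//= rmorph_nat.
rewrite echarE mulr0 oppr0 expR0 mulrAC mulfV// !mul1r cospi sinpi.
by apply/eqP; rewrite eq_complex/= oppr0 !eqxx.
Qed.

Lemma echarN z : echar (- z) = (echar z)^-1.
Proof.
by apply: (mulfI (echar_neq0 z)); rewrite -echarD subrr echar0 divff// echar_neq0.
Qed.

Lemma echar_nat n : echar n%:R = 1.
Proof.
elim: n => [|n IHn]; first exact: echar0.
by rewrite -addn1 natrD echarD IHn echar1 mulr1.
Qed.

Lemma echar_int (m : int) : echar m%:~R = 1.
Proof. by case: m => n; rewrite ?NegzE ?rmorphN/= ?echarN -pmulrn echar_nat ?invr1. Qed.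

Lemma echarMn z n : echar (n%:R * z) = echar z ^+ n.
Proof.
elim: n => [|n IHn]; first by rewrite mul0r echar0.
by rewrite -addn1 natrD mulrDl mul1r echarD IHn exprD.
Qed.

Lemma echarDint z (m : int) : echar (z + m%:~R) = echar z.
Proof. by rewrite echarD echar_int mulr1. Qed.

Lemma echar_neq1_int z (m : int) : echar z != 1 -> z - m%:~R != 0.
Proof. by apply: contraNneq => /subr0_eq ->; rewrite echar_int. Qed.

Lemma echar_neq1 z : complex.Im z != 0 -> echar z != 1.
Proof.
apply: contraNneq => /(congr1 (@modulus R)); rewrite modulus_echar modulus1.
rewrite -[RHS]expR0 => /expR_inj/eqP; rewrite oppr_eq0 !mulf_eq0 => /orP[/orP[|]|//].
  by rewrite pnatr_eq0.
by rewrite gt_eqF// pi_gt0.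
Qed.

(** The kernel [w / (1 - w) ^ 2] is both the generating function of the
positive integers and, at [w = echar z], the function [-1 / (2 sin (pi z)) ^ 2]:
it is where the Fourier coefficients of the propagator come from, and, up to a
constant, what the lattice sum along a row adds up to. *)
Definition kernel w : R[i] := w / (1 - w) ^+ 2.

Lemma kernelV w : kernel w^-1 = kernel w.
Proof.
rewrite /kernel; have [->|w0] := eqVneq w 0; first by rewrite invr0.
have [->|w1] := eqVneq w 1; first by rewrite invr1.
have w1' : 1 - w != 0 by rewrite subr_eq0 eq_sym.
have w1'' : 1 - w^-1 != 0 by rewrite subr_eq0 eq_sym -invr1 (inj_eq invr_inj).
rewrite (_ : 1 - w^-1 = - (1 - w) / w); last by field.
by field; rewrite w0 w1'.
Qed.

Lemma kernel_le w (mu rho : R) : modulus w <= mu -> mu <= rho -> rho < 1 ->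
  modulus (kernel w) <= mu / (1 - rho) ^+ 2.
Proof.
move=> wm mr r1; have wr := le_trans wm mr; rewrite /kernel modulusM modulusV modulusX.
have w1 : 1 - rho <= modulus (1 - w).
  by rewrite (le_trans _ (ler_modulusB _ _))// modulus1 lerB.
have r0 : 0 < 1 - rho by rewrite subr_gt0.
rewrite ler_pM ?modulus_ge0 ?invr_ge0 ?sqr_ge0//.
rewrite lef_pV2 ?posrE ?exprn_gt0 ?(lt_le_trans r0)//.
by rewrite lerXn2r ?nnegrE ?(ltW r0)// modulus_ge0.
Qed.

(** The derivative of the geometric series: multiplied by [(1 - w) ^ 2], its
partial sums telescope, which gives the remainder. *)
Lemma kernel_partial_sum w n (mu rho : R) :
  modulus w <= mu -> mu <= rho -> rho < 1 ->
  modulus (kernel w - \sum_(k < n.+1) k%:R * w ^+ k)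
    <= (2 * n).+1%:R * mu ^+ n.+1 / (1 - rho) ^+ 2.
Proof.
move=> wm mr r1; have wr := le_trans wm mr; have r0 : 0 < 1 - rho by rewrite subr_gt0.
have w1 : 1 - rho <= modulus (1 - w).
  by rewrite (le_trans _ (ler_modulusB _ _))// modulus1 lerB.
have w1n : 1 - w != 0 by rewrite -modulus_gt0 (lt_le_trans r0).
have sumE : (1 - w) ^+ 2 * (\sum_(k < n.+1) k%:R * w ^+ k)
    = w - n.+1%:R * w ^+ n.+1 + n%:R * w ^+ n.+2.
  elim: n => [|n IHn]; first by rewrite big_ord_recr big_ord0/=; ring.
  by rewrite big_ord_recr/= mulrDr IHn !exprS; ring.
rewrite (_ : kernel w - _ =
    (n.+1%:R * w ^+ n.+1 - n%:R * w ^+ n.+2) / (1 - w) ^+ 2); last first.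
  apply: (mulfI (expf_neq0 2 w1n)); rewrite mulrBr sumE /kernel.
  by field.
rewrite modulusM modulusV modulusX.
have mu0 : 0 <= mu by rewrite (le_trans (modulus_ge0 w)).
apply: ler_pM; rewrite ?modulus_ge0 ?invr_ge0 ?sqr_ge0//; last first.
  rewrite lef_pV2 ?posrE ?exprn_gt0 ?(lt_le_trans r0)//.
  by rewrite lerXn2r ?nnegrE ?(ltW r0)// modulus_ge0.
rewrite (le_trans (modulusB _ _))// !modulusM !modulus_nat !modulusX.
have h : modulus w ^+ n.+1 <= mu ^+ n.+1.
  by rewrite lerXn2r ?nnegrE ?modulus_ge0.
have h' : modulus w ^+ n.+2 <= mu ^+ n.+1.
  rewrite exprSr (le_trans _ h)// ler_piMr ?exprn_ge0 ?modulus_ge0//.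
  by rewrite (le_trans wr)// ltW.
rewrite (le_trans (lerD (ler_wpM2l (ler0n _ _) h) (ler_wpM2l (ler0n _ _) h')))//.
by rewrite -mulrDl -natrD mul2n -addnn addSn ler_wpM2r ?exprn_ge0.
Qed.

(** For a complex number [r * e^(i theta)] the distance to [1] is at least what
the angle alone accounts for. *)
Lemma kernel_echar_le z (s := sin (pi * complex.Re z)) : s != 0 ->
  modulus (kernel (echar z)) <= (4 * s ^+ 2)^-1.
Proof.
move=> s0; have s2 : 0 < s ^+ 2 by rewrite exprn_even_gt0.
rewrite /kernel modulusM modulusV modulusX modulus_sqr modulus_echar.
case: z @s s0 s2 => x y s s0 s2.
rewrite echarE /=; set r := expR _; have r0 : 0 < r by exact: expR_gt0.
have cosE : cos (2 * pi * x) = 1 - 2 * s ^+ 2.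
  by rewrite -mulrA mulr_natl cos_mulr2n cos2sin2 -[sin (pi * x)]/s; ring.
have sinE : sin (2 * pi * x) ^+ 2 = 1 - (1 - 2 * s ^+ 2) ^+ 2.
  by rewrite sin2cos2 cosE.
rewrite /= !mul0r !subr0 !addr0.
rewrite (_ : _ + _ = (1 - r) ^+ 2 + 4 * r * s ^+ 2); last first.
  by rewrite sub0r sqrrN exprMn sinE cosE; ring.
have D0 : 0 < (1 - r) ^+ 2 + 4 * r * s ^+ 2.
  by rewrite ltr_wpDl ?sqr_ge0// mulr_gt0// mulr_gt0.
have s4 : 0 < 4 * s ^+ 2 by rewrite mulr_gt0.
rewrite ler_pdivrMr// ler_pdivlMl// [leLHS]mulrC mulrA.
by rewrite [r * 4]mulrC lerDr sqr_ge0.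
Qed.

(** Put [u = echar (z / 2)]: the two arguments of the kernel on the right are
[u] and [- u], the square roots of the one on the left. *)
Lemma kernel_duplication z : echar z != 1 ->
  kernel (echar z) = (kernel (echar (z / 2)) + kernel (echar ((z + 1) / 2))) / 4.
Proof.
move=> z1; have z2 : echar z = echar (z / 2) ^+ 2.
  by rewrite -echarMn mulrCA divff ?mulr1// pnatr_eq0.
have -> : echar ((z + 1) / 2) = - echar (z / 2).
  by rewrite mulrDl echarD div1r echar_half mulrN1.
rewrite z2 /kernel in z1 *; set u := echar _ in z1 *.
have u1 : 1 - u != 0 by apply: contraNneq z1 => /subr0_eq <-; rewrite expr1n.
have u2 : 1 + u != 0.
  by apply: contraNneq z1 => /eqP; rewrite addrC addr_eq0 => /eqP->; rewrite sqrrN expr1n.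
have u3 : 1 - u ^+ 2 != 0 by rewrite subr_eq0 eq_sym.
rewrite opprK (_ : 1 - u ^+ 2 = (1 - u) * (1 + u)); last by ring.
by field; rewrite u1 u2.
Qed.

End Exponential.
(** * The lattice sum along a row *)

Section RowSums.
Variable R : realType.
Local Open Scope classical_set_scope.
Local Open Scope ring_scope.
Local Open Scope complex_scope.
Implicit Types (z w a : R[i]).

Lemma echar_dyadic_neq1 z N (j : nat) : echar z != 1 ->
  echar ((z + j%:R) / (2 ^ N)%:R) != 1.
Proof.
apply: contraNneq => /(congr1 (fun w => w ^+ (2 ^ N))).
rewrite -echarMn expr1n mulrCA divff ?mulr1 ?echarD ?echar_nat ?mulr1 => [->//|].
by rewrite pnatr_eq0 expn_eq0.
Qed.

Lemma sum_pow2S (f : nat -> R[i]) N :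
  \sum_(j < 2 ^ N.+1) f j = \sum_(j < 2 ^ N) (f j + f (2 ^ N + j)%N).
Proof. by rewrite big_split/= expnS mul2n -addnn big_split_ord. Qed.

Lemma kernel_dyadic z N : echar z != 1 ->
  kernel (echar z) =
  (\sum_(j < 2 ^ N) kernel (echar ((z + j%:R) / (2 ^ N)%:R))) / (4 ^ N)%:R.
Proof.
move=> z1; have twoN M : (2 ^ M)%:R != 0 :> R[i] by rewrite pnatr_eq0 expn_eq0.
elim: N => [|N ->]; first by rewrite big_ord1 addr0 !divr1.
rewrite (sum_pow2S (fun j => kernel (echar ((z + j%:R) / _)))).
rewrite (expnS 4) natrM invfM [RHS]mulrA; congr (_ / _).
rewrite mulr_suml; apply: eq_bigr => j _.
rewrite (kernel_duplication (echar_dyadic_neq1 N j z1)).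
congr ((kernel (echar _) + kernel (echar _)) / _); rewrite expnS natrM.
  by have := twoN N; move: (2 ^ N)%:R => u u0; field.
by rewrite natrD; have := twoN N; move: (2 ^ N)%:R => u u0; field.
Qed.

(** The terms of the duplication formula, iterated [N.+1] times, arranged
symmetrically around [0] by the periodicity of the summand. *)
Definition dyadic_term z N (j : nat) : R[i] :=
  (kernel (echar ((z + j%:R) / (2 ^ N.+1)%:R))
   + kernel (echar ((z - j.+1%:R) / (2 ^ N.+1)%:R))) / (4 ^ N.+1)%:R.

Lemma kernel_dyadic_sym z N : echar z != 1 ->
  kernel (echar z) = \sum_(j < 2 ^ N) dyadic_term z N j.
Proof.
move=> z1; have twoN : (2 ^ N.+1)%:R != 0 :> R[i] by rewrite pnatr_eq0 expn_eq0.
rewrite (kernel_dyadic N.+1 z1) -mulr_suml; congr (_ / _).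
rewrite (sum_pow2S (fun j => kernel (echar ((z + j%:R) / _)))) !big_split/=.
congr (_ + _); rewrite (reindex_inj rev_ord_inj); apply: eq_bigr => j _ /=.
rewrite -(echarDint _ (-1)); congr (kernel (echar _)).
have -> : (2 ^ N + (2 ^ N - j.+1))%N%:R = (2 ^ N.+1)%:R - j.+1%:R :> R[i].
  apply/(canRL (addrK _)); rewrite -natrD; congr _%:R.
  by rewrite -addnA subnK ?ltn_ord// addnn -mul2n expnS.
by field.
Qed.

Lemma difference_quotient (f : R -> R) (d : R) : is_derive (0 : R) (1 : R) f d ->
  (fun n => (2 ^ n)%:R * (f (2 ^ n)%:R^-1 - f 0)) @ \oo --> d.
Proof.
move=> [df <-].
have h0 : (fun n => (2 ^ n)%:R^-1 : R) @ \oo --> (0 : R).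
  apply/vanishing_cvgr; apply: (@vanishing_le _ _ (fun n => n%:R^-1) 1) => [n n0|].
    rewrite subr0 ger0_norm ?invr_ge0// lef_pV2 ?posrE ?ltr0n ?expn_gt0//.
    by rewrite ler_nat ltnW// ltn_expl.
  exact: vanishing_inv.
have h0' : (fun n => (2 ^ n)%:R^-1 : R) @ \oo --> (0 : R)^'.
  move=> A [e e0 eA]; have [N _ eN] := h0 _ (nbhsx_ballx (0 : R) e e0).
  exists N => // n Nn; apply: eA; first exact: eN.
  by rewrite invr_eq0 pnatr_eq0 expn_eq0.
have := cvg_comp _ _ h0' df.
apply: cvg_trans; apply: near_eq_cvg; near=> n.
by rewrite /= invrK addr0 scaler1.
Unshelve. all: by end_near. Qed.

Lemma tends_echar_diff a :
  tends (fun n => (2 ^ n)%:R * (echar (a / (2 ^ n)%:R) - 1)) ('i * (2 * pi)%:C * a).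
Proof.
case: a => x y.
have E n : (2 ^ n)%:R * (echar ((x +i* y) / (2 ^ n)%:R) - 1) =
    ((2 ^ n)%:R * (expR (- (2 * pi * y * (2 ^ n)%:R^-1))
       * cos (2 * pi * x * (2 ^ n)%:R^-1) - 1))
    +i* ((2 ^ n)%:R * (expR (- (2 * pi * y * (2 ^ n)%:R^-1))
       * sin (2 * pi * x * (2 ^ n)%:R^-1))).
  rewrite -(rmorph_nat (real_complex R)) -fmorphV/=.
  rewrite (_ : (x +i* y) * _ = (x * (2 ^ n)%:R^-1) +i* (y * (2 ^ n)%:R^-1)); last by simpc.
  by rewrite echarE -!mulrA; simpc.
have -> : 'i * (2 * pi)%:C * (x +i* y) = (- (2 * pi * y)) +i* (2 * pi * x).
  by apply/eqP; rewrite eq_complex/=; apply/andP; split; apply/eqP; ring.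
pose f (t : R) := expR (- (2 * pi * y * t)) * cos (2 * pi * x * t).
pose g (t : R) := expR (- (2 * pi * y * t)) * sin (2 * pi * x * t).
have df : is_derive (0 : R) (1 : R) f (- (2 * pi * y)).
  apply: is_derive_eq; rewrite !mulr0 oppr0 expR0 cos0 sin0 /GRing.scale/=; ring.
have dg : is_derive (0 : R) (1 : R) g (2 * pi * x).
  apply: is_derive_eq; rewrite !mulr0 oppr0 expR0 cos0 sin0 /GRing.scale/=; ring.
apply: cvg_tends.
  have := difference_quotient df; rewrite (_ : f 0 = 1); last first.
    by rewrite /f !mulr0 oppr0 expR0 cos0 mulr1.
  by apply: cvg_trans; apply: near_eq_cvg; near=> n; rewrite E.
have := difference_quotient dg; rewrite (_ : g 0 = 0); last first.
  by rewrite /g !mulr0 oppr0 sin0 mulr0.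
by apply: cvg_trans; apply: near_eq_cvg; near=> n; rewrite E/= subr0.
Unshelve. all: by end_near. Qed.

Lemma tends_inv_pow2 : tends (fun n => (2 ^ n)%:R^-1) (0 : R[i]).
Proof.
apply: (@vanishing_le _ _ (fun n => n%:R^-1) 1) (@vanishing_inv R) => n n0.
rewrite subr0 modulusV modulus_nat lef_pV2 ?posrE ?ltr0n ?expn_gt0//.
by rewrite ler_nat ltnW// ltn_expl.
Qed.

(** Since [echar (a / 2 ^ n) - 1] is asymptotic to [2 pi i a / 2 ^ n], the kernel
grows like the inverse of its square. *)
Lemma tends_kernel_dyadic a : a != 0 ->
  tends (fun n => kernel (echar (a / (2 ^ n)%:R)) / (4 ^ n)%:R)
        (- (((2 * pi) ^+ 2)%:C)^-1 * a ^- 2).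
Proof.
move=> a0; set L := 'i * (2 * pi)%:C * a.
have d := tends_echar_diff a; rewrite -/L in d.
have pi0 : (2 * pi : R)%:C != 0.
  by rewrite (fmorph_eq0 (real_complex R)) mulf_neq0// ?pnatr_eq0// gt_eqF// pi_gt0.
have L2 : L ^+ 2 = - ((2 * pi) ^+ 2)%:C * a ^+ 2.
  by rewrite /L exprMn [X in X * _]exprMn sqr_i mulN1r (rmorphXn (real_complex R)).
have w1 : tends (fun n => echar (a / (2 ^ n)%:R)) 1.
  have := tendsD (tendsM tends_inv_pow2 d) (tends_cst 1); rewrite mul0r add0r.
  by apply: tends_eq => n; rewrite mulKf ?subrK// pnatr_eq0 expn_eq0.
have L20 : L ^+ 2 != 0.
  by rewrite L2 mulf_neq0 ?oppr_eq0 ?expf_neq0// (rmorphXn (real_complex R)) expf_neq0.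
have := tendsM w1 (tendsV L20 (tendsM d d)).
rewrite L2 mul1r invfM invrN; apply: tends_eq => n.
rewrite /kernel -[in RHS]mulrA; congr (_ * _).
rewrite -invfM; congr (_^-1).
rewrite (_ : 4 ^ n = (2 ^ n) ^ 2)%N ?natrX -?expnM ?[(n * 2)%N]mulnC ?expnM//.
by ring.
Qed.

Lemma sin_ge_mulcos (u : R) : 0 <= u <= pi / 2 -> u * cos u <= sin u.
Proof.
move=> /andP[]; rewrite le_eqVlt => /predU1P[<- _|u0 upi].
  by rewrite mul0r sin0.
have [c] := @MVT R sin cos 0 u u0 (fun x _ => is_derive_sin x)
  (continuous_subspaceT (@continuous_sin R)).
rewrite in_itv/= => /andP[c0 cu]; rewrite sin0 !subr0 => ->.
rewrite mulrC ler_wpM2r ?(ltW u0)// ltW// ltr_cos ?in_itv/= ?(ltW c0) ?(ltW u0)//=.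
  have := @pi_gt0 R; move: upi; lra.
have := @pi_gt0 R; move: upi cu; lra.
Qed.

(** The range of [a] extends beyond [1 / 2] because the dyadic fractions are
shifted by the real part of [z]. *)
Lemma sin_pi_lower_bound : exists2 k : R, 0 < k &
  forall a : R, `|a| <= 3 / 4 -> k * a ^+ 2 <= sin (pi * a) ^+ 2.
Proof.
have pi0 := @pi_gt0 R.
(* 3 / 8 * pi is half of the largest angle, and sin (2 * u) is estimated by
   means of u * cos u <= sin u *)
pose c : R := cos (3 / 8 * pi).
have c0 : 0 < c by apply: cos_gt0_pihalf; apply/andP; split; lra.
exists ((pi * c ^+ 2) ^+ 2).
  by rewrite exprn_gt0// mulr_gt0// exprn_gt0.
suff h (a : R) : 0 <= a <= 3 / 4 -> pi * c ^+ 2 * a <= sin (pi * a).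
  move=> a a34; rewrite -(real_normK (num_real (sin _))) -[a ^+ 2]real_normK ?num_real// -exprMn.
  rewrite lerXn2r ?nnegrE ?mulr_ge0 ?(ltW c0) ?(ltW pi0)//.
  have := h `|a|; rewrite normr_ge0 a34 => /(_ isT)/le_trans; apply.
  rewrite (le_trans (ler_norm _))//; have [a0|a0] := ger0P a => //.
  by rewrite mulrN sinN normrN.
move=> /andP[a0 a34]; pose u := pi * a / 2.
have u0 : 0 <= u by rewrite divr_ge0// mulr_ge0// ltW.
have u38 : u <= 3 / 8 * pi.
  have : pi * a <= pi * (3 / 4) by rewrite ler_pM2l.
  by rewrite /u; lra.
have cu : c <= cos u.
  have i1 : 3 / 8 * pi \in `[(0 : R), pi]%R by rewrite in_itv/=; apply/andP; split; lra.
  have i2 : u \in `[(0 : R), pi]%R by rewrite in_itv/= u0/=; lra.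
  by rewrite /c leNgt ltr_cos// -leNgt.
have -> : pi * a = u *+ 2 by rewrite /u mulr2n; field.
rewrite sin_mulr2n mulr2n.
have us : u * cos u <= sin u by apply: sin_ge_mulcos; rewrite u0; lra.
have -> : pi * c ^+ 2 * a = (u * c * c) *+ 2 by rewrite /u mulr2n; field.
rewrite mulr2n; suff : u * c * c <= cos u * sin u by lra.
rewrite mulrC ler_pM ?(ltW c0) ?(mulr_ge0 u0 (ltW c0))//.
by rewrite (le_trans _ us)// ler_wpM2l.
Qed.

(** The domination that allows to pass to the limit in the iterated duplication
formula term by term. *)
Lemma kernel_dyadic_bound : exists2 B : R, 0 < B & forall b N,
  complex.Re b != 0 -> `|complex.Re b| <= 3 / 4 * (2 ^ N)%:R ->
  modulus (kernel (echar (b / (2 ^ N)%:R)) / (4 ^ N)%:R) <= B / complex.Re b ^+ 2.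
Proof.
have [k k0 sink] := sin_pi_lower_bound; exists (4 * k)^-1.
  by rewrite invr_gt0 mulr_gt0.
move=> b N b0 bN; pose T : R := (2 ^ N)%:R; rewrite -/T in bN.
have T0 : 0 < T by rewrite ltr0n expn_gt0.
pose a := complex.Re (b / (2 ^ N)%:R).
have aE : a = complex.Re b / T.
  rewrite /a -(rmorph_nat (real_complex R)) -fmorphV/=.
  by case: b {b0 bN a} => x y /=; rewrite mulr0 subr0.
have a34 : `|a| <= 3 / 4 by rewrite aE normrM normfV (gtr0_norm T0) ler_pdivrMr.
have ka : 0 < k * a ^+ 2.
  by rewrite mulr_gt0// exprn_even_gt0//= aE mulf_neq0// invr_eq0 gt_eqF.
have s2 := sink a a34.
have s0 : sin (pi * a) != 0.
  by apply: contraTneq s2 => ->; rewrite expr0n/= -ltNge.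
rewrite modulusM modulusV modulus_nat.
have -> : (4 ^ N)%:R = T ^+ 2 :> R.
  by rewrite -natrX -expnM mulnC expnM.
rewrite ler_pdivrMr ?exprn_gt0// (le_trans (kernel_echar_le s0))//.
have -> : (4 * k)^-1 / complex.Re b ^+ 2 * T ^+ 2 = (4 * (k * a ^+ 2))^-1.
  by rewrite aE; field; rewrite b0 !gt_eqF.
by rewrite -/a lef_pV2 ?posrE ?ler_pM2l// mulr_gt0// (lt_le_trans ka).
Qed.

Lemma sum_inv_sqr (J K : nat) : (0 < J)%N ->
  \sum_(J <= j < K) (j%:R ^+ 2)^-1 <= 2 / J%:R :> R.
Proof.
move=> J0; have [KJ|/ltnW JK] := leqP K J; first by rewrite big_geq// divr_ge0.
suff : \sum_(J <= j < K) (j%:R ^+ 2)^-1 <= 2 / J%:R - 2 / K%:R :> R.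
  by move=> /le_trans; apply; rewrite gerBl divr_ge0.
elim: K JK => [|K IHK]; first by rewrite leqn0 => /eqP J00; rewrite J00 in J0.
rewrite leq_eqVlt => /predU1P[<-|]; first by rewrite big_geq// subrr.
rewrite ltnS => JK; rewrite big_nat_recr//=.
have x1 : 1 <= K%:R :> R by rewrite ler1n (leq_trans J0).
have KS : K.+1%:R = K%:R + 1 :> R by rewrite natr1.
move: (IHK JK); rewrite KS; move: (K%:R) x1 => x x1.
suff : (x ^+ 2)^-1 <= 2 / x - 2 / (x + 1) by lra.
rewrite -subr_ge0 (_ : _ - _ = (x - 1) / (x ^+ 2 * (x + 1))).
  by rewrite divr_ge0 ?subr_ge0// mulr_ge0 ?sqr_ge0// addr_ge0// (le_trans ler01).
by field; rewrite !gt_eqF//; lra.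
Qed.

(** Dominated convergence for sums whose range grows with the parameter. *)
Lemma tannery (A : nat -> nat -> R[i]) (l : nat -> R[i]) (K : nat -> nat)
    (B : R) (N0 : nat) : 0 <= B ->
  (forall j, tends (A^~ j) (l j)) ->
  (forall N j, (N0 <= N)%N -> (N0 <= j < K N)%N -> modulus (A N j) <= B / j%:R ^+ 2) ->
  (forall j, (N0 <= j)%N -> modulus (l j) <= B / j%:R ^+ 2) ->
  (forall N, (N <= K N)%N) ->
  vanishing (fun N => modulus (\sum_(j < K N) A N j - \sum_(j < K N) l j)).
Proof.
move=> B0 Al AB lB NK e e0; have e2 : 0 < e / 2 by rewrite divr_gt0.
have /(_ _ e2)[J0 JB] : vanishing (fun J => (4 * B) * J%:R^-1).
  by apply: vanishingZ (@vanishing_inv R); rewrite mulr_ge0.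
pose J := (maxn J0 N0).+1.
have /(_ _ e2)[M AM] : vanishing (fun N => \sum_(j < J) modulus (A N j - l j)).
  exact: (@vanishing_sum _ J (fun N j => modulus (A N j - l j))).
exists (maxn M (maxn J N0)) => N; rewrite !geq_max => /and3P[MN JN N0N].
have JK : (J <= K N)%N := leq_trans JN (NK N).
rewrite -sumrB (le_trans (modulus_sum _ _ _))//.
rewrite -(big_mkord xpredT (fun j => modulus (A N j - l j))).
rewrite (big_cat_nat (n := J))//= big_mkord (splitr e) lerD ?AM//.
have J1 : (J0 <= J)%N by rewrite ltnW// ltnS leq_maxl.
have NJ : (N0 <= J)%N by rewrite ltnW// ltnS leq_maxr.
rewrite (le_trans _ (JB J J1))//.
apply: (@le_trans _ _ (\sum_(J <= j < K N) (2 * B) * (j%:R ^+ 2)^-1)).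
  apply: ler_sum_nat => j /andP[Jj jK]; rewrite (le_trans (modulusB _ _))//.
  rewrite mulr_natl mulr2n mulrDl lerD//; last exact: lB (leq_trans NJ Jj).
  by apply: AB => //; rewrite (leq_trans NJ Jj).
rewrite -mulr_sumr; have := @sum_inv_sqr J (K N) isT.
move=> /(ler_wpM2l (mulr_ge0 (ler0n R 2) B0))/le_trans; apply.
by rewrite le_eqVlt; apply/orP; left; apply/eqP; ring.
Qed.

Definition rowsum z (K : nat) : R[i] :=
  \sum_(j < K) ((z + j%:R) ^- 2 + (z - j.+1%:R) ^- 2).

Lemma Re_addn z n : complex.Re (z + n%:R) = complex.Re z + n%:R.
Proof. by rewrite -(rmorph_nat (real_complex R)); case: z. Qed.

Lemma Re_subn z n : complex.Re (z - n%:R) = complex.Re z - n%:R.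
Proof. by rewrite -(rmorph_nat (real_complex R)); case: z. Qed.

Lemma row_term_bound z (j : nat) : (0 < j)%N -> 2 * `|complex.Re z| <= j%:R ->
  j%:R / 2 <= `|complex.Re (z + j%:R)| /\ j%:R / 2 <= `|complex.Re (z - j.+1%:R)|.
Proof.
rewrite Re_addn Re_subn; move: (complex.Re z) => x j0 xj.
have jS : j.+1%:R = j%:R + 1 :> R by rewrite natr1.
have xle := ler_norm x; have xge := ler_norm (- x); rewrite normrN in xge.
split; first by rewrite ger0_norm; lra.
by rewrite ler0_norm jS; lra.
Qed.

Lemma inv_sqr_modulus_le w (c : R) : 0 < c -> c <= `|complex.Re w| ->
  modulus (w ^- 2) <= c ^- 2.
Proof.
move=> c0 cw; have cm := le_trans cw (modulus_Re w).
rewrite modulusV modulusX lef_pV2 ?posrE ?exprn_gt0 ?(lt_le_trans c0)//.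
by rewrite lerXn2r ?nnegrE ?modulus_ge0// ltW.
Qed.

Lemma rowsum_tail z : exists2 B : R, 0 <= B & exists N0, forall n m,
  (N0 <= n <= m)%N -> modulus (rowsum z m - rowsum z n) <= B / n%:R.
Proof.
exists 16 => //; exists (Num.truncn (2 * `|complex.Re z|)).+1 => n m /andP[zn nm].
have n0 : (0 < n)%N by exact: leq_trans zn.
have zn' : 2 * `|complex.Re z| <= n%:R.
  by rewrite (le_trans (ltW (truncnS_gt _)))// ler_nat.
rewrite /rowsum -!(big_mkord xpredT (fun j => (z + j%:R) ^- 2 + (z - j.+1%:R) ^- 2)).
rewrite (big_cat_nat (n := n) (p := m))//= addrAC subrr add0r.
rewrite (le_trans (modulus_sum _ _ _))//.
apply: (@le_trans _ _ (\sum_(n <= j < m) 8 * (j%:R ^+ 2)^-1)); last first.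
  rewrite -mulr_sumr (le_trans (ler_wpM2l _ (sum_inv_sqr m n0)))//.
  by rewrite mulrA -natrM.
apply: ler_sum_nat => j /andP[nj _].
have j0 := leq_trans n0 nj.
have zj : 2 * `|complex.Re z| <= j%:R by rewrite (le_trans zn')// ler_nat.
have [h1 h2] := row_term_bound j0 zj.
have j2 : 0 < j%:R / 2 :> R by rewrite divr_gt0// ltr0n.
rewrite (le_trans (modulusD _ _))//.
rewrite (le_trans (lerD (inv_sqr_modulus_le j2 h1) (inv_sqr_modulus_le j2 h2)))//.
by rewrite le_eqVlt; apply/orP; left; apply/eqP; field; rewrite pnatr_eq0 -lt0n.
Qed.

(** For each [N] the iterated duplication formula writes the kernel as a sum of
[2 ^ N.+1] terms, and these converge to the terms of the row sum.  The result is
the expansion of [(pi / sin (pi z)) ^ 2] in partial fractions. *)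
Lemma tends_rowsum z : echar z != 1 ->
  tends (rowsum z) (- ((2 * pi) ^+ 2)%:C * kernel (echar z)).
Proof.
move=> z1; pose c : R[i] := ((2 * pi) ^+ 2)%:C.
have c0 : c != 0.
  by rewrite (fmorph_eq0 (real_complex R)) expf_neq0 ?mulf_neq0 ?pnatr_eq0// gt_eqF ?pi_gt0.
have [B B0 kB] := kernel_dyadic_bound.
pose l (j : nat) := - c^-1 * ((z + j%:R) ^- 2 + (z - j.+1%:R) ^- 2).
have limA j : tends (dyadic_term z ^~ j) (l j).
  have h1 : z + j%:R != 0.
    by have := echar_neq1_int (- j%:Z) z1; rewrite rmorphN opprK.
  have h2 : z - j.+1%:R != 0 by have := echar_neq1_int j.+1%:Z z1.
  rewrite /l mulrDr; have := tendsD (tends_kernel_dyadic h1) (tends_kernel_dyadic h2).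
  move=> /(tends_comp (phi := S)) => /(_ leqnSn); apply: tends_eq => N /=.
  by rewrite -mulrDl.
(* from N0 on, the real part of z is at most half of the index *)
pose N0 := (Num.truncn (2 * `|complex.Re z|)).+1.
have jz j : (N0 <= j)%N -> (0 < j)%N /\ 2 * `|complex.Re z| <= j%:R.
  move=> Nj; split; first exact: leq_trans Nj.
  by rewrite (le_trans (ltW (truncnS_gt _)))// ler_nat.
have jz2 j : (N0 <= j)%N -> let q := (j%:R / 2 : R) in
    [/\ 0 < q, q <= `|complex.Re (z + j%:R)| & q <= `|complex.Re (z - j.+1%:R)|].
  by move=> /jz[j0 zj] q; have [? ?] := row_term_bound j0 zj; split=> //;
    rewrite divr_gt0// ltr0n.
have q2 (j : nat) : (N0 <= j)%N -> (j%:R / 2 : R) ^- 2 = 4 / j%:R ^+ 2.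
  by move=> /jz[j0 _]; field; rewrite pnatr_eq0 -lt0n.
pose D : R := 8 * (B + modulus c^-1).
have D0 : 0 <= D by rewrite mulr_ge0// addr_ge0 ?modulus_ge0// ltW.
have AD N j : (N0 <= N)%N -> (N0 <= j < 2 ^ N)%N ->
    modulus (dyadic_term z N j) <= D / j%:R ^+ 2.
  move=> N0N /andP[Nj jN]; have [q0 h1 h2] := jz2 j Nj.
  have [_ zN] := jz N N0N.
  have NN : N%:R <= (2 ^ N)%:R :> R by rewrite ler_nat ltnW// ltn_expl.
  have jN' : j.+1%:R <= (2 ^ N)%:R :> R by rewrite ler_nat.
  have b w : j%:R / 2 <= `|complex.Re w| -> `|complex.Re w| <= 3 / 4 * (2 ^ N.+1)%:R ->
      modulus (kernel (echar (w / (2 ^ N.+1)%:R)) / (4 ^ N.+1)%:R) <= B * (4 / j%:R ^+ 2).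
    move=> qw wN; have w0 : complex.Re w != 0.
      by rewrite -normr_gt0 (lt_le_trans q0).
    rewrite (le_trans (kB _ _ w0 wN))// ler_wpM2l ?(ltW B0)// -q2//.
    rewrite -(real_normK (num_real (complex.Re w))).
    rewrite lef_pV2 ?posrE ?exprn_gt0 ?(lt_le_trans q0)//.
    by rewrite lerXn2r ?nnegrE ?(ltW q0).
  have S1 : j.+1%:R = j%:R + 1 :> R by rewrite natr1.
  have S2 : (2 ^ N.+1)%:R = 2 * (2 ^ N)%:R :> R by rewrite expnS natrM.
  have xle := ler_norm (complex.Re z).
  have xge := ler_norm (- complex.Re z); rewrite normrN in xge.
  have j0 : 0 <= j%:R :> R by [].
  rewrite /dyadic_term mulrDl (le_trans (modulusD _ _))//.
  rewrite (le_trans (lerD (b _ h1 _) (b _ h2 _)))//.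
  - by rewrite Re_addn S2 ler_norml; apply/andP; split; lra.
  - by rewrite Re_subn S2 ler_norml; apply/andP; split; lra.
  have j2 : 0 <= (j%:R ^+ 2)^-1 :> R by rewrite invr_ge0 sqr_ge0.
  rewrite /D [8 * _]mulrDr [leRHS]mulrDl -[leLHS]addr0 lerD//; last first.
    by rewrite !mulr_ge0// modulus_ge0.
  by rewrite le_eqVlt; apply/orP; left; apply/eqP; ring.
have lD j : (N0 <= j)%N -> modulus (l j) <= D / j%:R ^+ 2.
  move=> Nj; have [q0 h1 h2] := jz2 j Nj.
  rewrite /l modulusM modulusN.
  have h := le_trans (modulusD _ _)
    (lerD (inv_sqr_modulus_le q0 h1) (inv_sqr_modulus_le q0 h2)).
  rewrite (le_trans (ler_wpM2l (modulus_ge0 _) h))// !q2//.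
  have j2 : 0 <= (j%:R ^+ 2)^-1 :> R by rewrite invr_ge0 sqr_ge0.
  rewrite /D [8 * _]mulrDr [leRHS]mulrDl -[leLHS]add0r lerD//.
    by rewrite !mulr_ge0// ltW.
  by rewrite le_eqVlt; apply/orP; left; apply/eqP; ring.
have K2 N : (N <= 2 ^ N)%N by rewrite ltnW// ltn_expl.
have := tannery D0 limA AD lD K2.
have -> : (fun N => modulus (\sum_(j < 2 ^ N) dyadic_term z N j - \sum_(j < 2 ^ N) l j))
   = fun N => modulus (- c^-1 * rowsum z (2 ^ N) - kernel (echar z)).
  by apply/funext => N; rewrite -kernel_dyadic_sym// modulusBC -mulr_sumr.
move=> /(tendsZ (- c)); rewrite -/c => h.
have {}h : tends (fun N => rowsum z (2 ^ N)) (- c * kernel (echar z)).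
  by apply: tends_eq h => N; rewrite mulrA mulrNN mulfV// mul1r.
apply: tends_near h; have [E E0 [M EM]] := rowsum_tail z.
apply: (@vanishing_le _ _ _ M) (vanishingZ E0 (@vanishing_inv R)) => n Mn.
by apply: EM; rewrite Mn K2.
Qed.

(** The value of the zeta function at [2], in the form in which it enters the
lattice sum: at [z = 1 / 2] the row sum runs over the inverse squares of the odd
numbers, which make up three quarters of the sum over all the integers. *)
Lemma tends_zeta2 :
  tends (fun N => \sum_(j < N) (j.+1%:R ^+ 2)^-1) ((pi ^+ 2 / 6)%:C : R[i]).
Proof.
pose H N : R[i] := \sum_(j < N) (j.+1%:R ^+ 2)^-1.
pose O N : R[i] := \sum_(j < N) ((2 * j + 1)%:R ^+ 2)^-1.
have HE N : H (2 * N)%N = O N + 4^-1 * H N.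
  elim: N => [|N IHN]; first by rewrite /H /O muln0 !big_ord0 mulr0 addr0.
  rewrite /H /O mulnS !big_ord_recr/= mulrDr -/(H _) -/(O _) -/(H _) IHN.
  rewrite addrACA !addrA; congr (_ + _ + _ + _); first by rewrite addn1.
  have -> : (2 * N).+2%:R = 2 * N.+1%:R :> R[i] by rewrite -natrM mulnS.
  by rewrite exprMn invfM; congr (_ * _); rewrite -natrX.
have OE N : O N = 8^-1 * rowsum (2^-1) N.
  rewrite /O /rowsum mulr_sumr; apply: eq_bigr => j _.
  have -> : (2 * j + 1)%:R = 2 * (2^-1 + j%:R) :> R[i].
    by rewrite natrD natrM mulrDr divff ?pnatr_eq0// addrC.
  have -> : 2^-1 - j.+1%:R = - (2^-1 + j%:R) :> R[i].
    by rewrite -natr1; field.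
  by rewrite sqrrN exprMn; field.
have piE k : (pi ^+ 2 / k%:R : R)%:C = (pi : R)%:C ^+ 2 / k%:R.
  by rewrite (rmorphM (real_complex R) (pi ^+ 2)) (rmorphXn (real_complex R))
    fmorphV (rmorph_nat (real_complex R)).
have kernelN1 : kernel (-1 : R[i]) = - 4^-1 by rewrite /kernel opprK; field.
have OL : tends O ((pi ^+ 2 / 8)%:C : R[i]).
  have h1 : echar (2^-1 : R[i]) != 1.
    by rewrite echar_half eq_sym -subr_eq0 opprK (_ : 1 + 1 = 2%:R) ?pnatr_eq0// -natrD.
  have := tendsZ 8^-1 (tends_rowsum h1); rewrite echar_half kernelN1.
  rewrite (_ : 8^-1 * _ = (pi ^+ 2 / 8)%:C).
    by apply: tends_eq => N; rewrite OE.
  by rewrite piE (rmorphXn (real_complex R)) (rmorphM (real_complex R))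
    (rmorph_nat (real_complex R)) !exprMn; field.
have HH : tends (fun N => H (2 * N)%N - H N) 0.
  apply: (@vanishing_le _ _ (fun N => 2 * N%:R^-1) 1) => [N N0|]; last first.
    by apply: vanishingZ (@vanishing_inv R).
  rewrite subr0 /H -!(big_mkord xpredT (fun j => (j.+1%:R ^+ 2)^-1)).
  rewrite (big_cat_nat (n := N) (p := (2 * N)%N))//=; last by rewrite leq_pmull.
  rewrite addrAC subrr add0r (le_trans (modulus_sum _ _ _))//.
  rewrite (le_trans _ (@sum_inv_sqr N (2 * N) N0))//.
  apply: ler_sum_nat => j /andP[Nj _]; have j0 := leq_trans N0 Nj.
  rewrite modulusV modulusX modulus_nat lef_pV2 ?posrE ?exprn_gt0 ?ltr0n//.
  by rewrite lerXn2r ?nnegrE// ler_nat.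
have := tendsZ (4 / 3) (tendsB OL HH); rewrite subr0.
rewrite (_ : 4 / 3 * _ = (pi ^+ 2 / 6)%:C); last first.
  by rewrite !piE; field.
apply: tends_eq => N; rewrite -/(H N) HE.
by field.
Qed.

(** The sum of [g] over [[-N, N]], indexed like the squares in the definition of
the Weierstrass function. *)
Definition symsum (N : nat) (g : int -> R[i]) : R[i] :=
  \sum_(i < (2 * N).+1) g (i%:Z - N%:Z).

Lemma symsumS N g :
  symsum N.+1 g = symsum N g + (g N.+1%:Z + g (- N.+1%:Z)).
Proof.
rewrite /symsum mulnS big_ord_recl big_ord_recr/=.
set A := g _; set B := \sum_(i < _) _; set C := g _.
have -> : A = g (- N.+1%:Z) by rewrite /A; congr g; lia.
have -> : C = g N.+1%:Z by rewrite /C /bump/=; congr g; lia.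
have -> : B = symsum N g.
  by apply: eq_bigr => i _; rewrite /bump/=; congr g; lia.
by rewrite -/(symsum N g) [LHS]addrC -[LHS]addrA.
Qed.

Lemma symsum0 g : symsum 0 g = g 0.
Proof. by rewrite /symsum big_ord1. Qed.

Lemma symsumB N g h : symsum N (fun m => g m - h m) = symsum N g - symsum N h.
Proof. exact: sumrB. Qed.

Lemma symsumZ N (c : R[i]) g : symsum N (fun m => c * g m) = c * symsum N g.
Proof. by rewrite /symsum mulr_sumr. Qed.

Lemma modulus_symsum N g (c : R) : (forall m, modulus (g m) <= c) ->
  modulus (symsum N g) <= (2 * N).+1%:R * c.
Proof.
move=> gc; rewrite (le_trans (modulus_sum _ _ _))//.
rewrite (le_trans (ler_sum _ (fun i _ => gc _)))//.
by rewrite sumr_const card_ord mulr_natl.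
Qed.

Lemma symsum_rowsum z N :
  symsum N (fun m => (z - m%:~R) ^- 2) = rowsum z N + (z + N%:R) ^- 2.
Proof.
elim: N => [|N IHN]; first by rewrite symsum0 /rowsum big_ord0 subr0 addr0 add0r.
rewrite symsumS IHN /rowsum big_ord_recr/= rmorphN/= opprK -!pmulrn.
by rewrite !addrA.
Qed.

Lemma tends_symsum_row z : echar z != 1 ->
  tends (fun N => symsum N (fun m => (z - m%:~R) ^- 2))
        (- ((2 * pi) ^+ 2)%:C * kernel (echar z)).
Proof.
move=> z1; apply: tends_near (tends_rowsum z1).
apply: (@vanishing_le _ _ (fun N => 4 * N%:R^-1) (Num.truncn (2 * `|complex.Re z|)).+1).
  move=> N zN; have N0 : (0 < N)%N by exact: leq_trans zN.
  have zN' : 2 * `|complex.Re z| <= N%:R.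
    by rewrite (le_trans (ltW (truncnS_gt _)))// ler_nat.
  have [h _] := row_term_bound N0 zN'.
  have N2 : 0 < N%:R / 2 :> R by rewrite divr_gt0// ltr0n.
  rewrite symsum_rowsum opprD addrA subrr add0r modulusN.
  rewrite (le_trans (inv_sqr_modulus_le N2 h))//.
  rewrite (_ : _ ^- 2 = 4 * N%:R^-1 * N%:R^-1); last first.
    by field; rewrite pnatr_eq0 -lt0n.
  by rewrite ler_piMr ?mulr_ge0 ?invr_ge0// invf_le1 ?ltr0n// ler1n.
by apply: vanishingZ (@vanishing_inv R).
Qed.

(** In the row through the origin the summand at [0] is [0 ^ -2 = 0]. *)
Lemma tends_symsum_row0 :
  tends (fun N => symsum N (fun m => (0 - m%:~R) ^- 2)) ((pi ^+ 2 / 3)%:C : R[i]).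
Proof.
have := tendsZ 2 tends_zeta2; rewrite (_ : 2 * _ = (pi ^+ 2 / 3)%:C); last first.
  rewrite -(rmorph_nat (real_complex R)) -(rmorphM (real_complex R)).
  by congr (_%:C); field.
apply: tends_eq; elim=> [|N IHN].
  by rewrite symsum0 big_ord0 mulr0 subr0 expr0n invr0.
rewrite symsumS -IHN big_ord_recr/= mulrDr; congr (_ + _).
by rewrite rmorphN/= opprK !sub0r sqrrN add0r mulr_natl mulr2n -!pmulrn.
Qed.

End RowSums.
(** * The Fourier expansion of the propagator *)

Section GeometricBounds.
Variables (R : realType) (a : R).
Hypothesis a_gt0 : 0 < a.
Let rho := expR (- a).

(** [expR u = expR (u / 3) ^ 3] is at least [(u / 3) ^ 3], for [u = a * N]. *)
Lemma vanishing_sqr_geometric : vanishing (fun N => N%:R ^+ 2 * rho ^+ N).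
Proof.
have a3 : 0 <= 27 / a ^+ 3 by rewrite divr_ge0// exprn_ge0// ltW.
apply: (@vanishing_le _ _ _ 1) (vanishingZ a3 (@vanishing_inv R)) => N N0.
have N1 : 0 < N%:R :> R by rewrite ltr0n.
have aN : 0 < a * N%:R / 3 by rewrite divr_gt0// mulr_gt0.
rewrite -expRM_natr mulNr expRN.
have -> : 27 / a ^+ 3 * N%:R^-1 = N%:R ^+ 2 / (a * N%:R / 3) ^+ 3.
  by field; rewrite !gt_eqF.
rewrite ler_wpM2l ?sqr_ge0// lef_pV2 ?posrE ?expR_gt0 ?exprn_gt0//.
set u := a * N%:R / 3 in aN *; have -> : a * N%:R = u * 3%:R by rewrite /u; field.
rewrite expRM_natr lerXn2r ?nnegrE ?expR_ge0 ?(ltW aN)//.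
by rewrite (le_trans _ (expR_ge1Dx _))// lerDr.
Qed.

Lemma rho_ge0 : 0 <= rho. Proof. exact: expR_ge0. Qed.

Lemma rho_lt1 : rho < 1. Proof. by rewrite expR_lt1 oppr_lt0. Qed.

Lemma vanishing_geometric : vanishing (fun N => rho ^+ N).
Proof.
apply: (@vanishing_le _ _ _ 1) vanishing_sqr_geometric => N N0.
by rewrite ler_peMl ?exprn_ge0 ?rho_ge0// exprn_ege1// ler1n.
Qed.

Lemma vanishing_square_geometric :
  vanishing (fun N => (2 * N).+1%:R ^+ 2 * rho ^+ N.+1).
Proof.
have n0 : (0 : R) <= 9 by [].
apply: (@vanishing_le _ _ _ 1) (vanishingZ n0 vanishing_sqr_geometric) => N N0.
rewrite mulrA ler_pM ?sqr_ge0 ?exprn_ge0 ?rho_ge0//.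
  rewrite (_ : 9 * N%:R ^+ 2 = (3 * N)%:R ^+ 2); last by rewrite natrM; ring.
  by rewrite lerXn2r ?nnegrE// ler_nat; lia.
by rewrite exprS ler_piMl ?exprn_ge0 ?rho_ge0// ltW// rho_lt1.
Qed.

Lemma geometric_tail n m : (n <= m)%N ->
  \sum_(n <= j < m) rho ^+ j.+1 <= rho ^+ n / (1 - rho).
Proof.
have r0 := rho_ge0; have r1 : 0 < 1 - rho by rewrite subr_gt0 rho_lt1.
move=> nm; rewrite ler_pdivlMr// mulrBr mulr1 mulr_suml -sumrB.
rewrite (@telescope_sumr_eq R n m (fun j => - rho ^+ j.+1))//; last first.
  by move=> j _; rewrite -exprSr opprK addrC.
have h1 : 0 <= rho ^+ m.+1 by rewrite exprn_ge0.
have h2 : rho ^+ n.+1 <= rho ^+ n.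
  by rewrite exprS ler_piMl ?exprn_ge0// ltW// rho_lt1.
lra.
Qed.

End GeometricBounds.

Section Lattice.
Variable R : realType.
Local Open Scope classical_set_scope.
Local Open Scope ring_scope.
Local Open Scope complex_scope.
Implicit Types (z w tau : R[i]).

(** The leading orders of the two terms cancel, so that the difference decays
like a third power. *)
Lemma lattice_term_bound z w : w != 0 -> 2 * modulus z <= modulus w ->
  modulus ((z - w) ^- 2 - w ^- 2) <= 10 * modulus z / modulus w ^+ 3.
Proof.
move=> w0 zw; have mw : 0 < modulus w by rewrite modulus_gt0.
have mz := modulus_ge0 z.
have zw2 : modulus w / 2 <= modulus (z - w).
  by have := ler_modulusB w z; rewrite modulusBC; lra.
have zw0 : z - w != 0 by rewrite -modulus_gt0 (lt_le_trans _ zw2)// divr_gt0.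
have -> : (z - w) ^- 2 - w ^- 2 = z * (w *+ 2 - z) / (w ^+ 2 * (z - w) ^+ 2).
  by rewrite mulr2n; field; rewrite w0 zw0.
rewrite modulusM modulusV modulusM [modulus (w ^+ 2 * _)]modulusM !modulusX.
have h1 : modulus (w *+ 2 - z) <= 5 / 2 * modulus w.
  rewrite (le_trans (modulusB _ _))// mulr2n.
  by have := modulusD w w; lra.
have h2 : (modulus w ^+ 2 * modulus (z - w) ^+ 2)^-1 <=
    (modulus w ^+ 2 * (modulus w / 2) ^+ 2)^-1.
  rewrite lef_pV2 ?posrE ?mulr_gt0 ?exprn_gt0 ?divr_gt0// ?(lt_le_trans _ zw2) ?divr_gt0//.
  by rewrite ler_pM2l ?exprn_gt0// lerXn2r ?nnegrE ?divr_ge0 ?modulus_ge0.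
rewrite (le_trans (ler_pM _ _ (ler_wpM2l mz h1) h2))//.
- by rewrite mulr_ge0 ?modulus_ge0.
- by rewrite invr_ge0 mulr_ge0 ?sqr_ge0.
by rewrite le_eqVlt; apply/orP; left; apply/eqP; field; rewrite gt_eqF.
Qed.

(** The area of the parallelogram spanned by [m + n * tau] and [tau] does not
depend on [n], and is at most the product of its sides. *)
Lemma lattice_modulus tau (m n : int) :
  `|m%:~R| * complex.Im tau <= modulus (m%:~R + n%:~R * tau) * modulus tau.
Proof.
have [t0|t0] := leP (complex.Im tau) 0.
  by rewrite (le_trans (mulr_ge0_le0 _ t0))// mulr_ge0 ?modulus_ge0.
rewrite -(rmorph_int (real_complex R) m) -(rmorph_int (real_complex R) n).
move: (m%:~R) (n%:~R) => x y; case: tau t0 => a b /= b0.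
have -> : modulus (a +i* b) = modulus (a -i* b) by rewrite /modulus/= sqrrN.
rewrite -modulusM (le_trans _ (modulus_Im _))//=.
rewrite (_ : _ + _ = - (x * b)); last by ring.
by rewrite normrN normrM (gtr0_norm b0).
Qed.

(** The row of height [n] of the lattice sum.  For [n = 0] the convention
[0 ^ -2 = 0] removes the second term at the origin. *)
Definition row_difference tau z (N : nat) (n : int) : R[i] :=
  symsum N (fun m : int => (z - n%:~R * tau - m%:~R) ^- 2
                           - (0 - n%:~R * tau - m%:~R) ^- 2).

(** Uniformly in [n], the part of a row outside the square [[-N, N] ^ 2] is
[O(1 / N ^ 2)].  As the square meets [2 * N + 1] rows, summation by squares and
summation by rows have the same limit. *)
Lemma row_difference_tail tau z : upper_half tau ->
  exists2 C : R, 0 <= C & exists N0, forall N M (n : int), (N0 <= N <= M)%N ->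
    modulus (row_difference tau z M n - row_difference tau z N n) <= C / N%:R ^+ 2.
Proof.
move=> b0; have t0 : 0 < modulus tau.
  rewrite modulus_gt0; apply: contraTneq b0 => ->.
  by rewrite /upper_half ltxx.
pose c := complex.Im tau / modulus tau; have c0 : 0 < c by rewrite divr_gt0.
pose D := 10 * modulus z / c ^+ 3.
have D0 : 0 <= D.
  by apply: divr_ge0; [rewrite mulr_ge0 ?modulus_ge0|rewrite exprn_ge0// ltW].
exists (4 * D); first by rewrite mulr_ge0.
pose N0 := (Num.truncn (2 * modulus z / c)).+1; exists N0 => N M n /andP[N0N NM].
pose g (m : int) := (z - n%:~R * tau - m%:~R) ^- 2 - (0 - n%:~R * tau - m%:~R) ^- 2.
have N_gt0 : (0 < N)%N by exact: leq_trans N0N.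
have gm (m : int) (j : nat) : (N <= j)%N -> `|m%:~R| = j.+1%:R :> R ->
    modulus (g m) <= D / (N%:R * j%:R ^+ 2).
  move=> Nj mj; set w := m%:~R + n%:~R * tau.
  have cw : c * j.+1%:R <= modulus w.
    by rewrite /c mulrAC ler_pdivrMr// mulrC -mj; exact: lattice_modulus.
  have zc : 2 * modulus z <= c * j.+1%:R.
    rewrite [leRHS]mulrC -ler_pdivrMr// (le_trans (ltW (truncnS_gt _)))// ler_nat.
    by rewrite (leq_trans N0N)// leqW.
  have cj : 0 < c * j.+1%:R by rewrite mulr_gt0.
  have w0 : w != 0 by rewrite -modulus_gt0 (lt_le_trans cj).
  have -> : g m = (z - w) ^- 2 - w ^- 2.
    rewrite /g (_ : z - n%:~R * tau - m%:~R = z - w); last by rewrite /w; ring.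
    by rewrite (_ : 0 - n%:~R * tau - m%:~R = - w) ?sqrrN// /w; ring.
  rewrite (le_trans (lattice_term_bound w0 (le_trans zc cw)))//.
  rewrite /D -[leRHS]mulrA ler_wpM2l ?mulr_ge0 ?modulus_ge0//.
  have p1 : 0 < modulus w ^+ 3 by rewrite exprn_gt0// (lt_le_trans cj).
  have p2 : 0 < c ^+ 3 * (N%:R * j%:R ^+ 2).
    rewrite mulr_gt0 ?(exprn_gt0 3 c0)// mulr_gt0 ?ltr0n//.
    by rewrite exprn_gt0// ltr0n (leq_trans N_gt0).
  rewrite -invfM lef_pV2 ?posrE//.
  apply: (@le_trans _ _ ((c * j.+1%:R) ^+ 3)).
    rewrite [leRHS]exprMn ler_wpM2l ?exprn_ge0 ?(ltW c0)// -natrX -natrM -natrX ler_nat.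
    rewrite (expnS _ 2) leq_mul//; first by rewrite leqW.
    by rewrite leq_exp2r.
  by rewrite lerXn2r ?nnegrE ?modulus_ge0 ?(ltW cj).
have -> : row_difference tau z M n - row_difference tau z N n =
    \sum_(N <= j < M) (g j.+1%:Z + g (- j.+1%:Z)).
  rewrite /row_difference -/g; elim: M NM => [|M IHM].
    by rewrite leqn0 => /eqP->; rewrite subrr big_geq.
  rewrite leq_eqVlt => /predU1P[->|]; first by rewrite subrr big_geq.
  by rewrite ltnS => NM; rewrite symsumS addrAC IHM// big_nat_recr.
rewrite (le_trans (modulus_sum _ _ _))//.
apply: (@le_trans _ _ (\sum_(N <= j < M) (2 * D / N%:R) * (j%:R ^+ 2)^-1)).
  apply: ler_sum_nat => j /andP[Nj _]; rewrite (le_trans (modulusD _ _))//.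
  rewrite (le_trans (lerD (gm _ j Nj _) (gm _ j Nj _)))//.
  - by rewrite -pmulrn normr_nat.
  - by rewrite mulrNz normrN -pmulrn normr_nat.
  rewrite le_eqVlt; apply/orP; left; apply/eqP; field.
  by rewrite !pnatr_eq0 -!lt0n N_gt0 (leq_trans N_gt0).
rewrite -mulr_sumr (le_trans (ler_wpM2l _ (sum_inv_sqr _ _ N_gt0)))//.
  by rewrite divr_ge0// mulr_ge0.
rewrite le_eqVlt; apply/orP; left; apply/eqP; field.
by rewrite pnatr_eq0 -lt0n.
Qed.

End Lattice.
Section Propagator.
Variable R : realType.
Local Open Scope classical_set_scope.
Local Open Scope ring_scope.
Local Open Scope complex_scope.
Implicit Types (z w tau : R[i]).

Let c : R[i] := ((2 * pi) ^+ 2)%:C.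

Lemma Im_sub_intM z tau (n : int) :
  complex.Im (z - n%:~R * tau) = complex.Im z - n%:~R * complex.Im tau.
Proof.
rewrite -(rmorph_int (real_complex R)); case: z tau => a b [a' b'] /=.
by rewrite mul0r addr0.
Qed.

Lemma echar_lattice z tau (n : int) :
  (forall n : int, complex.Im z != n%:~R * complex.Im tau) ->
  echar (z - n%:~R * tau) != 1.
Proof.
by move=> zt; apply: echar_neq1; rewrite Im_sub_intM subr_eq0.
Qed.

(** The term [z ^ -2] belongs to the lattice point [0], as [0 ^ -2 = 0]. *)
Lemma weierstrass_square_sum z tau N :
  z ^- 2 + \sum_(ij | @square_pt N ij != (0, 0))
    ((z - lattice_pt tau (square_pt ij)) ^- 2 - lattice_pt tau (square_pt ij) ^- 2)
  = symsum N (row_difference tau z N).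
Proof.
pose t (ij : 'I_(2 * N).+1 * 'I_(2 * N).+1) :=
  (z - lattice_pt tau (square_pt ij)) ^- 2 - lattice_pt tau (square_pt ij) ^- 2.
have N2 : (N < (2 * N).+1)%N by lia.
have sq0 ij : (@square_pt N ij != (0, 0)) = (ij != (Ordinal N2, Ordinal N2)).
  congr (~~ _); case: ij => i j; rewrite /square_pt -!pair_eqE/= /pair_eq/=.
  by rewrite !subr_eq0.
transitivity (\sum_ij t ij).
  rewrite [RHS](bigD1 (Ordinal N2, Ordinal N2))//=.
  congr (_ + _); last by apply: eq_bigl => ij; exact: sq0.
  rewrite /t /square_pt/= subrr /lattice_pt/= mul0r addr0 subr0.
  by rewrite expr0n invr0 subr0.
rewrite -(pair_bigA _ (fun i j => t (i, j)))/= exchange_big/=.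
apply: eq_bigr => j _; rewrite /row_difference /symsum; apply: eq_bigr => i _.
rewrite /t /square_pt /lattice_pt/=; set x := _%:~R; set y := _%:~R.
congr (_ - _); first by congr (_ ^- 2); rewrite opprD addrA addrAC.
by rewrite -sqrrN; congr (_ ^- 2); rewrite sub0r opprD addrC.
Qed.

(** The lattice is summed by rows, and each row is replaced by its limit, which
is a value of the kernel except for the row of the inverse squares of the
integers. *)
Lemma tends_weierstrass z tau P G : upper_half tau ->
  (forall n : int, complex.Im z != n%:~R * complex.Im tau) ->
  tends (fun N => symsum N (fun n => kernel (echar (z - n%:~R * tau)))) P ->
  tends (fun N => \sum_(n < N) kernel (echar (n.+1%:R * tau))) G ->
  weierstrass_p z tau = - c * P - (pi ^+ 2 / 3)%:C + 2 * c * G.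
Proof.
move=> t0 zt hP hG.
pose row0 (n : int) : R[i] := if n == 0 then (pi ^+ 2 / 3)%:C
  else - c * kernel (echar (0 - n%:~R * tau)).
pose d n := - c * kernel (echar (z - n%:~R * tau)) - row0 n.
have dP n : tends (row_difference tau z ^~ n) (d n).
  have h1 := tends_symsum_row (echar_lattice n zt).
  have h2 : tends (fun N => symsum N (fun m => (0 - n%:~R * tau - m%:~R) ^- 2)) (row0 n).
    rewrite /row0; have [->|n0] := eqVneq n 0.
      by apply: tends_eq (@tends_symsum_row0 R) => N; rewrite mul0r subr0.
    apply: tends_symsum_row; apply: echar_neq1.
    by rewrite Im_sub_intM sub0r oppr_eq0 mulf_neq0 ?intr_eq0// gt_eqF.
  by apply: tends_eq (tendsB h1 h2) => N; rewrite -symsumB.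
have [C C0 [N0 tailC]] := row_difference_tail z t0.
have dC n N : (N0 <= N)%N -> modulus (d n - row_difference tau z N n) <= C / N%:R ^+ 2.
  move=> N0N; apply: (@tends_modulus_le _ _ _ _ N) (tendsB (dP n) (tends_cst _)).
  by move=> M NM; apply: tailC; rewrite N0N.
have sum_row0 N : symsum N row0 =
    (pi ^+ 2 / 3)%:C - 2 * c * \sum_(n < N) kernel (echar (n.+1%:R * tau)).
  elim: N => [|N IHN]; first by rewrite symsum0 /row0 eqxx big_ord0 mulr0 subr0.
  have rp : row0 N.+1%:Z = - c * kernel (echar (N.+1%:R * tau)).
    by rewrite /row0/= sub0r echarN kernelV.
  have rn : row0 (- N.+1%:Z) = - c * kernel (echar (N.+1%:R * tau)).
    rewrite /row0 oppr_eq0/= (_ : 0 - _ = N.+1%:R * tau)//.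
    by rewrite mulrNz -pmulrn; ring.
  rewrite symsumS IHN big_ord_recr/= rp rn.
  by ring.
have sum_d N : symsum N d = - c * symsum N (fun n => kernel (echar (z - n%:~R * tau)))
    - (pi ^+ 2 / 3)%:C + 2 * c * \sum_(n < N) kernel (echar (n.+1%:R * tau)).
  by rewrite /d symsumB symsumZ sum_row0 opprB addrA addrAC.
suff /tends_clim h : tends (fun N => \sum_(ij | @square_pt N ij != (0, 0))
    ((z - lattice_pt tau (square_pt ij)) ^- 2 - lattice_pt tau (square_pt ij) ^- 2))
    (- c * P - (pi ^+ 2 / 3)%:C + 2 * c * G - z ^- 2).
  by rewrite /weierstrass_p h addrC subrK.
have hd := tendsB (tendsD (tendsB (tendsZ (- c) hP) (tends_cst (pi ^+ 2 / 3)%:C))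
  (tendsZ (2 * c) hG)) (tends_cst (z ^- 2)).
apply: tends_near hd.
apply: (@vanishing_le _ _ (fun N => (3 * C) * N%:R^-1) (maxn N0 1)) => [N|]; last first.
  by apply: vanishingZ (@vanishing_inv R); rewrite mulr_ge0.
rewrite geq_max => /andP[N0N N1].
have E (S : R[i]) : z ^- 2 + S = symsum N (row_difference tau z N) ->
    - c * symsum N (fun n => kernel (echar (z - n%:~R * tau))) - (pi ^+ 2 / 3)%:C
      + 2 * c * \sum_(n < N) kernel (echar (n.+1%:R * tau)) - z ^- 2 - S
    = symsum N (fun n => d n - row_difference tau z N n).
  by move=> zS; rewrite symsumB sum_d -zS opprD addrA.
rewrite (E _ (weierstrass_square_sum z tau N)).
rewrite (le_trans (modulus_symsum _ (fun n => dC n N N0N)))//.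
have NR : 0 < N%:R :> R by rewrite ltr0n.
rewrite (_ : (3 * C) * N%:R^-1 = (3 * N)%:R * (C / N%:R ^+ 2)); last first.
  by rewrite natrM; field; rewrite gt_eqF.
rewrite ler_wpM2r ?divr_ge0 ?sqr_ge0// ler_nat; lia.
Qed.

End Propagator.
Section Eisenstein.
Variable R : realType.
Local Open Scope ring_scope.
Local Open Scope complex_scope.
Implicit Types (z w tau q : R[i]).

Lemma divisor_sumE N d : (0 < d <= N)%N ->
  divisor_sum d = (\sum_(n < N) \sum_(k < N.+1) if (n.+1 * k == d)%N then k : nat else 0)%N.
Proof.
move=> /andP[d0 dN].
have -> : divisor_sum d = (\sum_(k < N.+1 | k %| d) k)%N.
  rewrite /divisor_sum -(big_mkord (fun k => dvdn k d) id) -[RHS]big_filter.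
  apply: perm_big; apply: uniq_perm.
  - exact: divisors_uniq.
  - by rewrite filter_uniq// iota_uniq.
  move=> k; rewrite -dvdn_divisors// mem_filter mem_index_iota ltnS.
  by case: (boolP (dvdn k d)) => //= /(dvdn_leq d0) kd; rewrite (leq_trans kd).
rewrite exchange_big big_mkcond; apply: eq_bigr => k _ /=.
rewrite -big_mkcond/= sum_nat_const.
have [/dvdnP[e de]|kd] := boolP (dvdn k d); last first.
  rewrite eq_card0 ?mul0n// => n; rewrite !inE; apply: contraNF kd => /eqP <-.
  exact: dvdn_mull.
have k0 : (0 < k)%N by move: d0; rewrite de muln_gt0 => /andP[].
have e0 : (0 < e)%N by move: d0; rewrite de muln_gt0 => /andP[].
have eN : (e.-1 < N)%N.
  by rewrite prednK// (leq_trans _ dN)// de leq_pmulr.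
rewrite (eq_card (B := pred1 (Ordinal eN))) ?card1 ?mul1n// => n.
rewrite inE -[n \in _]/((n.+1 * k)%N == d) de eqn_pmul2r//; apply/eqP/eqP => [ne|->/=].
  by apply: val_inj; rewrite /= -ne.
by rewrite prednK.
Qed.

(** A Lambert series: the divisors [k] of the numbers [d] are grouped according
to the quotients [n.+1 = d / k]. *)
Lemma sum_divisor_sum q N :
  \sum_(1 <= d < N.+1) (divisor_sum d)%:R * q ^+ d
  = \sum_(n < N) \sum_(k < (N %/ n.+1).+1) k%:R * (q ^+ n.+1) ^+ k.
Proof.
rewrite big_add1 big_mkord.
transitivity (\sum_(d < N) \sum_(n < N) \sum_(k < N.+1)
    if (n.+1 * k == d.+1)%N then k%:R * q ^+ d.+1 else 0).
  apply: eq_bigr => d _; rewrite (@divisor_sumE N) ?ltn_ord//.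
  rewrite natr_sum mulr_suml; apply: eq_bigr => n _.
  rewrite natr_sum mulr_suml; apply: eq_bigr => k _.
  by case: ifP => // _; rewrite mul0r.
rewrite exchange_big; apply: eq_bigr => n _ /=.
rewrite exchange_big/= (big_ord_widen N.+1 (fun k => k%:R * (q ^+ n.+1) ^+ k)); last first.
  by rewrite ltnS leq_div.
rewrite [RHS]big_mkcond; apply: eq_bigr => k _ /=.
rewrite ltnS leq_divRL// -exprM [(k * _)%N]mulnC.
have [->|k0] := posnP k.
  rewrite muln0 leq0n mul0r big1// => d _; by case: ifP => // _; rewrite mul0r.
have [nkN|Nnk] := leqP.
  have nk0 : (0 < n.+1 * k)%N by rewrite muln_gt0.
  have nk : ((n.+1 * k).-1 < N)%N by rewrite prednK.
  rewrite (bigD1 (Ordinal nk))//= prednK// eqxx big1 ?addr0// => d.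
  by case: ifP => // /eqP nkd /eqP[]; apply: val_inj; rewrite /= nkd.
rewrite big1// => d _; case: ifP => // /eqP nkd.
by have := ltn_ord d; rewrite -nkd leqNgt Nnk.
Qed.

(** The Eisenstein series sums the kernel over the powers of [echar tau].  The
first [N] divisor sums truncate the [n]th kernel at [k <= N / n], and the
remainders of these truncations are exponentially small in [N]. *)
Lemma E2_kernel tau : upper_half tau -> exists2 G,
  tends (fun N => \sum_(n < N) kernel (echar (n.+1%:R * tau))) G &
  E2 (echar tau) = 1 - 24 * G.
Proof.
move=> t0; have a0 : 0 < 2 * pi * complex.Im tau by rewrite !mulr_gt0// pi_gt0.
set rho := expR (- (2 * pi * complex.Im tau)).
have r0 : 0 <= rho := expR_ge0 _.
have r1 : rho < 1 := rho_lt1 a0.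
have d0 : 0 < 1 - rho by rewrite subr_gt0.
have mE n : modulus (echar (n.+1%:R * tau)) = rho ^+ n.+1.
  by rewrite echarMn modulusX modulus_echar.
have rn n : rho ^+ n.+1 <= rho by rewrite exprS ler_piMr// exprn_ile1// ltW.
have kE n : modulus (kernel (echar (n.+1%:R * tau))) <= rho ^+ n.+1 / (1 - rho) ^+ 2.
  by apply: kernel_le (rn n) r1; rewrite mE.
have [G hG] : exists G, tends (fun N => \sum_(n < N) kernel (echar (n.+1%:R * tau))) G.
  apply: (cauchy_tends (r := fun N => (1 - rho) ^- 3 * rho ^+ N)).
    by apply: vanishingZ (vanishing_geometric a0); rewrite invr_ge0 exprn_ge0 ?ltW.
  move=> n m nm; rewrite -!(big_mkord xpredT (fun n => kernel (echar (n.+1%:R * tau)))).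
  rewrite (big_cat_nat (n := n) (p := m))//= addrAC subrr add0r.
  rewrite (le_trans (modulus_sum _ _ _))//.
  rewrite (le_trans (ler_sum_nat (fun j _ => kE j)))//.
  rewrite -mulr_suml.
  rewrite (le_trans (ler_wpM2r _ (geometric_tail a0 nm)))//.
    by rewrite invr_ge0 sqr_ge0.
  by rewrite le_eqVlt; apply/orP; left; apply/eqP; rewrite -/rho; field; rewrite gt_eqF.
exists G => //; congr (1 - 24 * _); apply: tends_clim; apply: tends_near hG.
pose b (N : nat) := (1 - rho) ^- 2 * ((2 * N).+1%:R ^+ 2 * rho ^+ N.+1).
apply: (@vanishing_le _ _ b 0) => [N _|]; last first.
  by apply: vanishingZ (vanishing_square_geometric a0); rewrite invr_ge0 sqr_ge0.
rewrite sum_divisor_sum -sumrB (le_trans (modulus_sum _ _ _))//.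
have step (n : 'I_N) : modulus (kernel (echar (n.+1%:R * tau))
    - \sum_(k < (N %/ n.+1).+1) k%:R * (echar tau ^+ n.+1) ^+ k)
    <= (2 * N).+1%:R * rho ^+ N.+1 / (1 - rho) ^+ 2.
  have mn : modulus (echar (n.+1%:R * tau)) <= rho ^+ n.+1 by rewrite mE.
  rewrite -echarMn (le_trans (kernel_partial_sum (N %/ n.+1) mn (rn n) r1))//.
  rewrite ler_wpM2r ?invr_ge0 ?sqr_ge0//.
  rewrite ler_pM ?exprn_ge0//; first by rewrite ler_nat ltnS leq_mul2l leq_div.
  rewrite -exprM ler_wiXn2l ?(ltW r1)//.
  by rewrite mulnC -ltn_divLR.
rewrite (le_trans (ler_sum _ (fun n _ => step n)))//.
rewrite sumr_const card_ord -[leLHS]mulr_natl /b.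
rewrite [leRHS](_ : _ = (2 * N).+1%:R
  * ((2 * N).+1%:R * rho ^+ N.+1 / (1 - rho) ^+ 2)); last by ring.
rewrite ler_wpM2r//; last by rewrite ler_nat; lia.
by rewrite !mulr_ge0 ?invr_ge0 ?sqr_ge0// exprn_ge0.
Qed.

End Eisenstein.

Section PropagatorExpansion.
Variable R : realType.
Local Open Scope ring_scope.
Local Open Scope complex_scope.
Variables (y : R) (tau : R[i]).
Hypothesis y_itv : 0 < `|y| < complex.Im tau.
Implicit Types (z w : R[i]).

(** On the horizontal line of height [y], the kernels in the expansion of the
propagator have arguments of modulus at most [rho ^+ n.+1]. *)
Let a : R := 2 * pi * Num.min `|y| (complex.Im tau - `|y|).
Let rho : R := expR (- a).

Let a_gt0 : 0 < a.
Proof.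
have /andP[y0 yt] := y_itv.
by rewrite !mulr_gt0 ?pi_gt0// lt_min y0 subr_gt0.
Qed.

Let rho0 : 0 <= rho := expR_ge0 _.
Let rho1 : rho < 1 := rho_lt1 a_gt0.
Let d_gt0 : 0 < 1 - rho. Proof. by rewrite subr_gt0. Qed.

Let rhoS n : rho ^+ n.+1 <= rho.
Proof. by rewrite exprS ler_piMr// exprn_ile1// ltW. Qed.

Let tau_gt0 : 0 < complex.Im tau.
Proof. by have /andP[y0] := y_itv; exact: lt_trans. Qed.

Lemma modulus_echar_row z n (s : R) : complex.Im z = y -> `|s| = 1 ->
  modulus (echar (s%:C * z + n.+1%:R * tau)) <= rho ^+ n.+1.
Proof.
move=> zy s1; rewrite modulus_echar /rho -expRM_natr ler_expR mulNr lerN2.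
have -> : complex.Im (s%:C * z + n.+1%:R * tau) = s * y + n.+1%:R * complex.Im tau.
  rewrite -(rmorph_nat (real_complex R)) -zy; case: z tau {zy} => ? ? [? ?] /=.
  by rewrite !mul0r !addr0.
rewrite /a -[leLHS]mulrA ler_wpM2l ?mulr_ge0 ?pi_ge0//.
have sy : - `|y| <= s * y.
  by rewrite lerNl (le_trans (ler_norm _))// normrN normrM s1 mul1r.
have n1 : 1 <= n.+1%:R :> R by rewrite ler1n.
have : n.+1%:R * Num.min `|y| (complex.Im tau - `|y|)
    <= n.+1%:R * (complex.Im tau - `|y|).
  by rewrite ler_wpM2l// ge_min lexx orbT.
have : `|y| <= n.+1%:R * `|y| by rewrite ler_peMl.
by rewrite mulrC; lra.
Qed.

Lemma modulus_echar0 z (s : R) : complex.Im z = y -> s * y = `|y| ->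
  modulus (echar (s%:C * z)) <= rho.
Proof.
move=> zy sy; rewrite modulus_echar /rho ler_expR lerN2.
have -> : complex.Im (s%:C * z) = `|y|.
  by rewrite -sy -zy; case: z {zy} => ? ? /=; rewrite mul0r addr0.
by rewrite /a ler_wpM2l ?mulr_ge0 ?pi_ge0// ge_min lexx.
Qed.

Lemma kernel_row_sum z N :
  symsum N (fun n => kernel (echar (z - n%:~R * tau))) =
  kernel (echar z) + \sum_(n < N) (kernel (echar ((-1)%:C * z + n.+1%:R * tau))
                                   + kernel (echar (1%:C * z + n.+1%:R * tau))).
Proof.
elim: N => [|N IHN].
  by rewrite symsum0 big_ord0 mul0r subr0 addr0.
rewrite symsumS IHN big_ord_recr/= -[LHS]addrA; congr (_ + (_ + (_ + _))).
  rewrite -pmulrn -kernelV -echarN opprB; congr (kernel (echar _)).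
  by rewrite (rmorphN1 (real_complex R)) mulN1r addrC.
by rewrite mulrNz mulNr opprK -pmulrn mul1r.
Qed.

(** The constants of the Weierstrass function and the Eisenstein series cancel:
the propagator is, up to sign, the sum of the kernel over the rows of the
lattice.  The convergence is uniform on horizontal lines. *)
Lemma propagator_kernel z N : complex.Im z = y ->
  modulus (- propagator z tau - symsum N (fun n => kernel (echar (z - n%:~R * tau))))
  <= 2 * (1 - rho) ^- 3 * rho ^+ N.
Proof.
move=> zy; pose u N := symsum N (fun n => kernel (echar (z - n%:~R * tau))).
have cauchy n m : (n <= m)%N -> modulus (u m - u n) <= 2 * (1 - rho) ^- 3 * rho ^+ n.
  move=> nm; rewrite /u !kernel_row_sum opprD addrACA subrr add0r.
  rewrite -!(big_mkord xpredT (fun n => kernel (echar ((-1)%:C * z + n.+1%:R * tau))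
    + kernel (echar (1%:C * z + n.+1%:R * tau)))).
  rewrite (big_cat_nat (n := n) (p := m))//= addrAC subrr add0r.
  rewrite (le_trans (modulus_sum _ _ _))//.
  apply: (@le_trans _ _ (\sum_(n <= j < m) 2 * (1 - rho) ^- 2 * rho ^+ j.+1)).
    apply: ler_sum_nat => j _; rewrite (le_trans (modulusD _ _))//.
    have k s : `|s| = 1 -> modulus (kernel (echar (s%:C * z + j.+1%:R * tau)))
        <= rho ^+ j.+1 / (1 - rho) ^+ 2.
      by move=> s1; apply: kernel_le (rhoS j) rho1; exact: modulus_echar_row.
    rewrite (le_trans (lerD (k _ (normrN1 R)) (k _ (normr1 R))))//.
    by rewrite le_eqVlt; apply/orP; left; apply/eqP; ring.
  rewrite -mulr_sumr (le_trans (ler_wpM2l _ (geometric_tail a_gt0 nm)))//.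
    by rewrite mulr_ge0// invr_ge0 sqr_ge0.
  rewrite le_eqVlt; apply/orP; left; apply/eqP; rewrite -/rho.
  by field; rewrite gt_eqF.
have [P uP] : exists P, tends u P.
  apply: (cauchy_tends (r := fun N => 2 * (1 - rho) ^- 3 * rho ^+ N)) cauchy.
  by apply: vanishingZ (vanishing_geometric a_gt0); rewrite mulr_ge0// invr_ge0 exprn_ge0// ltW.
have /andP[y0 yt] := y_itv.
have zt (n : int) : complex.Im z != n%:~R * complex.Im tau.
  rewrite zy; apply/eqP => yn; move: y0 yt.
  rewrite yn normrM (gtr0_norm tau_gt0) -intr_norm.
  have [->|n0] := eqVneq n 0; first by rewrite normr0 mul0r ltxx.
  rewrite gtr_pMl// (ltr_int R _ 1); move: n0; lia.
have [G hG E2G] := E2_kernel tau_gt0.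
have -> : propagator z tau = - P.
  have W := tends_weierstrass tau_gt0 zt uP hG.
  rewrite /propagator W (_ : cexp _ ^+ 2 = echar tau); last first.
    rewrite expr2 -cexpD /echar; congr cexp.
    by rewrite (rmorphM (real_complex R)) (rmorph_nat (real_complex R)); ring.
  rewrite E2G.
  have pi0 : (pi : R)%:C != 0 by rewrite (fmorph_eq0 (real_complex R)) gt_eqF ?pi_gt0.
  have -> : (pi ^+ 2 / 3 : R)%:C = (pi : R)%:C ^+ 2 / 3.
    by rewrite (rmorphM (real_complex R) (pi ^+ 2)) (rmorphXn (real_complex R))
      fmorphV (rmorph_nat (real_complex R)).
  have -> : ((2 * pi) ^+ 2 : R)%:C = 4 * (pi : R)%:C ^+ 2.
    by rewrite (rmorphXn (real_complex R)) (rmorphM (real_complex R))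
      (rmorph_nat (real_complex R)); ring.
  by move: (pi : R)%:C pi0 => p p0; field.
rewrite opprK; apply: (@tends_modulus_le _ _ _ _ N) (tendsB uP (tends_cst _)) => M.
exact: cauchy.
Qed.

End PropagatorExpansion.
Section FourierSum.
Variable R : realType.
Local Open Scope ring_scope.
Local Open Scope complex_scope.
Implicit Types (y : R) (z w tau : R[i]).

(** The coefficient of [echar (j * z)] in [- P], with the geometric series
[Q ^ |j| / (1 - Q ^ |j|)], for [Q = echar tau], cut off after [N] terms. *)
Definition fourier_coef tau y (N : nat) (j : int) : R[i] :=
  (absz j)%:R * (((0 < j%:~R * y)%R)%:R + \sum_(n < N) echar (n.+1%:R * tau) ^+ absz j).

Definition fourier_sum tau y (N : nat) z : R[i] :=
  symsum N (fun j => fourier_coef tau y N j * echar (j%:~R * z)).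

Lemma fourier_coef0 tau y N : fourier_coef tau y N 0 = 0.
Proof. by rewrite /fourier_coef mul0r. Qed.

Lemma symsum_pairs N (g : int -> R[i]) :
  symsum N g = g 0 + \sum_(k < N) (g k.+1%:Z + g (- k.+1%:Z)).
Proof.
elim: N => [|N IHN]; first by rewrite symsum0 big_ord0 addr0.
by rewrite symsumS IHN big_ord_recr/= -[LHS]addrA.
Qed.

Let T N w : R[i] := \sum_(k < N.+1) k%:R * w ^+ k.

Let TE N w : T N w = \sum_(k < N) k.+1%:R * w ^+ k.+1.
Proof. by rewrite /T big_ord_recl mul0r add0r. Qed.

Lemma fourier_sumE tau y N z : y != 0 ->
  fourier_sum tau y N z = T N (echar ((Num.sg y)%:C * z))
  + \sum_(n < N) (T N (echar ((-1)%:C * z + n.+1%:R * tau))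
                  + T N (echar (1%:C * z + n.+1%:R * tau))).
Proof.
move=> y0; rewrite /fourier_sum symsum_pairs fourier_coef0 mul0r add0r.
rewrite TE; under [X in _ = _ + X]eq_bigr do rewrite !TE -big_split/=.
rewrite exchange_big/= -big_split/=; apply: eq_bigr => k _.
have N1 : (-1 : R)%:C = -1 by exact: rmorphN1.
have eZ (w : R[i]) : echar (k.+1%:R * w) = echar w ^+ k.+1 by exact: echarMn.
have up : fourier_coef tau y N k.+1%:Z * echar (k.+1%:Z%:~R * z) =
   k.+1%:R * (((0 < y)%R)%:R * echar z ^+ k.+1
     + \sum_(n < N) echar (1%:C * z + n.+1%:R * tau) ^+ k.+1).
  rewrite /fourier_coef/= -pmulrn eZ -mulrA mulrDl pmulr_rgt0 ?ltr0n//.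
  congr (_ * (_ + _)); rewrite mulr_suml; apply: eq_bigr => n _.
  by rewrite [_%:C * z]mul1r [in RHS]echarD [RHS]exprMn [RHS]mulrC.
have down : fourier_coef tau y N (- k.+1%:Z) * echar ((- k.+1%:Z)%:~R * z) =
   k.+1%:R * (((y < 0)%R)%:R * echar (- z) ^+ k.+1
     + \sum_(n < N) echar ((-1)%:C * z + n.+1%:R * tau) ^+ k.+1).
  have eN : echar ((- k.+1%:Z)%:~R * z) = echar (- z) ^+ k.+1.
    by rewrite mulrNz mulNr -mulrN; exact: eZ.
  have sN : (0 < (- k.+1%:Z)%:~R * y) = (y < 0).
    by rewrite mulrNz mulNr oppr_gt0 pmulr_rlt0.
  rewrite /fourier_coef abszN eN sN -mulrA mulrDl.
  congr (_ * (_ + _)); rewrite mulr_suml; apply: eq_bigr => n _.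
  by rewrite N1 mulN1r [in RHS]echarD [RHS]exprMn [RHS]mulrC.
rewrite up down -mulrDr big_split/= -!mulr_sumr -[in RHS]mulrDr -[RHS]mulrDr.
apply: (congr1 (fun x => k.+1%:R * x)).
rewrite addrACA [X in _ + X]addrC; congr (_ + _).
have [y_lt0|y_gt0|//] := ltgtP y 0.
- by rewrite ltr0_sg// N1 mulN1r mul0r add0r mul1r.
- by rewrite gtr0_sg// mul1r mul1r mul0r addr0.
- by move=> h; rewrite h eqxx in y0.
Qed.

(** Both truncations, of the sum over the rows and of the power series of the
kernels, are uniform on horizontal lines. *)
Lemma propagator_fourier y tau : 0 < `|y| < complex.Im tau ->
  exists2 r, vanishing r & forall z N, complex.Im z = y ->
    modulus (fourier_sum tau y N z + propagator z tau) <= r N.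
Proof.
move=> y_itv; have /andP[y0 _] := y_itv; rewrite normr_gt0 in y0.
set a := 2 * pi * Num.min `|y| (complex.Im tau - `|y|).
have a0 : 0 < a.
  have /andP[y0' yt] := y_itv.
  by rewrite !mulr_gt0 ?pi_gt0// lt_min y0' subr_gt0.
pose rho := expR (- a); have r0 : 0 <= rho := expR_ge0 _.
have r1 : rho < 1 := rho_lt1 a0; have d0 : 0 < 1 - rho by rewrite subr_gt0.
exists (fun N => 2 * (1 - rho) ^- 3 * rho ^+ N
         + (1 - rho) ^- 2 * ((2 * N).+1%:R ^+ 2 * rho ^+ N.+1)) => [|z N zy].
  apply: vanishingD; apply: vanishingZ.
  - by rewrite mulr_ge0// invr_ge0 exprn_ge0// ltW.
  - exact: vanishing_geometric.
  - by rewrite invr_ge0 sqr_ge0.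
  - exact: vanishing_square_geometric.
have kT w : modulus w <= rho ->
    modulus (kernel w - T N w) <= (2 * N).+1%:R * rho ^+ N.+1 / (1 - rho) ^+ 2.
  by move=> wr; exact: kernel_partial_sum wr (lexx _) r1.
have sy : `|y| = Num.sg y * y by rewrite normrEsg.
set K := symsum N (fun n => kernel (echar (z - n%:~R * tau))).
have -> : fourier_sum tau y N z + propagator z tau =
    - (- propagator z tau - K) - (K - fourier_sum tau y N z) by ring.
rewrite (le_trans (modulusB _ _))// modulusN lerD//.
  exact: (propagator_kernel y_itv N zy).
have -> : K = kernel (echar ((Num.sg y)%:C * z))
   + \sum_(n < N) (kernel (echar ((-1)%:C * z + n.+1%:R * tau))
                   + kernel (echar (1%:C * z + n.+1%:R * tau))).
  rewrite /K kernel_row_sum; congr (_ + _); have [y1|y1|y1] := ltgtP y 0.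
  - by rewrite ltr0_sg// (rmorphN1 (real_complex R)) mulN1r echarN kernelV.
  - by rewrite gtr0_sg// mul1r.
  - by rewrite y1 eqxx in y0.
rewrite fourier_sumE// opprD addrACA -sumrB.
set b := (2 * N).+1%:R * rho ^+ N.+1 / (1 - rho) ^+ 2.
have -> : (1 - rho) ^- 2 * ((2 * N).+1%:R ^+ 2 * rho ^+ N.+1) = b + (b + b) *+ N.
  rewrite -mulr_natl /b (_ : (2 * N).+1%:R = 1 + 2 * N%:R :> R); first by ring.
  by rewrite -natr1 natrM addrC.
rewrite (le_trans (modulusD _ _))// lerD//.
  by apply: kT; exact: modulus_echar0 zy (esym sy).
rewrite (le_trans (modulus_sum _ _ _))//.
rewrite -[in leRHS](card_ord N) -sumr_const ler_sum// => n _.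
rewrite opprD addrACA (le_trans (modulusD _ _))// lerD// kT//.
  rewrite (le_trans (modulus_echar_row tau n zy (normrN1 R)))//.
  by rewrite exprS ler_piMr// exprn_ile1// ltW.
rewrite (le_trans (modulus_echar_row tau n zy (normr1 R)))//.
by rewrite exprS ler_piMr// exprn_ile1// ltW.
Qed.

End FourierSum.
(** * Integration of trigonometric polynomials and their uniform limits *)

Section Integral01.
Variable R : realType.
Local Open Scope classical_set_scope.
Local Open Scope ring_scope.
Local Open Scope complex_scope.
Implicit Types (f g : R -> R[i]).

Definition rcontinuous f : Prop :=
  continuous (fun x => complex.Re (f x)) /\ continuous (fun x => complex.Im (f x)).

Lemma continuous_integrable01 (h : R -> R) : continuous h ->
  (@lebesgue_measure R).-integrable `[0, 1] (EFin \o h).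
Proof.
move=> ch; apply: continuous_compact_integrable; first exact: segment_compact.
exact: continuous_subspaceT.
Qed.

Lemma rcontinuousD f g : rcontinuous f -> rcontinuous g ->
  rcontinuous (fun x => f x + g x).
Proof.
move=> [cf cf'] [cg cg']; split.
  rewrite (_ : (fun _ => _) = fun x => complex.Re (f x) + complex.Re (g x)).
    by move=> x; apply: continuousD; [exact: cf|exact: cg].
  by apply/funext => x; case: (f x); case: (g x).
rewrite (_ : (fun _ => _) = fun x => complex.Im (f x) + complex.Im (g x)).
  by move=> x; apply: continuousD; [exact: cf'|exact: cg'].
by apply/funext => x; case: (f x); case: (g x).
Qed.

Lemma ReM (c w : R[i]) : complex.Re (c * w) =
  complex.Re c * complex.Re w - complex.Im c * complex.Im w.
Proof. by case: c; case: w. Qed.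

Lemma ImM (c w : R[i]) : complex.Im (c * w) =
  complex.Re c * complex.Im w + complex.Im c * complex.Re w.
Proof. by case: c; case: w. Qed.

Let contZ (r : R) (h : R -> R) : continuous h -> continuous (fun x => r * h x).
Proof. by move=> ch x; apply: continuousM; [exact: cst_continuous|exact: ch]. Qed.

Let contD (h k : R -> R) : continuous h -> continuous k ->
  continuous (fun x => h x + k x).
Proof. by move=> ch ck x; apply: continuousD; [exact: ch|exact: ck]. Qed.

Let contB (h k : R -> R) : continuous h -> continuous k ->
  continuous (fun x => h x - k x).
Proof. by move=> ch ck x; apply: continuousB; [exact: ch|exact: ck]. Qed.

Lemma rcontinuousZ (c : R[i]) f : rcontinuous f -> rcontinuous (fun x => c * f x).
Proof.
move=> [cf cf']; split.
  rewrite (_ : (fun _ => _) = fun x =>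
      complex.Re c * complex.Re (f x) - complex.Im c * complex.Im (f x)).
    by apply: contB; exact: contZ.
  by apply/funext => x; rewrite ReM.
rewrite (_ : (fun _ => _) = fun x =>
    complex.Re c * complex.Im (f x) + complex.Im c * complex.Re (f x)).
  by apply: contD; exact: contZ.
by apply/funext => x; rewrite ImM.
Qed.

Lemma rcontinuous_sum (I : finType) (F : I -> R -> R[i]) :
  (forall i, rcontinuous (F i)) -> rcontinuous (fun x => \sum_i F i x).
Proof.
move=> cF; elim: (index_enum I) => [|i s IHs].
  rewrite (funext (fun x => big_nil _ _ _ (F^~ x))).
  by split=> x; exact: cst_continuous.
rewrite (funext (fun x => big_cons _ _ _ _ _ (F^~ x))).
exact: rcontinuousD.
Qed.

Lemma integral01D f g : rcontinuous f -> rcontinuous g ->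
  integral01 (fun x => f x + g x) = integral01 f + integral01 g.
Proof.
move=> [cf cf'] [cg cg']; rewrite /integral01; apply/eqP; rewrite eq_complex/=.
apply/andP; split; apply/eqP; rewrite -RintegralD//; try exact: continuous_integrable01.
  by apply: eq_Rintegral => x _; case: (f x); case: (g x).
by apply: eq_Rintegral => x _; case: (f x); case: (g x).
Qed.

Lemma integral01Z (c : R[i]) f : rcontinuous f ->
  integral01 (fun x => c * f x) = c * integral01 f.
Proof.
move=> [cf cf']; have icf := continuous_integrable01 cf.
have icf' := continuous_integrable01 cf'.
rewrite /integral01; apply/eqP; rewrite eq_complex ReM ImM/=.
apply/andP; split; apply/eqP; rewrite -!RintegralZl//.
  rewrite -RintegralB//; try by apply/continuous_integrable01/contZ.
  by apply: eq_Rintegral => x _; rewrite ReM.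
rewrite -RintegralD//; try by apply/continuous_integrable01/contZ.
by apply: eq_Rintegral => x _; rewrite ImM.
Qed.

Lemma integral01_sum (I : finType) (F : I -> R -> R[i]) :
  (forall i, rcontinuous (F i)) ->
  integral01 (fun x => \sum_i F i x) = \sum_i integral01 (F i).
Proof.
move=> cF; have [] : rcontinuous (fun x => \sum_(i <- index_enum I) F i x) /\
   integral01 (fun x => \sum_(i <- index_enum I) F i x) =
   \sum_(i <- index_enum I) integral01 (F i); last by [].
elim: (index_enum I) => [|i s [cs IHs]].
  have E : (fun x : R => \sum_(i <- [::]) F i x) = fun=> 0.
    by apply/funext => x; rewrite big_nil.
  rewrite E; split; first by split=> x; exact: cst_continuous.
  by rewrite big_nil /integral01/= Rintegral_cst// mul0r.
have E : (fun x : R => \sum_(j <- i :: s) F j x) =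
    fun x => F i x + \sum_(j <- s) F j x.
  by apply/funext => x; rewrite big_cons.
rewrite E; split; first exact: rcontinuousD.
by rewrite integral01D// IHs big_cons.
Qed.

(** The real and the imaginary part are bounded separately, whence the factor
[2]. *)
Lemma integral01_le f (e : R) : rcontinuous f -> (forall x, modulus (f x) <= e) ->
  modulus (integral01 f) <= 2 * e.
Proof.
move=> [cf cf'] fe; rewrite (le_trans (modulus_le _))//= mulr_natl mulr2n.
have le_e (h : R -> R) : continuous h -> (forall x, `|h x| <= e) ->
    `|\int[lebesgue_measure]_(t in `[0, 1]) h t| <= e.
  move=> ch he; have ich := continuous_integrable01 ch.
  rewrite (le_trans (le_normr_Rintegral _ _))//.
  have -> : e = \int[@lebesgue_measure R]_(t in `[0, 1]) e.
    by rewrite Rintegral_cst//= lebesgue_measure_itv/= lte_fin ltr01 oppr0 adde0 mulr1.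
  apply: le_Rintegral => //.
  - by apply: continuous_integrable01 => x; apply: continuous_comp;
      [exact: ch|exact: norm_continuous].
  - by apply: continuous_integrable01 => x; exact: cst_continuous.
rewrite lerD//; apply: le_e => // x; rewrite (le_trans _ (fe x))//.
  exact: modulus_Re.
exact: modulus_Im.
Qed.

Lemma uniform_limit_rcontinuous f : (forall e, 0 < e ->
    exists2 g, rcontinuous g & forall x, modulus (g x - f x) <= e) ->
  rcontinuous f.
Proof.
move=> fg; suff cp (p : R[i] -> R) : (forall v w, `|p v - p w| <= modulus (v - w)) ->
    (forall g, rcontinuous g -> continuous (fun x => p (g x))) ->
    continuous (fun x => p (f x)).
  split.
    apply: cp => [v w|g []//].
    by rewrite (le_trans _ (modulus_Re _))//; case: v; case: w.
  apply: cp => [v w|g []//].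
  by rewrite (le_trans _ (modulus_Im _))//; case: v; case: w.
move=> pM pc x; apply/cvgrPdist_le => e e0; have e3 : 0 < e / 3 by rewrite divr_gt0.
have [g cg ge] := fg _ e3.
have /cvgrPdist_le/(_ _ e3) := pc g cg x; apply: filterS => t gxt.
have h w : `|p (g w) - p (f w)| <= e / 3 := le_trans (pM _ _) (ge w).
have -> : p (f x) - p (f t) = (p (g x) - p (g t)) - (p (g x) - p (f x))
    + (p (g t) - p (f t)) by ring.
have h1 := h x; have h2 := h t.
rewrite (le_trans (ler_normD _ _))//.
have := ler_normB (p (g x) - p (g t)) (p (g x) - p (f x)).
by move: h1 h2 gxt; lra.
Qed.

Lemma echar_realE (x : R) :
  echar x%:C = cos (2 * pi * x) +i* sin (2 * pi * x).
Proof. by rewrite (echarE x 0) mulr0 oppr0 expR0 mul1r. Qed.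

Lemma rcontinuous_echar (k : R) : rcontinuous (fun x => echar (k * x)%:C).
Proof.
have ck : continuous (fun x : R => 2 * pi * (k * x)).
  by apply: (contZ (h := fun x => k * x)); exact: mulrl_continuous.
rewrite (funext (fun x => echar_realE (k * x))); split=> x /=.
  by apply: continuous_comp; [exact: ck|exact: continuous_cos].
by apply: continuous_comp; [exact: ck|exact: continuous_sin].
Qed.

Lemma integral01_deriv (F f : R -> R) : (forall x, is_derive x (1 : R) F (f x)) ->
  continuous f -> \int[lebesgue_measure]_(t in `[0, 1]) f t = F 1 - F 0.
Proof.
move=> dF cf; have cF : continuous F.
  by move=> x; apply: differentiable_continuous; apply/derivable1_diffP;
    exact: (@ex_derive _ _ _ _ _ _ _ (dF x)).
rewrite /Rintegral (@continuous_FTC2 _ _ F)//.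
- exact: continuous_subspaceT.
- split.
  + by move=> x _; exact: (@ex_derive _ _ _ _ _ _ _ (dF x)).
  + by apply: cvg_at_right_filter; exact: cF.
  + by apply: cvg_at_left_filter; exact: cF.
- by move=> x _; rewrite derive1E; exact: (@derive_val _ _ _ _ _ _ _ (dF x)).
Qed.

(** Orthogonality of the characters. *)
Lemma integral01_echar (k : int) :
  integral01 (fun x => echar (k%:~R * x)%:C) = (k == 0)%:R :> R[i].
Proof.
have [ck ck'] := rcontinuous_echar k%:~R.
have [->|k0] := eqVneq k 0.
  under eq_fun do rewrite mul0r echar0.
  by rewrite /integral01/= !Rintegral_cst//= lebesgue_measure_itv/= lte_fin ltr01
    oppr0 adde0 mulr1 mul0r.
pose K : R := 2 * pi * k%:~R.
have K0 : K != 0.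
  by rewrite !mulf_neq0 ?pnatr_eq0 ?intr_eq0// gt_eqF ?pi_gt0.
have KE (x : R) : 2 * pi * (k%:~R * x) = K * x by rewrite mulrA.
have eK : cos K +i* sin K = 1.
  rewrite -(_ : 2 * pi * k%:~R = K)// -echar_realE (rmorph_int (real_complex R)).
  exact: echar_int.
have [cK sK] : cos K = 1 /\ sin K = 0.
  by have /eqP := eK; rewrite eq_complex/= => /andP[/eqP-> /eqP->].
have dS (x : R) : is_derive x (1 : R) (fun x => K^-1 * sin (K * x))
    (complex.Re (echar (k%:~R * x)%:C)).
  rewrite echar_realE/= KE; apply: is_derive_eq.
  by rewrite /GRing.scale/= mulr1; field.
have dC (x : R) : is_derive x (1 : R) (fun x => - K^-1 * cos (K * x))
    (complex.Im (echar (k%:~R * x)%:C)).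
  rewrite echar_realE/= KE; apply: is_derive_eq.
  by rewrite /GRing.scale/= mulr1; field.
rewrite /integral01 (integral01_deriv dS ck) (integral01_deriv dC ck').
by rewrite !mulr1 !mulr0 sin0 cos0 sK cK mulr0 !subrr.
Qed.

End Integral01.
Section TrigonometricPolynomials.
Variables (R : realType) (n : nat).
Local Open Scope ring_scope.
Local Open Scope complex_scope.
Implicit Types (t : 'I_n -> R) (f g : ('I_n -> R) -> R[i]) (v : 'I_n).

Definition trigpoly (I : finType) (alpha : I -> 'I_n -> int) (c : I -> R[i]) t :=
  \sum_i c i * echar (\sum_v (alpha i v)%:~R * t v)%:C.

(** Uniform limits of trigonometric polynomials: a class of functions that are
integrable in each variable and that is stable under these integrations. *)
Definition almost_periodic f : Prop := forall e : R, 0 < e ->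
  exists (I : finType) (alpha : I -> 'I_n -> int) (c : I -> R[i]),
    forall t, modulus (f t - trigpoly alpha c t) <= e.

Definition integral_at v f t : R[i] := integral01 (fun x => f [eta t with v |-> x]).

Lemma trigpoly_at (I : finType) (alpha : I -> 'I_n -> int) (c : I -> R[i]) v t :
  (fun x => trigpoly alpha c [eta t with v |-> x]) =
  fun x => \sum_i (c i * echar (\sum_(w | w != v) (alpha i w)%:~R * t w)%:C)
    * echar ((alpha i v)%:~R * x)%:C.
Proof.
apply/funext => x; apply: eq_bigr => i _; rewrite -mulrA -echarD; congr (_ * echar _).
rewrite -rmorphD/=; congr (_%:C); rewrite (bigD1 v)//= eqxx addrC; congr (_ + _).
by apply: eq_bigr => w /negPf ->.
Qed.

Lemma rcontinuous_trigpoly_at (I : finType) (alpha : I -> 'I_n -> int) (c : I -> R[i]) v t :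
  rcontinuous (fun x => trigpoly alpha c [eta t with v |-> x]).
Proof.
rewrite trigpoly_at; apply: rcontinuous_sum => i.
exact/rcontinuousZ/rcontinuous_echar.
Qed.

Lemma integral_trigpoly (I : finType) (alpha : I -> 'I_n -> int) (c : I -> R[i]) v t :
  integral_at v (trigpoly alpha c) t =
  trigpoly alpha (fun i => (alpha i v == 0)%:R * c i) t.
Proof.
rewrite /integral_at trigpoly_at integral01_sum => [|i]; last first.
  exact/rcontinuousZ/rcontinuous_echar.
apply: eq_bigr => i _; rewrite integral01Z; last exact: rcontinuous_echar.
rewrite integral01_echar [RHS]mulrAC -mulrA [RHS]mulrC mulrA.
have [av|_] := eqVneq (alpha i v) 0; last by rewrite mulr0n mul0r !mulr0.
by rewrite mulr1n mulr1 mul1r [in RHS](bigD1 v)//= av mul0r add0r.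
Qed.

Lemma almost_periodic_rcontinuous f v t : almost_periodic f ->
  rcontinuous (fun x => f [eta t with v |-> x]).
Proof.
move=> apf; apply: uniform_limit_rcontinuous => e /apf[I [alpha [c fc]]].
exists (fun x => trigpoly alpha c [eta t with v |-> x]).
  exact: rcontinuous_trigpoly_at.
by move=> x; rewrite modulusBC.
Qed.

Lemma integral_at_approx (I : finType) (alpha : I -> 'I_n -> int) (c : I -> R[i])
    f v (e : R) : almost_periodic f ->
  (forall t, modulus (f t - trigpoly alpha c t) <= e) ->
  forall t, modulus (integral_at v f t
    - trigpoly alpha (fun i => (alpha i v == 0)%:R * c i) t) <= 2 * e.
Proof.
move=> apf fc t; rewrite -integral_trigpoly /integral_at.
have cf := almost_periodic_rcontinuous v t apf.
have cp := rcontinuousZ (-1) (rcontinuous_trigpoly_at alpha c v t).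
have := integral01_le (e := e) (rcontinuousD cf cp).
rewrite integral01D// integral01Z; last exact: rcontinuous_trigpoly_at.
by rewrite mulN1r; apply => x; rewrite mulN1r.
Qed.

Lemma almost_periodic_integral f v : almost_periodic f ->
  almost_periodic (integral_at v f).
Proof.
move=> apf e e0; have [|I [alpha [c fc]]] := apf (e / 2); first by rewrite divr_gt0.
exists I, alpha, (fun i => (alpha i v == 0)%:R * c i) => t.
by rewrite (le_trans (integral_at_approx v apf fc t))// mulrC divfK.
Qed.

(** Each integration removes the terms that oscillate in its variable, and
doubles the error of the approximation; only the constant terms survive all of
them. *)
Lemma cube_integral_approx (I : finType) (alpha : I -> 'I_n -> int) (c : I -> R[i])
    f (e : R) : almost_periodic f ->
  (forall t, modulus (f t - trigpoly alpha c t) <= e) ->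
  modulus (cube_integral f - \sum_(i | [forall v, alpha i v == 0]) c i)
    <= 2 ^+ n * e.
Proof.
move=> apf fc.
have H (l : seq 'I_n) : almost_periodic (foldr integral_at f l) /\ forall t,
    modulus (foldr integral_at f l t
      - trigpoly alpha (fun i => (all (fun v => alpha i v == 0) l)%:R * c i) t)
    <= 2 ^+ size l * e.
  elim: l => [|v l [apl IHl]].
    split=> // t /=; rewrite mul1r (_ : (fun i => _) = c)//.
    by apply/funext => i; rewrite mul1r.
  split; first exact: almost_periodic_integral.
  move=> t; rewrite exprS -mulrA; have := integral_at_approx v apl IHl t.
  rewrite (_ : (fun i => _ * (_ * c i)) =
    fun i => (all (fun v => alpha i v == 0) (v :: l))%:R * c i)//.
  by apply/funext => i /=; rewrite mulrA -natrM mulnb.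
have [_ /(_ (fun=> 0))] := H (enum 'I_n); rewrite size_enum_ord.
rewrite [trigpoly _ _ _](_ : _ = \sum_(i | [forall v, alpha i v == 0]) c i)//.
rewrite [RHS]big_mkcond; apply: eq_bigr => i _.
rewrite big1 => [|v _]; last by rewrite mulr0.
rewrite echar0 mulr1 (_ : all _ _ = [forall v, alpha i v == 0]); last first.
  by apply/allP/forallP => [h v|h v _]; rewrite h ?mem_enum.
by case: ifP; rewrite ?mul1r ?mul0r.
Qed.

End TrigonometricPolynomials.

Section UniformLimits.
Variables (R : realType) (T : Type) (t0 : T).
Local Open Scope ring_scope.
Local Open Scope complex_scope.
Implicit Types (f g : T -> R[i]) (u w : nat -> T -> R[i]).

Definition uniform_limit u f : Prop :=
  exists2 r, vanishing r & exists N0, forall N t, (N0 <= N)%N ->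
    modulus (u N t - f t) <= r N.

Definition bounded_by f (B : R) : Prop := forall t, modulus (f t) <= B.

Lemma uniform_limitM u w f g (B D : R) : bounded_by f B -> bounded_by g D ->
  uniform_limit u f -> uniform_limit w g ->
  uniform_limit (fun N t => u N t * w N t) (fun t => f t * g t).
Proof.
move=> fB gD [r r0 [N ur]] [s s0 [M ws]].
have B0 : 0 <= B := le_trans (modulus_ge0 _) (fB t0).
have D0 : 0 <= D := le_trans (modulus_ge0 _) (gD t0).
have [K sK] := s0 1 ltr01.
exists (fun n => (D + 1) * r n + B * s n).
  by apply: vanishingD; apply: vanishingZ; rewrite ?addr_ge0.
exists (maxn N (maxn M K)) => n t; rewrite !geq_max => /and3P[Nn Mn Kn].
have -> : u n t * w n t - f t * g t = (u n t - f t) * w n t + f t * (w n t - g t).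
  by ring.
rewrite (le_trans (modulusD _ _))// !modulusM lerD//; last first.
  by rewrite ler_pM ?modulus_ge0 ?ws.
rewrite mulrC ler_pM ?modulus_ge0 ?ur// -(subrK (g t) (w n t)).
rewrite (le_trans (modulusD _ _))// [leRHS]addrC; apply: lerD (gD t).
exact: le_trans (ws n t Mn) (sK n Kn).
Qed.

Lemma uniform_limit_prod (I : Type) (s : seq I) (u : I -> nat -> T -> R[i])
    (f : I -> T -> R[i]) (B : I -> R) :
  (forall i, bounded_by (f i) (B i)) -> (forall i, uniform_limit (u i) (f i)) ->
  bounded_by (fun t => \prod_(i <- s) f i t) (\prod_(i <- s) B i) /\
  uniform_limit (fun N t => \prod_(i <- s) u i N t) (fun t => \prod_(i <- s) f i t).
Proof.
move=> fB uf; elim: s => [|i s [IHB IHu]].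
  split=> [t|]; first by rewrite !big_nil modulus1.
  exists (fun=> 0); first exact: vanishing0.
  by exists 0%N => N t _; rewrite !big_nil subrr modulus0.
split=> [t|].
  by rewrite !big_cons modulusM ler_pM ?modulus_ge0 ?fB.
have [r r0 [N0 h]] := uniform_limitM (fB i) IHB (uf i) IHu.
by exists r => //; exists N0 => N t /h; rewrite !big_cons.
Qed.

Lemma uniform_limit_bounded u f (B : nat -> R) :
  (forall N, bounded_by (u N) (B N)) -> uniform_limit u f -> exists D, bounded_by f D.
Proof.
move=> uB [r r0 [N ur]]; have [M rM] := r0 1 ltr01.
exists (B (maxn N M) + 1) => t; rewrite -(subKr (u (maxn N M) t) (f t)).
rewrite (le_trans (modulusB _ _))// lerD ?uB//.
by rewrite (le_trans (ur _ t _)) ?rM ?leq_maxl ?leq_maxr.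
Qed.

End UniformLimits.
(** * Feynman integrals and flows *)

Section FeynmanIntegral.
Variables (R : realType) (n m : nat) (G : graph n m).
Local Open Scope ring_scope.
Local Open Scope complex_scope.
Variables (tau : 'I_m -> R[i]) (y : 'I_n -> R).
Hypothesis y_inj : injective y.
Hypothesis y_small : forall i j k, `|y i - y j| < complex.Im (tau k).
Implicit Types (k : 'I_m) (t : 'I_n -> R) (N : nat).

Let height k : R := y (etail G k) - y (ehead G k).
Let offset k t : R := t (etail G k) - t (ehead G k).
Let position t : 'I_n -> R[i] := fun v => t v +i* y v.

(** The coefficients of the truncated Fourier expansion of the factor at the
edge [k], as a function of the difference of the real parts at its ends.  The
factor at a loop is constant. *)
Definition edge_coef k N (j : int) : R[i] :=
  if etail G k == ehead G k then (j == 0)%:R * - propagator 0 (tau k)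
  else fourier_coef (tau k) (height k) N j * echar (j%:~R * (0 +i* height k)).

Definition edge_sum k N t : R[i] :=
  symsum N (fun j => edge_coef k N j * echar (j%:~R * offset k t)%:C).

Lemma edge_sum_loop k N t : etail G k = ehead G k ->
  edge_sum k N t = - propagator 0 (tau k).
Proof.
move=> lk; rewrite /edge_sum symsum_pairs /edge_coef /offset lk eqxx subrr.
rewrite big1 => [|j _]; last by rewrite oppr_eq0/= !mul0r addr0.
by rewrite eqxx mulr1n mul1r mulr0 echar0 mulr1 addr0.
Qed.

Lemma position_sub k t :
  position t (etail G k) - position t (ehead G k) = offset k t +i* height k.
Proof. by []. Qed.

Lemma edge_sumE k N t : etail G k != ehead G k ->
  edge_sum k N t = fourier_sum (tau k) (height k) N (offset k t +i* height k).
Proof.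
move=> lk; apply: eq_bigr => i _; rewrite /edge_coef (negPf lk) -mulrA -echarD.
set j := _ - _; congr (_ * echar _).
by rewrite -!(rmorph_int (real_complex R)); simpc.
Qed.

Lemma edge_limit k : uniform_limit (edge_sum k)
  (fun t => - propagator (position t (etail G k) - position t (ehead G k)) (tau k)).
Proof.
have [lk|lk] := eqVneq (etail G k) (ehead G k).
  exists (fun=> 0); first exact: vanishing0.
  by exists 0%N => N t _; rewrite edge_sum_loop// lk !subrr modulus0.
have h0 : 0 < `|height k| < complex.Im (tau k).
  by rewrite normr_gt0 subr_eq0 (inj_eq y_inj) lk y_small.
have [r r0 rP] := propagator_fourier h0.
exists r => //; exists 0%N => N t _; rewrite edge_sumE// opprK position_sub.
exact: rP.
Qed.

Lemma modulus_echar_real (x : R) : modulus (echar x%:C) = 1.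
Proof. by rewrite modulus_echar/= mulr0 oppr0 expR0. Qed.

Lemma edge_sum_bounded k N : bounded_by (edge_sum k N)
  (\sum_(i < (2 * N).+1) modulus (edge_coef k N (i%:Z - N%:Z))).
Proof.
move=> t; rewrite (le_trans (modulus_sum _ _ _))// ler_sum// => i _.
by rewrite modulusM modulus_echar_real mulr1.
Qed.

(** The terms of the product of the truncated expansions are indexed by the
functions [J] with values in [[0, 2 * N]]. *)
Definition frequency N (J : {ffun 'I_m -> 'I_(2 * N).+1}) k : int :=
  (J k)%:Z - N%:Z.

Definition frequency_coef N (J : {ffun 'I_m -> 'I_(2 * N).+1}) : R[i] :=
  \prod_k edge_coef k N (frequency J k).

(** A term is constant in the positions of the vertices if its frequencies form
a flow. *)
Definition constant_term N : R[i] :=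
  \sum_(J : {ffun 'I_m -> 'I_(2 * N).+1} |
         [forall v, divergence G (frequency J) v == 0]) frequency_coef J.

Lemma echar_sum (I : finType) (f : I -> R) :
  \prod_i echar (f i)%:C = echar (\sum_i f i)%:C.
Proof.
symmetry; apply: (big_morph (fun x : R => echar x%:C)); last exact: echar0.
by move=> x z; rewrite -echarD rmorphD.
Qed.

(** Expanded, the product of the truncated expansions depends on the position of
[v] through the divergence at [v] of the frequencies. *)
Lemma prod_edge_sum N t : \prod_k edge_sum k N t =
  trigpoly (fun J : {ffun 'I_m -> 'I_(2 * N).+1} => divergence G (frequency J))
    (@frequency_coef N) t.
Proof.
rewrite bigA_distr_bigA; apply: eq_bigr => J _.
rewrite big_split/= echar_sum; congr (_ * echar _%:C).
under [RHS]eq_bigr do rewrite mulrzl; rewrite -sum_divergence.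
by apply: eq_bigr => k _; rewrite mulrzl.
Qed.

Lemma path_integral_limit : exists2 r, vanishing r & exists N0, forall N, (N0 <= N)%N ->
  modulus (path_integral y (feynman_integrand G tau) - constant_term N) <= r N.
Proof.
pose f t := feynman_integrand G tau (position t).
have t0 : 'I_n -> R := fun=> 0.
have fB k := uniform_limit_bounded (edge_sum_bounded k) (edge_limit k).
have /choice[B fB'] := fB.
have [_ [r r0 [N0 rP]]] := uniform_limit_prod t0 (index_enum 'I_m) fB' edge_limit.
have fr N t : (N0 <= N)%N -> modulus (f t - trigpoly
    (fun J : {ffun 'I_m -> 'I_(2 * N).+1} => divergence G (frequency J))
    (@frequency_coef N) t) <= r N.
  by move=> N0N; rewrite modulusBC -prod_edge_sum; exact: rP.
have apf : almost_periodic f.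
  move=> e /r0[M rM]; pose N := maxn N0 M.
  exists {ffun 'I_m -> 'I_(2 * N).+1}, (fun J => divergence G (frequency J)),
    (@frequency_coef N) => t.
  by rewrite (le_trans (fr N t (leq_maxl _ _)))// rM// leq_maxr.
exists (fun N => 2 ^+ n * r N); first by apply: vanishingZ; rewrite ?exprn_ge0.
exists N0 => N N0N; exact: cube_integral_approx apf (fun t => fr N t N0N).
Qed.

(** A flow has frequency [0] at a bridge, and the constant coefficient of the
propagator is [0]. *)
Lemma path_integral_bridge b : is_connected G -> bridge G b ->
  path_integral y (feynman_integrand G tau) = 0.
Proof.
move=> connG bG; have lb : etail G b != ehead G b.
  by have /(bridgeP connG) := bG; apply: contraNneq => ->; exact: connect0.
have [r r0 [N0 rP]] := path_integral_limit.
apply/eqP; rewrite -modulus_eq0 eq_le modulus_ge0 andbT.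
apply: vanishing_cst; apply: (@vanishing_le _ _ _ N0) r0 => N /rP.
rewrite [constant_term N]big1 ?subr0// => J /forallP J0.
have Jb : frequency J b = 0.
  by apply: (flow_bridge connG) => // v; exact/eqP.
rewrite /frequency_coef (bigD1 b)//= Jb /edge_coef (negPf lb) fourier_coef0.
by rewrite !mul0r.
Qed.

Hypothesis loopless : forall k, etail G k != ehead G k.
Hypothesis tauE : forall k, tau k = 0 +i* 1.

Let Q : R[i] := echar (0 +i* 1).

Lemma echar_imaginary_gt0 (a : R) : 0 < echar (0 +i* a).
Proof.
rewrite echarE mulr0 cos0 sin0 mulr1 ltcE/=.
by rewrite eqxx expR_gt0.
Qed.

Let edge_bound k (j : int) : R[i] :=
  (absz j)%:R * Q ^+ absz j * echar (j%:~R * (0 +i* height k)).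

Lemma echar_height_gt0 k (j : int) : 0 < echar (j%:~R * (0 +i* height k)).
Proof.
rewrite -(rmorph_int (real_complex R)) (_ : _ * _ = 0 +i* (j%:~R * height k)).
  exact: echar_imaginary_gt0.
by simpc.
Qed.

(** The character is positive on the imaginary axis. *)
Lemma edge_coef_ge0 k N (j : int) : 0 <= edge_coef k N j.
Proof.
rewrite /edge_coef (negPf (loopless k)) mulr_ge0 ?(ltW (echar_height_gt0 _ _))//.
rewrite /fourier_coef tauE mulr_ge0// addr_ge0// sumr_ge0// => i _.
by rewrite echarMn !exprn_ge0// ltW// echar_imaginary_gt0.
Qed.

(** The first term of the geometric series is a lower bound that does not depend
on the truncation. *)
Lemma edge_coef_ge k N (j : int) : (0 < N)%N -> edge_bound k j <= edge_coef k N j.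
Proof.
move=> N0; rewrite /edge_coef (negPf (loopless k)) /edge_bound.
rewrite ler_wpM2r ?(ltW (echar_height_gt0 _ _))// /fourier_coef tauE.
rewrite ler_wpM2l// (bigD1 (Ordinal N0))//= mul1r addrCA lerDl addr_ge0//.
rewrite sumr_ge0// => i _.
by rewrite echarMn !exprn_ge0// ltW// echar_imaginary_gt0.
Qed.

Lemma edge_bound_gt0 k (j : int) : j != 0 -> 0 < edge_bound k j.
Proof.
move=> j0; rewrite mulr_gt0 ?echar_height_gt0// mulr_gt0 ?ltr0n ?absz_gt0//.
by rewrite exprn_gt0// echar_imaginary_gt0.
Qed.

(** The term of the flow [s] alone bounds the constant terms below, uniformly in
the truncation. *)
Lemma path_integral_flow_gt0 (s : 'I_m -> int) : flow G s -> (forall k, s k != 0) ->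
  0 < complex.Re (path_integral y (feynman_integrand G tau)).
Proof.
move=> s_flow s0; have [r r0 [N0 rP]] := path_integral_limit.
pose c := \prod_k edge_bound k (s k).
have c0 : 0 < c by apply: prodr_gt0 => k _; exact: edge_bound_gt0.
(* from M on, the flow s is among the frequencies *)
pose M := (\sum_k absz (s k)).+1.
have cM N : (M <= N)%N -> c <= constant_term N.
  move=> MN; have sN k : (absz (s k + N%:Z)%R < (2 * N).+1)%N /\ (absz (s k) <= N)%N.
    have : (absz (s k) <= N)%N.
      by rewrite (leq_trans _ MN)// leqW// (bigD1 k)//= leq_addr.
    by move=> h; split=> //; lia.
  pose J : {ffun 'I_m -> 'I_(2 * N).+1} := [ffun k => Ordinal (sN k).1].
  have Js k : frequency J k = s k.
    by rewrite /frequency ffunE/=; have := (sN k).2; lia.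
  rewrite /constant_term (bigD1 J)/=; last first.
    apply/forallP => v; rewrite -(s_flow v); apply/eqP.
    by congr (_ - _); apply: eq_bigr => k _; exact: Js.
  rewrite -[c]addr0 lerD//; last first.
    by rewrite sumr_ge0// => J' _; apply: prodr_ge0 => k _; exact: edge_coef_ge0.
  apply: ler_prod => k _; rewrite ltW ?edge_bound_gt0//= Js.
  by apply: edge_coef_ge; exact: leq_trans MN.
have Rec : 0 < complex.Re c by have := c0; rewrite ltcE/= => /andP[].
have [|K rK] := r0 (complex.Re c / 2); first by rewrite divr_gt0.
pose N := maxn N0 (maxn M K).
have h := le_trans (modulus_Re _) (rP N (leq_maxl _ _)).
have rN : r N <= complex.Re c / 2 by rewrite rK// /N !leq_max leqnn !orbT.
have : complex.Re c <= complex.Re (constant_term N).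
  have := cM N; rewrite /N !leq_max leqnn !orbT => /(_ isT).
  by rewrite lecE => /andP[].
have ReB (v w : R[i]) : complex.Re (v - w) = complex.Re v - complex.Re w.
  by case: v; case: w.
move: h; rewrite ReB => h; have := le_trans h rN; rewrite ler_norml => /andP[+ _].
by move: Rec; lra.
Qed.

End FeynmanIntegral.
(** * The vanishing criterion *)

Section FeynmanGraph.
Variables (R : realType) (n m : nat) (G : graph n m).
Local Open Scope ring_scope.
Local Open Scope complex_scope.
Hypotheses (connG : is_connected G) (trivG : trivalent G).

Lemma feynman_integral_bridge b (tau : 'I_m -> R[i]) (y : 'S_n -> 'I_n -> R) :
  bridge G b -> (forall Omega, admissible tau Omega (y Omega)) ->
  feynman_integral G tau y = 0.
Proof.
move=> bG yP; rewrite /feynman_integral big1// => Omega _.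
by have [y_inj _ y_small] := yP Omega; exact: path_integral_bridge connG bG.
Qed.

(** Every order of the vertices contributes a positive real part, so nothing
cancels in the sum. *)
Lemma feynman_integral_neq0 (tau : 'I_m -> R[i]) (y : 'S_n -> 'I_n -> R) :
  (forall k, ~ bridge G k) -> (forall k, tau k = 0 +i* 1) ->
  (forall Omega, admissible tau Omega (y Omega)) ->
  feynman_integral G tau y != 0.
Proof.
move=> nobridge tauE yP; have [s s_flow s0] := nowhere_zero_flow connG nobridge.
have loopless := nowhere_zero_flow_loopless trivG s_flow s0.
pose I Omega := path_integral (y Omega) (feynman_integrand G tau).
have I_gt0 Omega : 0 < complex.Re (I Omega).
  have [y_inj _ y_small] := yP Omega.
  exact: (path_integral_flow_gt0 y_inj y_small loopless tauE s_flow).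
have ReE : complex.Re (\sum_Omega I Omega) = \sum_Omega complex.Re (I Omega).
  by apply: (big_morph (@complex.Re R)) => // -[? ?] [? ?].
apply/eqP => /(congr1 (@complex.Re R)); rewrite /feynman_integral ReE => /eqP.
rewrite gt_eqF// (bigD1 1%g)//= ltr_pwDl ?sumr_ge0// => Omega _.
exact: ltW.
Qed.

Lemma bridge_no_flow b : bridge G b -> forall f, flow G f -> exists k, f k = 0.
Proof. by move=> bG f f0; exists b; exact: (flow_bridge connG). Qed.

Lemma Ntrop_bridgeP (L : R) (p : 'I_n.+1 -> circle L) :
  0 < L -> (1 < n)%N -> injective p ->
  (forall a, Ntrop G p a = 0%E) <-> (exists k, bridge G k).
Proof.
move=> L0 n1 p_inj; split=> [N0|[b bG] a]; last first.
  exact/Ntrop0_no_flow/bridge_no_flow/bG.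
apply: contrapT => nob; have nobridge k : ~ bridge G k by move=> bG; apply: nob; exists k.
have [s s_flow s0] := nowhere_zero_flow connG nobridge.
have [k sk] := Ntrop_flow L0 n1 p_inj N0 s_flow.
by have := s0 k; rewrite sk eqxx.
Qed.

End FeynmanGraph.

Theorem corollary2p35 (R : realType) (g : nat) (hg : (1 < g)%N)
    (G : graph (2 * g - 2) (3 * g - 3)) (hG : feynman G)
    (L : R) (hL : 0 < L)
    (p : 'I_(2 * g - 2).+1 -> circle L) (hp : injective p)
    (y : ('I_(3 * g - 3) -> R[i]) -> 'S_(2 * g - 2) -> 'I_(2 * g - 2) -> R)
    (hy : forall tau, (forall k, upper_half (tau k)) ->
          forall Omega, admissible tau Omega (y tau Omega)) :
  ((forall a : 'I_(3 * g - 3) -> nat, Ntrop G p a = 0%E)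
     <-> (exists k, bridge G k)) /\
  ((forall a : 'I_(3 * g - 3) -> nat, Ntrop G p a = 0%E)
     <-> (forall tau : 'I_(3 * g - 3) -> R[i], (forall k, upper_half (tau k)) ->
            feynman_integral G tau (y tau) = 0)).
Proof.
have [connG trivG _] := hG; have n1 : (1 < 2 * g - 2)%N by lia.
have NP := Ntrop_bridgeP connG hL n1 hp.
split=> //; split=> [/NP[b bG] tau tau0|I0].
  exact: (feynman_integral_bridge connG bG (hy tau tau0)).
apply/NP; apply: contrapT => nob; have nobridge k : ~ bridge G k by move=> bG; apply: nob; exists k.
pose tau (_ : 'I_(3 * g - 3)) : R[i] := Complex 0 1.
have tau0 k : upper_half (tau k) by rewrite /upper_half/= ltr01.
have := feynman_integral_neq0 connG trivG nobridge (fun=> erefl) (hy tau tau0).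
by rewrite I0// eqxx.
Qed.
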